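(* There exists a nonconstant $u\in \mathcal{D}^{1,p}(\mathbb{R}^n)$ such that $$[u]_{C^{1-n/p}(\mathbb{R}^n)}= C_*\|Du\|_{L^p(\mathbb{R}^n)}.$$ In particular, $C_*>0$.
   Context: Throughout, $n\ge 1$ is an integer and $n<p<\infty$. $\mathcal{D}^{1,p}(\mathbb{R}^n)$ is the space of $u\in L^1_{\mathrm{loc}}(\mathbb{R}^n)$ whose weak first-order partial derivatives $u_{x_1},\dots,u_{x_n}$ all belong to $L^p(\mathbb{R}^n)$. Every such $u$ has a Hölder continuous representative and is always identified with it. Put $[u]_{C^{1-n/p}(\mathbb{R}^n)}:=\sup_{x\ne y}\frac{|u(x)-u(y)|}{|x-y|^{1-n/p}}$ and $\|Du\|_{L^p(\mathbb{R}^n)}:=\left(\int_{\mathbb{R}^n}|Du|^p\,dx\right)^{1/p}$. Morrey's inequality says there is a finite constant $C$ with $[u]_{C^{1-n/p}(\mathbb{R}^n)}\le C\|Du\|_{L^p(\mathbb{R}^n)}$ for all $u\in\mathcal{D}^{1,p}(\mathbb{R}^n)$; $C_*$ denotes the sharp (smallest) such constant. *)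

(* Defs.v *)
From HB Require Import structures.
From mathcomp Require Import all_boot all_order all_algebra.
From mathcomp Require Import all_classical all_reals all_analysis.
Set Implicit Arguments.
Unset Strict Implicit.
Unset Printing Implicit Defensive.
Import Order.TTheory GRing.Theory Num.Theory.
Import numFieldNormedType.Exports.
Local Open Scope classical_set_scope.
Local Open Scope ring_scope.

Definition rV_display : measure_display. Proof. exact. Qed.

Section measurable_rV.
Context (R : realType) (n : nat).

(* 'rV[R]_n gets the sigma-algebra generated by the coordinate functions, which
   is the Borel one; this is the library's construction for n.-tuple. *)
Definition rV_coord (i : 'I_n) (v : 'rV[R]_n) : measurableTypeR R := v ord0 i.

Let rV_set0 : g_sigma_preimage rV_coord set0.
Proof. exact: sigma_algebra0. Qed.

Let rV_setC A : g_sigma_preimage rV_coord A -> g_sigma_preimage rV_coord (~` A).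
Proof. exact: sigma_algebraC. Qed.

Let rV_bigcup (F : (set 'rV[R]_n)^nat) :
  (forall i, g_sigma_preimage rV_coord (F i)) ->
  g_sigma_preimage rV_coord (\bigcup_i (F i)).
Proof. exact: sigma_algebra_bigcup. Qed.

HB.instance Definition _ := @isMeasurable.Build rV_display
  'rV[R]_n (g_sigma_preimage rV_coord) rV_set0 rV_setC rV_bigcup.

End measurable_rV.


Section measurable_fun_rV.
Context (R : realType).

Lemma measurable_rV_coord n (i : 'I_n) : measurable_fun setT (@rV_coord R n i).
Proof.
move=> _ Y mY; apply: sub_sigma_algebra => /=.
by rewrite -bigcup_seq/=; exists i; [rewrite /= mem_index_enum|exists Y].
Qed.

Lemma measurable_fun_rVP d (T : measurableType d) n (f : T -> 'rV[R]_n) :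
  (forall i, measurable_fun setT (rV_coord i \o f)) -> measurable_fun setT f.
Proof.
move=> mf _ Y mY; rewrite setTI.
suff : g_sigma_preimage (@rV_coord R n) `<=`
    [set B | measurable (f @^-1` B)] by exact.
apply: smallest_sub.
  split; first by rewrite /= preimage_set0.
  - by move=> B mB /=; rewrite setTD preimage_setC; exact: measurableC.
  - by move=> F mF /=; rewrite preimage_bigcup; exact: bigcupT_measurable.
rewrite -bigcup_seq; apply: bigcup_sub => i _ _ [A mA <-] /=.
by rewrite setTI -comp_preimage -[X in measurable X]setTI; exact: mf.
Qed.

End measurable_fun_rV.

Section lebesgue_rV.
Context (R : realType).

Definition rV_cons n (z : measurableTypeR R * 'rV[R]_n) : 'rV[R]_n.+1 :=
  \row_i (if unlift ord0 i is Some j then z.2 ord0 j else z.1).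

Definition rV_uncons n (v : 'rV[R]_n.+1) : measurableTypeR R * 'rV[R]_n :=
  (v ord0 ord0, \row_j v ord0 (lift ord0 j)).

Lemma rV_consK n : cancel (@rV_cons n) (@rV_uncons n).
Proof.
move=> [x v]; rewrite /rV_uncons /rV_cons mxE unlift_none; congr pair.
by apply/rowP => j; rewrite !mxE liftK.
Qed.

Lemma measurable_rV_cons n : measurable_fun setT (@rV_cons n).
Proof.
apply: measurable_fun_rVP => i; case: (unliftP ord0 i) => [j|] ->.
- rewrite (_ : _ \o _ = rV_coord j \o snd).
    by apply: measurableT_comp => //; exact: measurable_rV_coord.
  by apply/funext => z /=; rewrite /rV_coord /rV_cons mxE liftK.
- rewrite (_ : _ \o _ = fst) //.
  by apply/funext => z /=; rewrite /rV_coord /rV_cons mxE unlift_none.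
Qed.

Lemma measurable_rV_uncons n : measurable_fun setT (@rV_uncons n).
Proof.
apply: measurable_fun_pair; first exact: (measurable_rV_coord ord0).
apply: measurable_fun_rVP => i.
rewrite (_ : _ \o _ = rV_coord (lift ord0 i)).
  exact: measurable_rV_coord.
by apply/funext => v /=; rewrite /rV_coord mxE.
Qed.

Section lebesgue_rV_cons.
Context n (mu : {sigma_finite_measure set 'rV[R]_n -> \bar R}).

Definition lebesgue_rV_cons : set 'rV[R]_n.+1 -> \bar R :=
  pushforward (lebesgue_measure \x mu)%E (@rV_cons n).

HB.instance Definition _ := Measure.copy lebesgue_rV_cons
  (measure_function_pushforward__canonical__measure_function_Measure
     (lebesgue_measure \x mu)%E (@measurable_rV_cons n)).

(* Reproved from the factors: on a product measure, the library's instance for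
   sub-probabilities takes precedence over the sigma-finite one. *)
Let lebesgue_rV_cons_sigma_finite : sigma_finite setT lebesgue_rV_cons.
Proof.
pose leb : {sigma_finite_measure set (measurableTypeR R) -> \bar R} :=
  lebesgue_measure.
have /sigma_finiteP[F [FT ndF Foo]] := sigma_finiteT leb.
have /sigma_finiteP[G [GT ndG Goo]] := sigma_finiteT mu.
exists (fun k => @rV_uncons n @^-1` (F k `*` G k)).
  rewrite -preimage_bigcup (_ : \bigcup_k _ = setT) ?preimage_setT//.
  apply/seteqP; split=> // -[x y] _.
  have [i _ Fix] : (\bigcup_k F k) x by rewrite -FT.
  have [j _ Gjy] : (\bigcup_k G k) y by rewrite -GT.
  exists (maxn i j) => //; split => /=.
    by move: x Fix; exact/subsetPset/ndF/leq_maxl.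
  by move: y Gjy; exact/subsetPset/ndG/leq_maxr.
move=> k; have [mF Fkoo] := Foo k; have [mG Gkoo] := Goo k; split.
  rewrite -[X in measurable X]setTI; apply: measurable_rV_uncons => //.
  exact: measurableX.
rewrite /lebesgue_rV_cons /pushforward -comp_preimage.
rewrite (_ : _ \o _ = id); last by apply/funext => z /=; rewrite rV_consK.
rewrite preimage_id (_ : lebesgue_measure = leb)//.
by rewrite product_measure1E// lte_mul_pinfty// ge0_fin_numE.
Qed.

HB.instance Definition _ := Measure_isSigmaFinite.Build _ _ _
  lebesgue_rV_cons lebesgue_rV_cons_sigma_finite.

End lebesgue_rV_cons.

(* Lebesgue measure on R^n as an iterated product of lebesgue_measure. *)
Fixpoint lebesgue_rV n : {sigma_finite_measure set 'rV[R]_n -> \bar R} :=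
  match n with
  | 0 => \d_(0 : 'rV[R]_0)
  | m.+1 => lebesgue_rV_cons (lebesgue_rV m)
  end.

End lebesgue_rV.

Arguments lebesgue_rV R n : clear implicits.

Section weak_derivatives.
Context (R : realType) (n : nat).
Implicit Types (u g phi : 'rV[R]_n -> R) (Du : 'rV[R]_n -> 'rV[R]_n).

Local Notation mu := (lebesgue_rV R n).

(* The library's norm on 'rV[R]_n is the sup norm; it is only used below
   through the topology. *)
Definition enorm (v : 'rV[R]_n) : R := Num.sqrt (\sum_i v ord0 i ^+ 2).

Definition basis_vec (i : 'I_n) : 'rV[R]_n := delta_mx ord0 i.

Definition iter_partial (s : seq 'I_n) phi : 'rV[R]_n -> R :=
  foldr (fun i f => 'D_(basis_vec i) f) phi s.

Definition smooth phi := forall s : seq 'I_n,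
  continuous (iter_partial s phi) /\
  forall i x, derivable (iter_partial s phi) x (basis_vec i).

Definition test_function phi :=
  smooth phi /\ compact (closure [set x | phi x != 0]).

Definition L1loc u := measurable_fun setT u /\
  forall K : set 'rV[R]_n, compact K -> mu.-integrable K (EFin \o u).

Definition weak_partial (i : 'I_n) u g := forall phi, test_function phi ->
  (\int[mu]_x (u x * 'D_(basis_vec i) phi x) = - \int[mu]_x (g x * phi x))%R.

(* Determines Du up to a null set. *)
Definition weak_gradient u Du := forall i : 'I_n,
  L1loc (fun x => Du x ord0 i) /\ weak_partial i u (fun x => Du x ord0 i).

(* Elements of D^{1,p} are identified with their continuous representative,
   whence the continuity requirement. *)
Definition D1p (p : R) u := [/\ continuous u, L1loc u &
  forall i : 'I_n, exists2 g, g \in Lfun mu p%:E & weak_partial i u g].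

Definition normDu (p : R) Du : \bar R :=
  Lnorm mu p%:E (fun x => (enorm (Du x))%:E).

Definition holder_seminorm (a : R) u : \bar R :=
  ereal_sup [set (`|u z.1 - u z.2| / enorm (z.1 - z.2) `^ a)%:E |
             z in [set z : 'rV[R]_n * 'rV[R]_n | z.1 != z.2]].

Definition morrey_seminorm (p : R) u : \bar R :=
  holder_seminorm (1 - n%:R / p) u.

End weak_derivatives.

Definition morrey_inequality (R : realType) (n : nat) (p C : R) :=
  forall (u : 'rV[R]_n -> R) (Du : 'rV[R]_n -> 'rV[R]_n),
    D1p p u -> weak_gradient u Du ->
    (morrey_seminorm p u <= C%:E * normDu p Du)%E.

(* By Morrey's inequality the set is nonempty, and its infimum belongs to it. *)
Definition sharp_morrey_constant (R : realType) (n : nat) (p : R) : R :=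
  inf [set C : R | morrey_inequality n p C].

(* Main.v *)
Require Import Defs.
From HB Require Import structures.
From mathcomp Require Import all_boot all_order all_algebra.
From mathcomp Require Import all_classical all_reals all_analysis.
From mathcomp Require Import measurable_realfun ring lra.
Import Order.TTheory GRing.Theory Num.Theory.
Import numFieldNormedType.Exports.
Set Implicit Arguments.
Unset Strict Implicit.
Unset Printing Implicit Defensive.
Local Open Scope classical_set_scope.
Local Open Scope ring_scope.

(** Morrey's inequality is obtained without mollification. For a product bump
    [eta] and [x] in the unit cube, [eta(y) - 2^n eta(2y - x)] is a sum of
    partial derivatives of test functions, so the averages against [eta] of [u]
    and of [u] composed with [y |-> (x + y) / 2] differ by at most a multiple of
    [|Du|_p]. That composition multiplies [|Du|_p] by [2^-(1 - n/p) < 1];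
    iterating it, the averages tend to a multiple of [u(x)], and the errors form
    a geometric series.

    For the extremal, scaling and translation reduce to functions with
    [u(0) = 0], [u(omega) = 1] and [|omega| = 1], whose infimal [|Du|_p] is
    [m = 1 / C_*]; compactness of the sphere allows one fixed direction [omega].
    These functions form a convex set, so uniform convexity makes the gradients
    of a minimizing sequence Cauchy in [L^p]; the sharp inequality then makes the
    functions themselves converge, to a function with [|Du|_p = m]. The constant
    is positive because the bump is not constant. *)

(** * Affine change of variables *)

(** The halving map suits the bump because it sends the cube of half-side 1 into itself whenever [x]
    belongs to that cube. The bumps at scale 1 and at scale 1/2 are then both supported in this
    cube, and so are the antiderivatives that write their difference as a divergence. The bump is a
    tensor product so that these antiderivatives are explicit.

    No weak compactness is used for the extremal. The midpoint of two competitors is again a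
    competitor, so its energy cannot fall below [m^p], whereas a large difference between the two
    gradients would force such a fall. Near-minimizers are therefore close to each other. The
    pointwise inequality behind this follows from compactness in [R^n] and homogeneity, which treats
    all [p > 1] at once. The limit of the gradients is then built almost everywhere along increments
    of energy at most [4^-k], and Fatou's lemma carries the energy bounds to it. *)

Section affine_change_of_variables.
Context (R : realType).

Definition affine_rV n (a : 'rV[R]_n) (r : R) (y : 'rV[R]_n) := a + r *: y.

Lemma measurable_affine_rV n (a : 'rV[R]_n) r :
  measurable_fun setT (affine_rV a r).
Proof.
apply: measurable_fun_rVP => i.
rewrite (_ : _ \o _ = (fun t => a ord0 i + r * t) \o rV_coord i).
  apply: measurableT_comp; last exact: measurable_rV_coord.
  by apply: measurable_funD => //; apply: measurable_funM.
by apply/funext => v /=; rewrite /rV_coord /affine_rV !mxE.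
Qed.

Let line (a r : R) (x : measurableTypeR R) : measurableTypeR R := a + r * x.

Let mline (a r : R) : measurable_fun setT (line a r).
Proof. by apply: measurable_funD => //; apply: measurable_funM. Qed.

(** The rescaled pushforward agrees with Lebesgue measure on half-open intervals, which determine
    the latter. *)
Let lebesgue_measure_line (a r : R) A : 0 < r -> measurable A ->
  lebesgue_measure A = (r%:E * lebesgue_measure (line a r @^-1` A))%E.
Proof.
move=> r0 mA.
pose m := mscale (NngNum (ltW r0))
  (measure_function_pushforward__canonical__measure_function_Measure
    (@lebesgue_measure R) (mline a r)).
apply: (@lebesgue_measure_unique R m) => // X -[[x y] /= _ <-].
rewrite /m /mscale /= /pushforward.
rewrite (_ : line a r @^-1` _ = [set` `](x - a) / r, (y - a) / r]]); last first.
  apply/seteqP; split => z /=; rewrite !in_itv/= /line.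
    by rewrite ltr_pdivrMr// ler_pdivlMr// ltrBlDl lerBrDl [z * r]mulrC.
  by rewrite ltr_pdivrMr// ler_pdivlMr// ltrBlDl lerBrDl [z * r]mulrC.
rewrite !lebesgue_measure_itv/= !lte_fin ltr_pM2r ?invr_gt0// ltrD2r.
case: ifPn => xy; last by rewrite mule0.
by rewrite -!EFinD -EFinM; congr EFin; field; rewrite gt_eqF.
Qed.

Let ge0_integral_line (a r : R) (f : measurableTypeR R -> \bar R) : 0 < r ->
  measurable_fun setT f -> (forall x, 0 <= f x)%E ->
  (\int[lebesgue_measure]_x f x =
   r%:E * \int[lebesgue_measure]_x f (line a r x))%E.
Proof.
move=> r0 mf f0.
pose pf := measure_function_pushforward__canonical__measure_function_Measure
    (@lebesgue_measure R) (mline a r).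
pose m := mscale (NngNum (ltW r0)) pf.
rewrite (@eq_measure_integral _ _ _ setT m); last first.
  by move=> A mA _; apply: lebesgue_measure_line.
rewrite ge0_integral_mscale// ge0_integral_pushforward//.
Qed.

(** Induction on the dimension: the first coordinate accounts for one factor [r], and each slice is
    an affine preimage with the truncated shift [a']. *)
Lemma lebesgue_rV_affine n (a : 'rV[R]_n) r A : 0 < r -> measurable A ->
  lebesgue_rV R n A = ((r ^+ n)%:E * lebesgue_rV R n (affine_rV a r @^-1` A))%E.
Proof.
move=> r0; elim: n a A => [|n IH] a A mA.
  rewrite expr0 mul1e /=; congr (\d_ _ _).
  by apply/funext => x /=; rewrite /preimage/= (thinmx0 (affine_rV _ _ _)) (thinmx0 x).
rewrite /= /lebesgue_rV_cons /pushforward /product_measure1.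
set mu := lebesgue_rV R n.
have mB : measurable (@rV_cons R n @^-1` A).
  by rewrite -[X in measurable X]setTI; exact: measurable_rV_cons.
set a' : 'rV[R]_n := \row_j a ord0 (lift ord0 j).
rewrite (@ge0_integral_line (a ord0 ord0) r)//; last first.
  exact: measurable_fun_xsection.
rewrite exprS EFinM -muleA; congr (_ * _)%E.
rewrite -ge0_integralZl//; last 2 first.
- apply: measurable_fun_xsection => //.
  rewrite -[X in measurable X]setTI; apply: measurable_rV_cons => //.
  by rewrite -[X in measurable X]setTI; apply: measurable_affine_rV.
- by rewrite lee_fin exprn_ge0// ltW.
apply: eq_integral => x _ /=.
rewrite (IH a'); last exact: measurable_xsection.
congr (_ * mu _)%E; apply/funext => y.
rewrite /preimage/= /xsection /= !inE/=; congr (A _).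
apply/rowP => i; rewrite /rV_cons !mxE.
by case: unliftP => [j|] -> //; rewrite !mxE.
Qed.

Lemma ge0_integral_affine n (a : 'rV[R]_n) r (f : 'rV[R]_n -> \bar R) : 0 < r ->
  measurable_fun setT f -> (forall x, 0 <= f x)%E ->
  (\int[lebesgue_rV R n]_x f x =
   (r ^+ n)%:E * \int[lebesgue_rV R n]_x f (affine_rV a r x))%E.
Proof.
move=> r0 mf f0.
pose pf := measure_function_pushforward__canonical__measure_function_Measure
    (lebesgue_rV R n) (measurable_affine_rV a r).
pose m := mscale (NngNum (ltW (exprn_gt0 n r0))) pf.
rewrite (@eq_measure_integral _ _ _ setT m); last first.
  by move=> A mA _; apply: lebesgue_rV_affine.
by rewrite ge0_integral_mscale// ge0_integral_pushforward//; exact: measurable_affine_rV.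
Qed.

Lemma integrable_affine n (a : 'rV[R]_n) r (f : 'rV[R]_n -> \bar R) : 0 < r ->
  (lebesgue_rV R n).-integrable setT f ->
  (lebesgue_rV R n).-integrable setT (f \o affine_rV a r).
Proof.
move=> r0 /integrableP[mf foo]; apply/integrableP; split.
  by apply: measurableT_comp => //; exact: measurable_affine_rV.
move: foo; rewrite (@ge0_integral_affine n a r)//; last exact: measurableT_comp.
have rn : 0 < r ^+ n by exact: exprn_gt0.
rewrite -lte_pdivlMl// => /lt_le_trans; apply.
by rewrite mulry gtr0_sg ?invr_gt0// mul1e.
Qed.

Lemma Rintegral_affine n (a : 'rV[R]_n) r (f : 'rV[R]_n -> R) : 0 < r ->
  (lebesgue_rV R n).-integrable setT (EFin \o f) ->
  \int[lebesgue_rV R n]_x f x =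
   r ^+ n * \int[lebesgue_rV R n]_x f (affine_rV a r x).
Proof.
move=> r0 intf; have mf := measurable_int _ intf.
have intg := integrable_affine a r0 intf.
rewrite /Rintegral.
rewrite [in LHS]integralE [in RHS]integralE.
rewrite (@ge0_integral_affine n a r _ r0 (measurable_funepos mf))//.
rewrite (@ge0_integral_affine n a r _ r0 (measurable_funeneg mf))//.
have Ip : (\int[lebesgue_rV R n]_x (EFin \o f)^\+ (affine_rV a r x))%E \is a fin_num.
  have := @integrable_pos_fin_num _ _ _ (lebesgue_rV R n) _ measurableT _ intg.
  by rewrite funepos_comp.
have In : (\int[lebesgue_rV R n]_x (EFin \o f)^\- (affine_rV a r x))%E \is a fin_num.
  have := @integrable_neg_fin_num _ _ _ (lebesgue_rV R n) _ measurableT _ intg.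
  by rewrite funeneg_comp.
have E (I J : \bar R) : I \is a fin_num -> J \is a fin_num ->
    fine ((r ^+ n)%:E * I - (r ^+ n)%:E * J) = r ^+ n * fine (I - J).
  by move=> /fineK <- /fineK <-; rewrite -!EFinM -!EFinB /= mulrBr.
rewrite (E _ _ Ip In); congr (_ * fine (_ - _)); apply: eq_integral => x _.
  by rewrite !funeposE.
by rewrite !funenegE.
Qed.

End affine_change_of_variables.

(** * Borel measurability of open sets and continuous functions *)

Section borel_rV.
Context (R : realType) (n : nat).

Lemma measurable_ball_rV (x : 'rV[R]_n) e : measurable (ball x e).
Proof.
have [e0|e0] := leP e 0.
  rewrite (_ : ball x e = set0)//; apply/seteqP; split => // y [].
  by rewrite ltNge e0.
rewrite (_ : ball x e = \bigcap_(i in [set: 'I_n])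
    (@rV_coord R n i @^-1` ball (x ord0 i) e)); last first.
  apply/seteqP; split => y.
    by move=> [_ xy] i _; exact: xy.
  by move=> xy; split => // i j; rewrite ord1; exact: xy.
apply: fin_bigcap_measurable => // i _.
rewrite -[X in measurable X]setTI; apply: measurable_rV_coord => //.
exact: measurable_ball.
Qed.

(** Balls of the sup norm are boxes, hence measurable for the sigma-algebra of the coordinates. An
    open set is the countable union of the balls it contains that have a rational centre and radius
    [1/(k+1)]. *)
Lemma open_measurable_rV (A : set 'rV[R]_n) : open A -> measurable A.
Proof.
move=> oA.
pose F (z : 'rV[rat]_n * nat) : set 'rV[R]_n :=
  if `[< ball (map_mx ratr z.1 : 'rV[R]_n) z.2.+1%:R^-1 `<=` A >]
  then ball (map_mx ratr z.1 : 'rV[R]_n) z.2.+1%:R^-1 else set0.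
rewrite (_ : A = \bigcup_z F z); last first.
  apply/seteqP; split => [x Ax|x [z _]]; last first.
    by rewrite /F; case: asboolP => // zA; exact: zA.
  have /nbhs_ballP[e /= e0 xeA] : nbhs x A by exact: open_nbhs_nbhs.
  have [k ke] : exists k : nat, k.+1%:R^-1 < e / 2.
    have e20 : 0 < e / 2 by rewrite divr_gt0.
    have [k _ /(_ k (leqnn k))/= ke] := near_infty_natSinv_lt (PosNum e20).
    by exists k.
  have k0 : (0 : R) < k.+1%:R^-1 by rewrite invr_gt0.
  have /choice[q qx] : forall i : 'I_n, exists q : rat,
      ball (x ord0 i) (k.+1%:R^-1) (ratr q).
    move=> i; have [|y [xr [q _ qy]]] :=
      @dense_rat R (ball (x ord0 i) (k.+1%:R^-1)) _ (@ball_open _ _ _ _).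
      by exists (x ord0 i); exact: ballxx.
    by exists q; rewrite qy.
  have xF : ball (map_mx ratr (\row_i q i) : 'rV[R]_n) k.+1%:R^-1 x.
    by split => // i j; rewrite ord1 !mxE; apply: ball_sym; exact: qx.
  exists (\row_i q i, k) => //; rewrite /F/=; case: asboolP => [_|nF]; first exact: xF.
  exfalso; apply: nF => y yF; apply: xeA.
  have := ball_triangle (ball_sym xF) yF; apply: le_ball.
  by rewrite [leRHS]splitr lerD// ltW.
apply: countable_bigcupT_measurable; first exact: countableP.
by move=> z; rewrite /F; case: asboolP => // _; exact: measurable_ball_rV.
Qed.

Lemma continuous_measurable_rV (f : 'rV[R]_n -> R) :
  continuous f -> measurable_fun setT f.
Proof.
move=> cf; apply: (measurability _ (RGenOpens.measurableE R)) => _ [_ [a [b ->] <-]].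
rewrite setTI; apply: open_measurable_rV; apply: open_comp => [x _|]; first exact: cf.
exact: interval_open.
Qed.

End borel_rV.

(** * Cubes and integrability on compact sets *)

Section cube.
Context (R : realType).

(** Described by coordinates rather than as a ball of the sup norm (see [cubeP]), so that volumes
    and supports of product functions are handled one coordinate at a time. *)
Definition cube n (M : R) : set 'rV[R]_n := [set v | forall i, `|v ord0 i| <= M].

Lemma cubeP n M (v : 'rV[R]_n) : 0 <= M -> cube M v <-> `|v| <= M.
Proof.
move=> M0; split => [vM|vM i]; last first.
  apply: le_trans vM; rewrite [leRHS]mx_normrE.
  exact: (le_bigmax _ (fun ij : 'I_1 * 'I_n => `|v ij.1 ij.2|) (ord0, i)).
rewrite [leLHS]mx_normrE; apply: bigmax_le => //= -[i j] _ /=.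
by rewrite ord1; exact: vM.
Qed.

Lemma compact_cube n M : compact (@cube n M).
Proof.
rewrite (_ : cube M = [set v : 'rV[R]_n | forall i, `[- M, M]%classic (v ord0 i)]).
  by apply: (@rV_compact _ _ (fun=> `[- M, M]%classic)) => i; exact: segment_compact.
by apply/seteqP; split => v /= h i; have := h i; rewrite in_itv/= ler_norml.
Qed.

Lemma measurable_cube n M : measurable (@cube n M).
Proof.
rewrite -[cube M]setCK; apply: measurableC; apply: open_measurable_rV.
rewrite openC; apply: compact_closed (@compact_cube n M).
exact: norm_hausdorff.
Qed.

Lemma lebesgue_rV_cube n M : 0 <= M ->
  lebesgue_rV R n (cube M) = ((M *+ 2) ^+ n)%:E.
Proof.
move=> M0; elim: n => [|n IH].
  by rewrite expr0 /= diracE mem_set// => -[].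
have mI : measurable (`[- M, M]%classic : set (measurableTypeR R)) by [].
have mC := @measurable_cube n M.
rewrite /= /lebesgue_rV_cons /pushforward.
rewrite (_ : _ @^-1` _ = `[- M, M]%classic `*` cube M); last first.
  apply/seteqP; split => -[x v].
    move=> h; split.
      by have := h ord0; rewrite /rV_cons mxE unlift_none/= in_itv/= ler_norml.
    by move=> i; have := h (lift ord0 i); rewrite /rV_cons mxE liftK.
  move=> [/= xM vM] i; rewrite /rV_cons mxE; case: unliftP => [j|] _ //=.
  by move: xM; rewrite in_itv/= ler_norml.
rewrite product_measure1E//; rewrite [X in (_ * X)%E]IH exprS EFinM.
congr (_ * _)%E; apply: (etrans (lebesgue_measure_itv `[- M, M])).
rewrite /= lte_fin; case: ltP => [_|M0'].
  by rewrite -EFinB opprK mulr2n.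
have -> : M = 0 by apply/eqP; rewrite eq_le M0; lra.
by rewrite mul0rn.
Qed.

Lemma lebesgue_rV_cube_lty n M : (lebesgue_rV R n (cube M) < +oo)%E.
Proof.
apply: (@le_lt_trans _ _ (lebesgue_rV R n (cube `|M|))).
  apply: le_measure; rewrite ?inE; [exact: measurable_cube..|].
  by move=> v vM i; apply: le_trans (vM i) _; exact: ler_norm.
by rewrite lebesgue_rV_cube// ltry.
Qed.

Lemma compact_sub_cube n (K : set 'rV[R]_n) : compact K ->
  exists2 M, 0 < M & K `<=` cube M.
Proof.
move=> /compact_bounded[M [_ /(_ (`|M| + 1))]] h.
exists (`|M| + 1); first by rewrite ltr_wpDl.
move=> v Kv; apply/cubeP; first by rewrite addr_ge0.
by apply: h => //; rewrite (le_lt_trans (ler_norm _))// ltrDl.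
Qed.

Lemma compact_measurable_rV n (K : set 'rV[R]_n) : compact K -> measurable K.
Proof.
move=> cK; rewrite -[K]setCK; apply: measurableC; apply: open_measurable_rV.
by rewrite openC; apply: compact_closed cK; exact: norm_hausdorff.
Qed.

Lemma bounded_integrable d (T : measurableType d)
    (mu : {measure set T -> \bar R}) (f : T -> R) A C :
  measurable A -> (mu A < +oo)%E -> measurable_fun A f ->
  (forall x, A x -> `|f x| <= C) -> mu.-integrable A (EFin \o f).
Proof.
move=> mA Aoo mf fC; apply: measurable_bounded_integrable => //.
exists C; split; first exact: num_real.
by move=> D CD x Ax; apply: le_trans (fC _ Ax) (ltW CD).
Qed.

Lemma continuous_bounded_compact n (f : 'rV[R]_n -> R) K :
  continuous f -> compact K -> exists2 C, 0 <= C & forall x, K x -> `|f x| <= C.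
Proof.
move=> cf cK; have [->|/set0P K0] := eqVneq K set0; first by exists 0.
have cnf : {within K, continuous (fun x => `|f x|)}.
  apply: continuous_subspaceT => x; apply: continuous_comp; first exact: cf.
  exact: norm_continuous.
have [c cK' cmax] := EVT_max_rV K0 cK cnf.
by exists `|f c| => // x Kx; apply: cmax; rewrite inE.
Qed.

Lemma compact_lty n (K : set 'rV[R]_n) : compact K -> (lebesgue_rV R n K < +oo)%E.
Proof.
move=> cK; have [M M0 KM] := compact_sub_cube cK.
apply: le_lt_trans (lebesgue_rV_cube_lty n M).
apply: le_measure; rewrite ?inE//; [exact: compact_measurable_rV|exact: measurable_cube].
Qed.

Lemma continuous_integrable_compact n (f : 'rV[R]_n -> R) K :
  continuous f -> compact K ->
  (lebesgue_rV R n).-integrable K (EFin \o f).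
Proof.
move=> cf cK; have [C _ fC] := continuous_bounded_compact cf cK.
apply: (@bounded_integrable _ _ _ _ _ C) => //; [exact: compact_measurable_rV|exact: compact_lty|].
by apply: measurable_funTS; exact: continuous_measurable_rV.
Qed.

Lemma integrable_outside0 d (T : measurableType d)
    (mu : {measure set T -> \bar R}) (f : T -> R) A : measurable A ->
  (forall x, ~ A x -> f x = 0) -> mu.-integrable A (EFin \o f) ->
  mu.-integrable setT (EFin \o f).
Proof.
move=> mA f0 fA.
rewrite (_ : EFin \o f = (EFin \o f) \_ A); first by rewrite -integrable_mkcond.
apply/funext => x; rewrite /patch; case: ifPn => // xA /=.
by rewrite f0// => xA'; move: xA; rewrite mem_set.
Qed.

End cube.

(** * Smooth step and test functions *)

Section smooth_functions_of_one_variable.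
Context (R : realType).
Implicit Types (f g : R -> R).

(** The derivative is a witness related to [f] by [is_derive], so that closure under sums, products
    and inverses follows by induction on [k] from explicit formulas. *)
Fixpoint Ck k f : Prop :=
  if k is m.+1 then
    exists2 f', (forall x : R, is_derive x (1 : R) f (f' x)) & Ck m f'
  else True.

Definition smooth1 f := forall k, Ck k f.

Lemma Ck_le k f : Ck k.+1 f -> Ck k f.
Proof.
elim: k f => // k IH f [f' ff' /IH f'k]; by exists f'.
Qed.

Lemma Ck_cst k c : Ck k (fun=> c).
Proof.
elim: k c => // k IH c; exists (fun=> 0) => // x.
exact: is_derive_cst.
Qed.

Lemma CkD k f g : Ck k f -> Ck k g -> Ck k (fun x => f x + g x).
Proof.
elim: k f g => // k IH f g [f' ff' f'k] [g' gg' g'k].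
by exists (fun x => f' x + g' x); [move=> x; exact: is_deriveD|exact: IH].
Qed.

Lemma CkM k f g : Ck k f -> Ck k g -> Ck k (fun x => f x * g x).
Proof.
elim: k f g => // k IH f g fk gk.
have [f' ff' f'k] := fk; have [g' gg' g'k] := gk.
exists (fun x => f x * g' x + g x * f' x).
  move=> x; have := @is_deriveM _ _ f g x 1 _ _ (ff' x) (gg' x).
  by [].
by apply: CkD; apply: IH => //; exact: Ck_le.
Qed.

Lemma CkV k f : (forall x, f x != 0) -> Ck k f -> Ck k (fun x => (f x)^-1).
Proof.
move=> f0; elim: k f f0 => // k IH f f0 fk.
have [f' ff' f'k] := fk.
exists (fun x => -1 * (((f x)^-1 * (f x)^-1) * f' x)).
  move=> x; have := @is_deriveV _ f x _ 1 (f0 x) (ff' x).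
  by rewrite /GRing.scale/= mulN1r mulNr expr2 invfM.
apply: CkM; first exact: Ck_cst.
by apply: CkM => //; apply: CkM; apply: IH => //; exact: Ck_le.
Qed.

Lemma Ck_affine k f a r : Ck k f -> Ck k (fun x => f (a + r * x)).
Proof.
elim: k f => // k IH f [f' ff' f'k].
exists (fun x => r * f' (a + r * x)).
  move=> x; have h : is_derive x 1 (fun x => a + r * x) r.
    have := is_deriveD (is_derive_cst a x 1) (is_deriveZ r (is_derive_id x 1)).
    by rewrite add0r /GRing.scale/= mulr1.
  by rewrite mulrC; exact: (is_derive1_comp (ff' _) h).
by apply: CkM; [exact: Ck_cst|exact: IH].
Qed.

Lemma smooth1_derive f : smooth1 f ->
  (forall x : R, is_derive x (1 : R) f (derive1 f x)) /\ smooth1 (derive1 f).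
Proof.
move=> fs; have h x : is_derive x (1 : R) f (derive1 f x).
  have [f' ff' _] := fs 1%N.
  by rewrite derive1E (@derive_val _ _ _ _ _ _ _ (ff' x)).
split => // k; have [f' ff' f'k] := fs k.+1.
rewrite (_ : derive1 f = f') //; apply/funext => x.
by rewrite derive1E (@derive_val _ _ _ _ _ _ _ (ff' x)).
Qed.

Lemma is_derive_continuous f (df : R) (x : R) : is_derive x (1 : R) f df -> {for x, continuous f}.
Proof. by move=> [fx _]; apply/differentiable_continuous/derivable1_diffP. Qed.

Lemma smooth1_continuous f : smooth1 f -> continuous f.
Proof.
move=> /smooth1_derive[h _] x; exact: (is_derive_continuous (h x)).
Qed.

End smooth_functions_of_one_variable.

Section smooth_step.
Context (R : realType).

(* The exponent [k] makes the family closed under differentiation. *)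
Definition flat k (t : R) : R := if 0 < t then t^-1 ^+ k * expR (- t^-1) else 0.

Lemma flat_ge0 k t : 0 <= flat k t.
Proof.
rewrite /flat; case: ifP => // t0; rewrite mulr_ge0// ?expR_ge0//.
by rewrite exprn_ge0// invr_ge0 ltW.
Qed.

Lemma flat_le0 k t : t <= 0 -> flat k t = 0.
Proof. by move=> t0; rewrite /flat ltNge t0. Qed.

Lemma flat_gt0 k t : 0 < t -> 0 < flat k t.
Proof. by move=> t0; rewrite /flat t0 mulr_gt0 ?expR_gt0 ?exprn_gt0 ?invr_gt0. Qed.

(** With [s = 1/t], [expR s] is the [k]-th power of [expR (s/k)], which is at least [s/k]. *)
Lemma flat_ub k t : flat k t <= k%:R ^+ k.
Proof.
rewrite /flat; case: ifP => t0; last by rewrite exprn_ge0.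
case: k => [|k].
  by rewrite !expr0 mul1r -[leRHS]expR0 ler_expR oppr_le0 invr_ge0 ltW.
rewrite expRN ler_pdivrMr ?expR_gt0//.
rewrite [X in expR X](_ : _ = t^-1 / k.+1%:R * k.+1%:R); last by rewrite divfK.
rewrite expRM_natr -exprMn; apply: lerXn2r; rewrite ?nnegrE.
- by rewrite invr_ge0 ltW.
- by rewrite mulr_ge0 ?expR_ge0.
- rewrite mulrC -ler_pdivrMr ?ltr0n//; apply: le_trans (expR_ge1Dx _).
  by rewrite lerDr.
Qed.

(** [flat k t] is [t ^+ 2] times [flat k.+2 t], and the latter is bounded. The quadratic decay gives
    the zero derivative at 0. *)
Lemma flat_sqr k t : flat k t <= k.+2%:R ^+ k.+2 * t ^+ 2.
Proof.
have [t0|t0] := leP t 0; first by rewrite flat_le0// mulr_ge0 ?sqr_ge0// exprn_ge0.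
rewrite -ler_pdivrMr ?exprn_gt0//; apply: le_trans (flat_ub k.+2 t).
by rewrite /flat t0 -exprVn mulrAC -exprD addn2.
Qed.

Let is_derive_quadratic (C : R) (f : R -> R) : f 0 = 0 ->
  (forall t, `|f t| <= C * t ^+ 2) -> is_derive (0 : R) (1 : R) f 0.
Proof.
move=> f0 fC; apply/is_derive1_caratheodory.
(* Since [0^-1] is 0, the difference quotient already has the wanted value 0 at the origin. *)
exists (fun t => f t / t); split; last by rewrite invr0 mulr0.
  move=> t; rewrite f0 !subr0; have [->|t0] := eqVneq t 0.
    by rewrite f0 mulr0.
  by rewrite divfK.
rewrite /prop_for /continuous_at /= invr0 mulr0; apply: norm_cvg0.
apply: (@squeeze_cvgr _ _ _ _ (cst 0) (fun t => C * `|t|)); last 2 first.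
- exact: cvg_cst.
- have : {for (0 : R), continuous (fun t : R => C * `|t|)}.
    apply: (@continuousM _ _ (cst C) (fun t : R => `|t|)); first exact: cst_continuous.
    exact: norm_continuous.
  by rewrite /prop_for /continuous_at normr0 mulr0.
apply: nearW => t; rewrite normr_ge0/= normrM normfV.
have [->|t0] := eqVneq t 0; first by rewrite normr0 invr0 !mulr0.
rewrite ler_pdivrMr ?normr_gt0// -mulrA -expr2 real_normK ?num_real//.
Qed.

Lemma is_derive_flat k t :
  is_derive t (1 : R) (flat k) (- k%:R * flat k.+1 t + flat k.+2 t).
Proof.
have [t0|t0|->] := ltgtP t 0.
- rewrite !flat_le0 ?ltW// mulr0 addr0.
  apply: (@near_eq_is_derive _ R R (cst 0)) => //.
    near=> s; rewrite /cst flat_le0// ltW//; near: s; exact: lt_nbhsl.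
- apply: (@near_eq_is_derive _ R R (fun s : R => s^-1 ^+ k * expR (- s^-1) : R)) => //.
    near=> s; rewrite /flat ifT//; near: s; exact: lt_nbhsr.
  have dV : is_derive t (1 : R) (fun s => s^-1) (- t^-1 ^+ 2).
    have := @is_deriveV _ id t 1 1 (lt0r_neq0 t0) (is_derive_id t 1).
    by rewrite /GRing.scale/= mulr1 exprVn.
  have dX : is_derive t (1 : R) (fun s : R => s^-1 ^+ k)
      (k%:R * t^-1 ^+ k.-1 * - t^-1 ^+ 2).
    by have := is_deriveX k dV; rewrite exprfctE.
  have dN : is_derive t (1 : R) (fun s : R => - s^-1) (t^-1 ^+ 2).
    by have := is_deriveN dV; rewrite opprK.
  have dE := @is_derive1_comp _ expR (fun s : R => - s^-1) _ _ _ (is_derive_expR (- t^-1)) dN.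
  have := is_deriveM dX dE; rewrite /flat t0 => /is_derive_eq; apply.
  rewrite /GRing.scale/=.
  case: k dX => [|k] _; first by rewrite !expr0 !mul0r oppr0 mul0r mulr0 addr0 add0r mul1r mulrC.
  rewrite /= !exprS; set z := t^-1; set E := expR _; ring.
- rewrite !flat_le0// mulr0 addr0.
  apply: (@is_derive_quadratic (k.+2%:R ^+ k.+2)); first by rewrite flat_le0.
  by move=> s; rewrite ger0_norm ?flat_ge0// flat_sqr.
Unshelve. all: by end_near.
Qed.

Lemma flat_smooth k : smooth1 (flat k).
Proof.
move=> m; elim: m k => // m IH k.
exists (fun t => - k%:R * flat k.+1 t + flat k.+2 t) => [t|]; first exact: is_derive_flat.
by apply: CkD => //; apply: CkM => //; exact: Ck_cst.
Qed.

(** Its derivative serves as the one-variable bump: starting from the antiderivative makes the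
    primitive of a difference of two bumps explicit. *)
Definition smooth_step (t : R) : R := flat 0 (1 + t) / (flat 0 (1 + t) + flat 0 (1 - t)).

Let den_gt0 t : 0 < flat 0 (1 + t) + flat 0 (1 - t).
Proof.
have [t0|t0] := leP t 0.
  by rewrite ltr_wpDl ?flat_ge0// flat_gt0; lra.
by rewrite ltr_wpDr ?flat_ge0// flat_gt0; lra.
Qed.

Let flat_p k m : Ck m (fun t => flat k (1 + t)).
Proof. by have := @Ck_affine R m (flat k) 1 1 (flat_smooth k m); under eq_fun do rewrite mul1r. Qed.

Let flat_m k m : Ck m (fun t => flat k (1 - t)).
Proof. by have := @Ck_affine R m (flat k) 1 (-1) (flat_smooth k m); under eq_fun do rewrite mulN1r. Qed.

Lemma smooth_step_smooth : smooth1 smooth_step.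
Proof.
move=> m; apply: CkM => //; apply: CkV; last exact: CkD.
by move=> t; rewrite gt_eqF.
Qed.

Lemma smooth_step_le0 t : t <= -1 -> smooth_step t = 0.
Proof. by move=> t1; rewrite /smooth_step flat_le0 ?mul0r//; lra. Qed.

Lemma smooth_step_ge1 t : 1 <= t -> smooth_step t = 1.
Proof.
move=> t1; rewrite /smooth_step (@flat_le0 0 (1 - t)); last by lra.
by rewrite addr0 divff// gt_eqF// flat_gt0//; lra.
Qed.

Lemma smooth_step_bound t : `|smooth_step t| <= 1.
Proof.
rewrite ger0_norm; last by apply: divr_ge0; [exact: flat_ge0|exact: ltW].
by rewrite /smooth_step ler_pdivrMr// mul1r lerDl flat_ge0.
Qed.

(** Quotient rule, with [c] the inverse square of the denominator. Only the sign and the support of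
    the derivative are wanted, so [c] stays existential. *)
Lemma derive_smooth_step t : exists2 c, 0 < c & derive1 smooth_step t =
  c * (flat 2 (1 + t) * flat 0 (1 - t) + flat 0 (1 + t) * flat 2 (1 - t)).
Proof.
exists ((flat 0 (1 + t) + flat 0 (1 - t)) ^- 2); first by rewrite invr_gt0 exprn_gt0.
have dl (r : R) : is_derive t (1 : R) (fun t => 1 + r * t) r.
  have := is_deriveD (is_derive_cst (1 : R) t (1 : R))
    (is_deriveZ r (is_derive_id t (1 : R))).
  by rewrite add0r /GRing.scale/= mulr1.
have dp : is_derive t (1 : R) (fun t => flat 0 (1 + t)) (flat 2 (1 + t)).
  have := @is_derive1_comp _ _ (fun t => 1 + 1 * t) _ _ _ (is_derive_flat 0 _) (dl 1).
  by under eq_fun do rewrite mul1r; rewrite oppr0 mul0r add0r mulr1 mul1r.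
have dm : is_derive t (1 : R) (fun t => flat 0 (1 - t)) (- flat 2 (1 - t)).
  have := @is_derive1_comp _ _ (fun t => 1 + (-1) * t) _ _ _ (is_derive_flat 0 _) (dl (-1)).
  by under eq_fun do rewrite mulN1r; rewrite oppr0 mul0r add0r mulrN1 mulN1r.
have dV := @is_deriveV _ (fun t => flat 0 (1 + t) + flat 0 (1 - t)) _ _ _
  (lt0r_neq0 (den_gt0 t)) (is_deriveD dp dm).
rewrite derive1E (@derive_val _ _ _ _ _ _ _ (is_deriveM dp dV)).
rewrite /GRing.scale/=; field; exact: lt0r_neq0.
Qed.

Lemma derive_smooth_step_ge0 t : 0 <= derive1 smooth_step t.
Proof.
have [c c0 ->] := derive_smooth_step t.
by apply: mulr_ge0; [exact: ltW|rewrite addr_ge0// mulr_ge0// flat_ge0].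
Qed.

Lemma derive_smooth_step_gt0 : 0 < derive1 smooth_step 0.
Proof.
have [c c0 ->] := derive_smooth_step 0.
by rewrite mulr_gt0// addr_gt0// mulr_gt0// flat_gt0; lra.
Qed.

Lemma derive_smooth_step_out t : 1 < `|t| -> derive1 smooth_step t = 0.
Proof.
move=> t1; have [c c0 ->] := derive_smooth_step t.
move: t1; rewrite lter_normr => /orP[t1|t1].
  by rewrite !(@flat_le0 _ (1 - t)) ?mulr0 ?addr0 ?mulr0//; lra.
by rewrite !(@flat_le0 _ (1 + t)) ?mul0r ?addr0 ?mulr0//; lra.
Qed.

End smooth_step.

(** * Directional derivatives as derivatives along lines *)

Section directional_derivative.
Context (R : realType) (V : normedModType R).
Implicit Types (f : V -> R) (x v : V).

Lemma is_derive_line f x v (d : R) :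
  is_derive x v f d <-> is_derive (0 : R) (1 : R) (fun h : R => f (h *: v + x)) d.
Proof.
have E : (fun h : R => h^-1 *: ((f \o shift x) (h *: v) - f x)) =
    (fun h : R => h^-1 *: (((fun h : R => f (h *: v + x)) \o shift 0) (h *: 1) -
      (fun h : R => f (h *: v + x)) 0)).
  by apply/funext => h /=; rewrite -[h *: (1 : R)]/(h * 1) mulr1 addr0 scale0r add0r.
by split=> -[df <-]; split; rewrite /derivable /derive ?E// -E.
Qed.

(** Differentiation under the integral needs the derivative along the line at every parameter [h],
    and not only at 0. *)
Lemma is_derive_line_shift f x v (h d : R) :
  is_derive (h *: v + x) v f d -> is_derive (h : R) (1 : R) (fun h : R => f (h *: v + x)) d.
Proof.
move=> /is_derive_line fd.
have dh : is_derive h (1 : R) (fun t : R => - h + t) 1.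
  have := is_deriveD (is_derive_cst (- h) h (1 : R)) (is_derive_id h (1 : R)).
  by rewrite add0r.
have hh : - h + h = 0 by rewrite addNr.
rewrite -hh in fd.
have := @is_derive1_comp _ _ (fun t : R => - h + t) _ _ _ fd dh.
rewrite mulr1; congr is_derive; apply/funext => t /=.
by rewrite scalerDl scaleNr addrACA addNr add0r.
Qed.

Lemma is_derive_affine f a (r : R) x v (d : R) :
  is_derive (a + r *: x) v f d -> is_derive x v (fun y => f (a + r *: y)) (r * d).
Proof.
move=> /is_derive_line fd; apply/is_derive_line.
have dh : is_derive (0 : R) (1 : R) (fun t : R => r * t) r.
  have := is_deriveZ r (is_derive_id (0 : R) (1 : R)).
  by rewrite /GRing.scale/= mulr1.
have h0 : r * 0 = 0 :> R by rewrite mulr0.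
rewrite -[X in is_derive X](mulr0 r) in fd.
have := @is_derive1_comp _ _ (fun t : R => r * t) _ _ _ fd dh.
rewrite mulrC; congr is_derive; apply/funext => t /=.
by rewrite scalerDr scalerA addrCA.
Qed.

End directional_derivative.

(** * Tensor products of one-variable functions *)

Section product_functions.
Context (R : realType) (n : nat).
Implicit Types (F : 'I_n -> R -> R).

(** A partial derivative changes a single factor, so iterated partial derivatives stay in this class
    and smoothness reduces to one variable. *)
Definition prod_fun F (x : 'rV[R]_n) : R := \prod_i F i (x ord0 i).

Definition with_factor F i (f : R -> R) : 'I_n -> R -> R := fun j => if j == i then f else F j.

Lemma prod_fun_with_factor F i f x :
  prod_fun (with_factor F i f) x = f (x ord0 i) * \prod_(j | j != i) F j (x ord0 j).
Proof.
rewrite /prod_fun (bigD1 i)//= /with_factor eqxx; congr (_ * _).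
by apply: eq_bigr => j /negbTE ->.
Qed.

Lemma with_factor_id F i : with_factor F i (F i) = F.
Proof. by apply/funext => j; rewrite /with_factor; case: eqP => // ->. Qed.

Lemma is_derive_prod_fun F i x : (forall j, smooth1 (F j)) ->
  is_derive x (basis_vec R i) (prod_fun F) (prod_fun (with_factor F i (derive1 (F i))) x).
Proof.
move=> sF; apply/is_derive_line.
rewrite prod_fun_with_factor; set c := \prod_(j | _) _.
rewrite (_ : (fun h : R => _) = (fun h : R => F i (x ord0 i + 1 * h) * c)); last first.
  apply/funext => h; rewrite -{1}(with_factor_id F i) prod_fun_with_factor; congr (F i _ * _).
    by rewrite !mxE !eqxx/= mulr1 mul1r addrC.
  apply: eq_bigr => j ji; congr (F j _).
  by rewrite !mxE eqxx (negbTE ji) mulr0 add0r.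
have [dF _] := smooth1_derive (sF i).
have dl : is_derive (0 : R) (1 : R) (fun h : R => x ord0 i + 1 * h) 1.
  have := is_deriveD (is_derive_cst (x ord0 i) (0 : R) (1 : R))
    (is_deriveZ (1 : R) (is_derive_id (0 : R) (1 : R))).
  by rewrite add0r /GRing.scale/= mulr1.
have := @is_derive1_comp _ _ (fun h : R => x ord0 i + 1 * h) _ _ _ (dF _) dl.
move/is_deriveM => /(_ _ _ (is_derive_cst c (0 : R) (1 : R))).
by move=> /is_derive_eq; apply; rewrite /GRing.scale/= !mulr0 add0r addr0 mulr1 mulrC.
Qed.

Lemma smooth1_with_factor F i : (forall j, smooth1 (F j)) ->
  forall j, smooth1 (with_factor F i (derive1 (F i)) j).
Proof.
move=> sF j; rewrite /with_factor; case: eqP => // _.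
by have [] := smooth1_derive (sF i).
Qed.

Lemma continuous_prod_fun F : (forall j, continuous (F j)) -> continuous (prod_fun F).
Proof.
move=> cF; rewrite /prod_fun.
elim: (index_enum _) => [|i s IH] x.
  rewrite (_ : (fun _ => _) = cst 1); first exact: cst_continuous.
  by apply/funext => y; rewrite big_nil.
rewrite (_ : (fun _ => _) = (fun y : 'rV[R]_n => F i (y ord0 i) * \prod_(j <- s) F j (y ord0 j))).
  apply: continuousM; last exact: IH.
  apply: (@continuous_comp _ _ _ (fun y : 'rV[R]_n => y ord0 i)); last exact: cF.
  exact: coord_continuous.
by apply/funext => y; rewrite big_cons.
Qed.

Lemma iter_partial_prod_fun F s : (forall j, smooth1 (F j)) ->
  exists2 G, iter_partial s (prod_fun F) = prod_fun G & forall j, smooth1 (G j).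
Proof.
move=> sF; elim: s => [|i s [G EG sG]]; first by exists F.
exists (with_factor G i (derive1 (G i))); last exact: smooth1_with_factor.
apply/funext => x; rewrite [LHS]/= -/(iter_partial s _) EG.
by rewrite (@derive_val _ _ _ _ _ _ _ (is_derive_prod_fun i x sG)).
Qed.

Lemma smooth_prod_fun F : (forall j, smooth1 (F j)) -> smooth (prod_fun F).
Proof.
move=> sF s; have [G -> sG] := iter_partial_prod_fun s sF.
split; first by apply: continuous_prod_fun => j; exact: smooth1_continuous.
by move=> i x; have [] := is_derive_prod_fun i x sG.
Qed.

End product_functions.

Section test_functions.
Context (R : realType) (n : nat).
Implicit Types (phi : 'rV[R]_n -> R).

Lemma test_function_cube phi M : smooth phi ->
  (forall x, ~ cube M x -> phi x = 0) -> test_function phi.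
Proof.
move=> sphi phi0; split => //.
apply: (subclosed_compact _ (@compact_cube R n M)); first exact: closed_closure.
have cC : closed (@cube R n M).
  by apply: compact_closed; [exact: norm_hausdorff|exact: compact_cube].
rewrite [X in _ `<=` X]((closure_id _).1 cC); apply: closure_subset => x /=.
by apply: contraNP => /phi0 ->.
Qed.

Lemma test_function_supp phi : test_function phi ->
  exists2 M, 0 < M & forall x, ~ cube M x -> phi x = 0.
Proof.
move=> [_ /compact_sub_cube[M M0 sM]]; exists M => // x xM.
apply/eqP; apply: contra_notT xM => px; apply: sM; exact: subset_closure.
Qed.

Lemma test_function_continuous phi : test_function phi -> continuous phi.
Proof. by move=> [/(_ [::])[]]. Qed.

Lemma test_function_derive phi i x : test_function phi ->
  is_derive x (basis_vec R i) phi ('D_(basis_vec R i) phi x).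
Proof. by move=> [/(_ [::])[_ /(_ i x)/derivableP]]. Qed.

Lemma test_function_continuous_derive phi i : test_function phi ->
  continuous ('D_(basis_vec R i) phi).
Proof. by move=> [/(_ [:: i])[]]. Qed.

Lemma derive_out phi v M : (forall x, ~ cube M x -> phi x = 0) ->
  forall x, ~ cube M x -> 'D_v phi x = 0.
Proof.
move=> phi0 x xM; rewrite -[RHS](derive_cst (0 : R) x v).
have oC : open (~` @cube R n M).
  by rewrite openC; apply: compact_closed; [exact: norm_hausdorff|exact: compact_cube].
have [->|v0] := eqVneq v 0; first by rewrite !derive0.
apply: near_eq_derive => //.
near=> y; apply: phi0; near: y.
exact: (open_nbhs_nbhs (conj oC xM)).
Unshelve. all: by end_near.
Qed.

Lemma iter_partial_affine phi a r s : smooth phi ->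
  iter_partial s (phi \o affine_rV a r) =
  (fun x => r ^+ size s * iter_partial s phi (affine_rV a r x)).
Proof.
move=> sphi; elim: s => [|i s IH]; first by apply/funext => x; rewrite mul1r.
rewrite [LHS]/= -/(iter_partial s _) IH; apply/funext => x.
have [_ /(_ i (affine_rV a r x))/derivableP/is_derive_affine h] := sphi s.
have /= := is_deriveZ (r ^+ size s) h.
move/(@derive_val _ _ _ _ _ _ _) => /= ->.
by rewrite exprSr /GRing.scale/= mulrA.
Qed.

Lemma continuous_affine (a : 'rV[R]_n) r : continuous (affine_rV a r).
Proof.
move=> x; apply: continuousD; first exact: cst_continuous.
exact: scaler_continuous.
Qed.

Lemma test_function_affine phi a r : 0 < r -> test_function phi ->
  test_function (phi \o affine_rV a r).
Proof.
move=> r0 tphi; have [M M0 phi0] := test_function_supp tphi.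
have [sphi _] := tphi.
apply: (@test_function_cube _ ((M + `|a|) / r)).
  move=> s; rewrite iter_partial_affine//; split.
    move=> x.
    apply: (@continuousM R 'rV[R]_n (cst (r ^+ size s))
      (iter_partial s phi \o affine_rV a r) x); first exact: cst_continuous.
    apply: (@continuous_comp _ _ _ (affine_rV a r)); first exact: continuous_affine.
    by have [cs _] := sphi s; exact: cs.
  move=> i x.
  have [_ /(_ i (affine_rV a r x))/derivableP/is_derive_affine h] := sphi s.
  by have [] := is_deriveZ (r ^+ size s) h.
move=> x xM; apply: phi0; apply: contra_not xM => /cubeP-/(_ (ltW M0)) axM.
apply/cubeP; first by rewrite divr_ge0 ?addr_ge0// ltW.
rewrite ler_pdivlMr// mulrC -[X in X * _](gtr0_norm r0) -normrZ.
rewrite -[r *: x](addKr a) addrC (le_trans (ler_normB _ _))// lerD2r.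
exact: axM.
Qed.

End test_functions.

(** * Integration by parts against test functions *)

Section integration_by_parts.
Context (R : realType) (n : nat).
Local Notation mu := (lebesgue_rV R n).
Implicit Types (F phi u g : 'rV[R]_n -> R).

Lemma continuous_integrable_cube F M : continuous F ->
  (forall x, ~ cube M x -> F x = 0) -> mu.-integrable setT (EFin \o F).
Proof.
move=> cF F0; apply: (integrable_outside0 (@measurable_cube R n M) F0).
by apply: continuous_integrable_compact => //; exact: compact_cube.
Qed.

Lemma L1loc_integrableM g phi M : L1loc g -> continuous phi ->
  (forall x, ~ cube M x -> phi x = 0) ->
  mu.-integrable setT (EFin \o (fun x => g x * phi x)).
Proof.
move=> [mg ig] cphi phi0.
apply: (integrable_outside0 (@measurable_cube R n M)).
  by move=> x /phi0 ->; rewrite mulr0.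
have [C C0 phiC] := continuous_bounded_compact cphi (@compact_cube R n M).
rewrite (_ : EFin \o _ = ((EFin \o g) \* (EFin \o phi))%E); last first.
  by apply/funext => x /=; rewrite EFinM.
apply: integrableMl; first exact: measurable_cube.
- by apply: ig; exact: compact_cube.
- by apply: measurable_funTS; exact: continuous_measurable_rV.
- exists C; split; first exact: num_real.
  by move=> D CD x Ax; apply: le_trans (phiC _ Ax) (ltW CD).
Qed.

Lemma continuous_L1loc F : continuous F -> L1loc F.
Proof.
move=> cF; split; first exact: continuous_measurable_rV.
by move=> K cK; exact: continuous_integrable_compact.
Qed.

(* Differentiating the translation invariance of the integral at [h = 0]. *)
Lemma Rintegral_derive_eq0 F i M : 0 <= M -> continuous F ->
  (forall x, derivable F x (basis_vec R i)) ->
  continuous ('D_(basis_vec R i) F) -> (forall x, ~ cube M x -> F x = 0) ->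
  \int[mu]_x 'D_(basis_vec R i) F x = 0.
Proof.
move=> M0 cF dF cdF F0; set e := basis_vec R i.
pose f (h : R) (y : 'rV[R]_n) : R := F (h *: e + y).
have fE h : f h = F \o affine_rV (h *: e) 1.
  by apply/funext => y; rewrite /f /affine_rV /= scale1r.
have iF : mu.-integrable setT (EFin \o F) by exact: continuous_integrable_cube F0.
have f' h y : is_derive (h : R) (1 : R) (f ^~ y) ('D_e F (h *: e + y)).
  by apply: is_derive_line_shift; exact/derivableP.
have d1f h y : partial1of2 f h y = 'D_e F (h *: e + y).
  by rewrite partial1of2E (@derive_val _ _ _ _ _ _ _ (f' h y)).
have [C C0 FC] := continuous_bounded_compact cdF (@compact_cube R n M).
(* The dominating function: for [|h| < 1] the translated support stays inside the cube of half-side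
   [M + 1]. *)
pose G (y : 'rV[R]_n) : R := C * \1_(cube (M + 1)) y.
have G0 y : 0 <= G y by rewrite mulr_ge0.
have iG : mu.-integrable setT (EFin \o G).
  apply: (integrable_outside0 (@measurable_cube R n (M + 1))).
    by move=> x xM; rewrite /G indicE memNset// mulr0.
  apply: (@bounded_integrable _ _ _ _ _ _ C).
  - exact: measurable_cube.
  - exact: lebesgue_rV_cube_lty.
  - apply: measurable_funM => //; apply: measurable_indic; exact: measurable_cube.
  - move=> x _; rewrite ger0_norm// /G indicE.
    by case: (_ \in _); rewrite ?mulr1// mulr0.
have Gub h y : `]-1, 1[%classic h -> setT y -> `|partial1of2 f h y| <= G y.
  rewrite /= in_itv/= => /andP[h1 h2] _; rewrite d1f.
  have [hM|hM] := pselect (cube M (h *: e + y)); last first.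
    by rewrite (derive_out _ F0)// normr0.
  rewrite /G indicE mem_set ?mulr1; first exact: FC.
  move=> j; have -> : y ord0 j = (h *: e + y) ord0 j - (h *: e) ord0 j.
    by rewrite [X in _ = X - _]mxE addrAC subrr add0r.
  apply: le_trans (ler_normB _ _) _; apply: lerD; first exact: hM.
  rewrite !mxE eqxx/= normrM; have /ltW hh : `|h| < 1 by rewrite ltr_norml h1.
  rewrite -[leRHS]mulr1; apply: ler_pM => //.
  by case: eqP => _; rewrite ?normr1 ?normr0.
have I0 : `]-1, 1[%classic (0 : R) by rewrite /= in_itv/= ltrN10 ltr01.
have intf h : `]-1, 1[%classic h -> mu.-integrable setT (EFin \o f h).
  by move=> _; rewrite fE; exact: (integrable_affine (h *: e) ltr01 iF).
have df1 h y : `]-1, 1[%classic h -> setT y -> derivable (f ^~ y) h 1.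
  by move=> _ _; have [] := f' h y.
have := differentiation_under_integral measurableT I0 intf df1 G0 iG Gub.
rewrite (_ : (fun x' => _) = cst (\int[mu]_x F x)); last first.
  apply/funext => h; rewrite (Rintegral_affine (h *: e) ltr01 iF) expr1n mul1r.
  by rewrite fE.
rewrite derive1_cst => ->; apply: eq_Rintegral => y _.
by rewrite d1f scale0r add0r.
Qed.

(** The product of [eta] and [phi] has compact support, so the integral of its derivative
    vanishes. *)
Lemma weak_partial_smooth (eta : 'rV[R]_n -> R) i : test_function eta ->
  weak_partial i eta ('D_(basis_vec R i) eta).
Proof.
move=> teta phi tphi; set e := basis_vec R i.
have [M M0 eta0] := test_function_supp teta.
have ce := test_function_continuous teta.
have cp := test_function_continuous tphi.
have cde : continuous ('D_e eta) by exact: test_function_continuous_derive.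
have cdp : continuous ('D_e phi) by exact: test_function_continuous_derive.
pose F x := eta x * phi x.
have dF x : is_derive x e F (eta x * 'D_e phi x + 'D_e eta x * phi x).
  rewrite [X in _ + X]mulrC.
  exact: (is_deriveM (test_function_derive i x teta) (test_function_derive i x tphi)).
have DF : 'D_e F = (fun x => eta x * 'D_e phi x + 'D_e eta x * phi x).
  by apply/funext => x; rewrite (@derive_val _ _ _ _ _ _ _ (dF x)).
have F0 x : ~ cube M x -> F x = 0 by move=> /eta0; rewrite /F => ->; rewrite mul0r.
have := @Rintegral_derive_eq0 F i M (ltW M0).
rewrite -/e DF => /(_ _ _ _ F0) h.
have /eqP : \int[mu]_x (eta x * 'D_e phi x + 'D_e eta x * phi x) = 0.
  apply: h.
  - by move=> x; apply: (@continuousM _ _ eta phi); [exact: ce|exact: cp].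
  - by move=> x; have [] := dF x.
  - move=> x; apply: (@continuousD R R 'rV[R]_n (fun x => eta x * 'D_e phi x) (fun x => 'D_e eta x * phi x)).
      by apply: (@continuousM _ _ eta ('D_e phi)); [exact: ce|exact: cdp].
    by apply: (@continuousM _ _ ('D_e eta) phi); [exact: cde|exact: cp].
rewrite RintegralD//; first by rewrite addr_eq0 => /eqP.
- rewrite (_ : EFin \o _ = (EFin \o (fun x => 'D_e phi x * eta x))).
    by apply: (@L1loc_integrableM _ _ M) => //; exact: continuous_L1loc.
  by apply/funext => x /=; rewrite mulrC.
- rewrite (_ : EFin \o _ = (EFin \o (fun x => phi x * 'D_e eta x))).
    apply: (@L1loc_integrableM _ _ M) => //; first exact: continuous_L1loc.
    exact: derive_out.
  by apply/funext => x /=; rewrite mulrC.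
Qed.

End integration_by_parts.

(** * Morrey's inequality *)

Section euclidean_norm.
Context (R : realType) (n : nat).
Implicit Types (a b v : 'rV[R]_n).

Let sumsq_ge0 v : 0 <= \sum_i v ord0 i ^+ 2.
Proof. by apply: sumr_ge0 => i _; exact: sqr_ge0. Qed.

Lemma enorm_ge0 v : 0 <= enorm v.
Proof. exact: sqrtr_ge0. Qed.

Lemma sqr_enorm v : enorm v ^+ 2 = \sum_i v ord0 i ^+ 2.
Proof. by rewrite sqr_sqrtr. Qed.

Lemma enormZ r v : enorm (r *: v) = `|r| * enorm v.
Proof.
rewrite /enorm -sqrtr_sqr -sqrtrM ?sqr_ge0//; congr Num.sqrt.
by rewrite mulr_sumr; apply: eq_bigr => i _; rewrite mxE exprMn.
Qed.

Lemma enorm0 : enorm (0 : 'rV[R]_n) = 0.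
Proof. by rewrite -(scale0r (0 : 'rV[R]_n)) enormZ normr0 mul0r. Qed.

Lemma enormN v : enorm (- v) = enorm v.
Proof. by rewrite -scaleN1r enormZ normrN1 mul1r. Qed.

Lemma coord_le_enorm v i : `|v ord0 i| <= enorm v.
Proof.
rewrite -(@ler_pXn2r _ 2) ?nnegrE ?enorm_ge0// sqr_enorm real_normK ?num_real//.
by rewrite (bigD1 i)//= lerDl sumr_ge0// => j _; exact: sqr_ge0.
Qed.

Lemma enorm_eq0 v : enorm v = 0 -> v = 0.
Proof.
move=> v0; apply/rowP => i; rewrite mxE; apply/eqP.
by rewrite -normr_eq0 eq_le normr_ge0 andbT -v0 coord_le_enorm.
Qed.

Lemma enorm_le_sum v : enorm v <= \sum_i `|v ord0 i|.
Proof.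
rewrite -(@ler_pXn2r _ 2) ?nnegrE ?enorm_ge0 ?sumr_ge0// sqr_enorm expr2 mulr_suml.
apply: ler_sum => i _; rewrite -real_normK ?num_real// expr2 ler_wpM2l//.
by rewrite (bigD1 i)//= lerDl sumr_ge0.
Qed.

(** Source of the strict convexity of the norm for vectors of equal length, in
    [midpoint_gap_gt0]. *)
Lemma parallelogram a b :
  enorm (a + b) ^+ 2 + enorm (a - b) ^+ 2 = 2 * (enorm a ^+ 2 + enorm b ^+ 2).
Proof.
rewrite !sqr_enorm -!big_split mulr_sumr /=; apply: eq_bigr => i _.
by rewrite !mxE; ring.
Qed.

Lemma ler_enormD a b : enorm (a + b) <= enorm a + enorm b.
Proof.
have dot : \sum_i a ord0 i * b ord0 i <= enorm a * enorm b.
  have [/enorm_eq0 ->|a0] := eqVneq (enorm a) 0.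
    by rewrite enorm0 mul0r big1// => i _; rewrite mxE mul0r.
  have [/enorm_eq0 ->|b0] := eqVneq (enorm b) 0.
    by rewrite enorm0 mulr0 big1// => i _; rewrite mxE mulr0.
  have ap : 0 < enorm a by rewrite lt_def a0 enorm_ge0.
  have bp : 0 < enorm b by rewrite lt_def b0 enorm_ge0.
  (* Cauchy-Schwarz: with [D] the inner product, this sum of squares expands to
     [2 |a| |b| (|a| |b| - D)]. *)
  have : 0 <= \sum_i (enorm b * a ord0 i - enorm a * b ord0 i) ^+ 2.
    by apply: sumr_ge0 => i _; exact: sqr_ge0.
  rewrite (eq_bigr (fun i => enorm b ^+ 2 * a ord0 i ^+ 2 +
      (enorm a ^+ 2 * b ord0 i ^+ 2 +
      (- 2 * enorm a * enorm b) * (a ord0 i * b ord0 i)))); last first.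
    by move=> i _; ring.
  rewrite !big_split/= -!mulr_sumr -!sqr_enorm.
  set D := \sum_i _; set A := enorm a; set B := enorm b.
  have -> : B ^+ 2 * A ^+ 2 + (A ^+ 2 * B ^+ 2 + -2 * A * B * D) =
      2 * A * B * (A * B - D) by ring.
  by rewrite pmulr_rge0 ?subr_ge0// !mulr_gt0.
rewrite -(@ler_pXn2r _ 2) ?nnegrE ?addr_ge0 ?enorm_ge0// sqrrD !sqr_enorm.
rewrite (eq_bigr (fun i => a ord0 i ^+ 2 + (a ord0 i * b ord0 i *+ 2 + b ord0 i ^+ 2))); last first.
  by move=> i _; rewrite mxE; ring.
by rewrite big_split big_split/= sumrMnl addrA lerD2r lerD2l lerMn2r/= dot.
Qed.

Lemma continuous_enorm : continuous (@enorm R n).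
Proof.
move=> v; rewrite /enorm.
apply: (@continuous_comp _ _ _ (fun v : 'rV[R]_n => \sum_i v ord0 i ^+ 2)); last exact: sqrt_continuous.
elim: (index_enum _) => [|i s IH].
  rewrite (_ : (fun _ => _) = cst 0); first exact: cst_continuous.
  by apply/funext => y; rewrite big_nil.
rewrite (_ : (fun _ => _) =
    (fun y : 'rV[R]_n => y ord0 i ^+ 2 + \sum_(j <- s) y ord0 j ^+ 2)).
  apply: (@continuousD _ _ _ (fun y : 'rV[R]_n => y ord0 i ^+ 2)); last exact: IH.
  apply: (@continuousM _ _ (fun y : 'rV[R]_n => y ord0 i) (fun y => y ord0 i));
    exact: coord_continuous.
by apply/funext => y; rewrite big_cons.
Qed.

Lemma measurable_enorm d (T : measurableType d) (f : T -> 'rV[R]_n) :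
  (forall i, measurable_fun setT (fun x => f x ord0 i)) ->
  measurable_fun setT (fun x => enorm (f x)).
Proof.
move=> mf; apply: (measurableT_comp (continuous_measurable_rV continuous_enorm)).
exact: measurable_fun_rVP.
Qed.

End euclidean_norm.

(** * The energy and its behaviour under scaling *)

Section energy.
Context (R : realType) (n : nat) (p : R).
Hypothesis p0 : 0 < p.
Local Notation mu := (lebesgue_rV R n).
Implicit Types (u : 'rV[R]_n -> R) (Du : 'rV[R]_n -> 'rV[R]_n).

(** The [p]-th power of [normDu] (see [normDuE]). As a plain integral it accepts pointwise
    inequalities directly. *)
Definition energy Du : \bar R := (\int[mu]_x (enorm (Du x) `^ p)%:E)%E.

(* [l] bounds the [L^p] norm of [Du]. *)
Definition grad_le u Du (l : R) :=
  [/\ continuous u, weak_gradient u Du & (energy Du <= (l `^ p)%:E)%E].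

Lemma normDuE Du : normDu p Du = poweR (energy Du) p^-1.
Proof.
rewrite /normDu unlock; congr poweR; apply: eq_integral => x _.
by rewrite /= ger0_norm ?enorm_ge0.
Qed.

Lemma measurable_energy Du :
  (forall i, measurable_fun setT (fun x => Du x ord0 i)) ->
  measurable_fun setT (fun x => (enorm (Du x) `^ p)%:E).
Proof.
move=> mDu; apply/measurable_EFinP.
apply: (@measurableT_comp _ _ _ _ _ _ (@powR R ^~ p)); first exact: measurable_powR.
exact: measurable_enorm.
Qed.

Lemma L1loc_affine (g : 'rV[R]_n -> R) a r c : 0 < r -> L1loc g ->
  L1loc (fun x => c * g (affine_rV a r x)).
Proof.
move=> r0 [mg ig]; split.
  apply: measurable_funM => //.
  by apply: (measurableT_comp mg); exact: measurable_affine_rV.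
move=> K cK; have [M M0 KM] := compact_sub_cube cK.
have mK := compact_measurable_rV cK.
(* This cube contains the image of [K]. Extending [g] by 0 outside it makes the change of variables
   on the whole space applicable. *)
have mC := @measurable_cube R n (`|a| + r * M).
have /integrable_mkcond-/(_ mC) := ig _ (@compact_cube R n (`|a| + r * M)).
move/(integrable_affine a r0)/(integrableS measurableT mK (@subsetT _ _)).
move/(integrableZl mK c); apply: eq_integrable => // x.
rewrite inE => Kx /=; rewrite /patch mem_set// => i.
rewrite !mxE; apply: le_trans (ler_normD _ _) _; apply: lerD.
  by have h : cube `|a| a; [exact/cubeP|exact: h].
rewrite normrM gtr0_norm// ler_pM2l//; exact: KM.
Qed.

(** Tests [u] against [phi] composed with the inverse map [T']. Both sides acquire the same Jacobian
    factor [r^n], which cancels. *)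
Lemma weak_partial_affine u g i a r : 0 < r -> continuous u -> L1loc g ->
  weak_partial i u g ->
  weak_partial i (u \o affine_rV a r) (fun x => r * g (affine_rV a r x)).
Proof.
move=> r0 cu Lg ug phi tphi; set e := basis_vec R i.
pose T := affine_rV a r; pose T' : 'rV[R]_n -> 'rV[R]_n := affine_rV (- r^-1 *: a) r^-1.
have TK y : T' (T y) = y.
  by rewrite /T /T' /affine_rV scalerDr scaleNr scalerA mulVf ?gt_eqF// scale1r addKr.
have ri0 : 0 < r^-1 by rewrite invr_gt0.
pose psi := phi \o T'; have tpsi : test_function psi by exact: test_function_affine.
have dpsi y : 'D_e psi y = r^-1 * 'D_e phi (T' y).
  by have /is_derive_affine[_] := test_function_derive i (T' y) tphi.
have [M M0 psi0] := test_function_supp tpsi.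
have := ug psi tpsi.
have iu : mu.-integrable setT (EFin \o (fun x => u x * 'D_e psi x)).
  apply: (L1loc_integrableM (continuous_L1loc cu)).
    exact: test_function_continuous_derive.
  exact: derive_out psi0.
have ig : mu.-integrable setT (EFin \o (fun x => g x * psi x)).
  apply: (L1loc_integrableM Lg _ psi0); exact: test_function_continuous.
rewrite (Rintegral_affine a r0 iu) (Rintegral_affine a r0 ig) -mulrN.
have rn0 : r ^+ n != 0 by rewrite expf_neq0// gt_eqF.
move/(mulfI rn0) => h.
transitivity (r * \int[mu]_x (u (T x) * 'D_e psi (T x))).
  rewrite -RintegralZl//; last exact: (integrable_affine a r0 iu).
  apply: eq_Rintegral => x _ /=; rewrite dpsi TK; field.
  by rewrite gt_eqF.
rewrite h mulrN -RintegralZl//; last exact: (integrable_affine a r0 ig).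
by congr (- _); apply: eq_Rintegral => x _ /=; rewrite /psi /= TK mulrA.
Qed.

(** The chain rule multiplies the energy by [r^p] and the change of variables by [r^-n]. The [p]-th
    root of the product is the Hoelder factor, so Morrey's inequality is scale invariant. *)
Lemma grad_le_affine u Du l a r : 0 < r -> 0 <= l -> grad_le u Du l ->
  grad_le (u \o affine_rV a r) (fun x => r *: Du (affine_rV a r x))
    (r `^ (1 - n%:R / p) * l).
Proof.
move=> r0 l0 [cu uDu El]; have rge0 := ltW r0.
have mDu i : measurable_fun setT (fun x => Du x ord0 i) by have [[]] := uDu i.
split.
- move=> x; apply: continuous_comp; first exact: continuous_affine.
  exact: cu.
- move=> i; have [Li wi] := uDu i; split.
    rewrite (_ : (fun x => _) = (fun x => r * (Du (affine_rV a r x)) ord0 i)).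
      exact: (L1loc_affine a r r0 Li).
    by apply/funext => x; rewrite mxE.
  rewrite (_ : (fun x => _) = (fun x => r * (Du (affine_rV a r x)) ord0 i)).
    exact: (weak_partial_affine a r0 cu Li wi).
  by apply/funext => x; rewrite mxE.
- rewrite /energy.
  under eq_integral do rewrite enormZ gtr0_norm// powRM ?enorm_ge0// EFinM.
  rewrite ge0_integralZl//; last 3 first.
  + apply: (measurableT_comp (measurable_energy mDu)); exact: measurable_affine_rV.
  + by move=> x _; rewrite lee_fin powR_ge0.
  + by rewrite lee_fin powR_ge0.
  have rn : 0 < r ^+ n by exact: exprn_gt0.
  move: El; rewrite /energy (ge0_integral_affine a r0 (measurable_energy mDu)); last first.
    by move=> x; rewrite lee_fin powR_ge0.
  set I := integral _ _ _ => El.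
  rewrite powRM ?powR_ge0// EFinM.
  have -> : (r `^ (1 - n%:R / p)) `^ p = r `^ p / r ^+ n.
    rewrite -powRrM mulrBl mul1r divfK ?gt_eqF// powRB ?powR_mulrn//.
    by apply/implyP => _; rewrite gt_eqF.
  rewrite EFinM -muleA lee_pmul2l ?lte_fin ?powR_gt0//.
  by rewrite lee_pdivlMl.
Qed.

(* Hoelder's inequality is replaced by the pointwise bound [t <= l + l^(1-p) t^p]. *)
Lemma energy_Rintegral_bound Du l i W B M : 1 < p -> 0 < l -> 0 <= M ->
  (forall j, L1loc (fun x => Du x ord0 j)) -> (energy Du <= (l `^ p)%:E)%E ->
  continuous W -> (forall x, ~ cube M x -> W x = 0) -> (forall x, `|W x| <= B) ->
  `|\int[mu]_x (Du x ord0 i * W x)| <= B * ((M *+ 2) ^+ n + 1) * l.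
Proof.
move=> p1 l0 M0 LDu El cW W0 WB.
have B0 : 0 <= B by apply: le_trans (WB 0).
have mDu j : measurable_fun setT (fun x => Du x ord0 j) by have [] := LDu j.
have iW : mu.-integrable setT (EFin \o (fun x => Du x ord0 i * W x)).
  exact: (L1loc_integrableM (LDu i) cW W0).
apply: (le_trans (le_normr_Rintegral _ iW)) => //.
rewrite -lee_fin; rewrite /Rintegral fineK; last first.
  by apply: integrable_fin_num => //; exact: integrable_norm iW.
pose H (x : 'rV[R]_n) : \bar R :=
  (B%:E * ((l * \1_(cube M) x)%:E + (l `^ (1 - p))%:E * (enorm (Du x) `^ p)%:E))%E.
have m1 : measurable_fun setT (fun x : 'rV[R]_n => (l * \1_(cube M) x)%:E).
  by apply/measurable_EFinP; apply: measurable_funM => //; apply: measurable_indic; exact: measurable_cube.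
have m2 : measurable_fun setT (fun x => ((l `^ (1 - p))%:E * (enorm (Du x) `^ p)%:E)%E).
  apply: emeasurable_funM; first exact: measurable_cst.
  exact: measurable_energy.
have n1 (x : 'rV[R]_n) : setT x -> (0 <= (l * \1_(cube M) x)%:E)%E.
  by move=> _; rewrite lee_fin mulr_ge0// ltW.
have n2 (x : 'rV[R]_n) : setT x -> (0 <= (l `^ (1 - p))%:E * (enorm (Du x) `^ p)%:E)%E.
  by move=> _; rewrite -EFinM lee_fin mulr_ge0// powR_ge0.
apply: (@le_trans _ _ (\int[mu]_x H x)%E).
  apply: ge0_le_integral => //.
  - apply/measurable_EFinP; apply: measurableT_comp => //.
    by apply/measurable_EFinP; exact: (measurable_int mu iW).
  - by apply: emeasurable_funM; [exact: measurable_cst|exact: emeasurable_funD].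
  - move=> x _; rewrite /H -EFinM lee_fin /=.
    have [xM|/W0 ->] := pselect (cube M x); last first.
      rewrite mulr0 normr0; apply: mulr_ge0 => //.
      by apply: addr_ge0; apply: mulr_ge0; rewrite ?powR_ge0//; exact: ltW.
    rewrite normrM mulrC; apply: ler_pM => //; rewrite indicE mem_set// mulr1.
    apply: le_trans (coord_le_enorm _ i) _; set t := enorm _.
    have t0 : 0 <= t by exact: enorm_ge0.
    have [tl|lt] := leP t l; first by rewrite ler_wpDr// mulr_ge0// powR_ge0.
    apply: ler_wpDl; first exact: ltW.
    have tp : 0 < t by exact: lt_trans lt.
    (* Here [t > l]: write [t] as [t^(1-p) t^p] and use that the exponent [1 - p] is negative. *)
    rewrite -[X in X <= _](powRr1 t0) -[X in t `^ X](subrK p) powRD; last first.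
      by apply/implyP => _; rewrite gt_eqF.
    rewrite ler_wpM2r ?powR_ge0//.
    rewrite -[1 - p]opprB !powRN lef_pV2 ?posrE ?powR_gt0//.
    by apply: ge0_ler_powR; rewrite ?nnegrE ?ltW// subr_gt0.
rewrite /H ge0_integralZl//; last 2 first.
- exact: emeasurable_funD.
- by move=> x _; rewrite adde_ge0// ?n1 ?n2.
(* The two summands integrate to [l (2M)^n] and to at most [l^(1-p) l^p = l]. Both are linear in
   [l], which is why the threshold in the pointwise bound is [l] itself. *)
rewrite -[in leRHS]mulrA EFinM; apply: lee_wpmul2l => //.
rewrite ge0_integralD// mulrDl EFinD; apply: leeD.
  under eq_integral do rewrite EFinM.
  rewrite ge0_integralZl//; last 2 first.
  - by apply/measurable_EFinP; apply: measurable_indic; exact: measurable_cube.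
  - by rewrite lee_fin ltW.
  rewrite integral_indic ?setIT//; last exact: measurable_cube.
  by rewrite [X in (_ * X <= _)%E](lebesgue_rV_cube n M0) -EFinM lee_fin mulrC.
rewrite ge0_integralZl//; last 3 first.
- exact: measurable_energy.
- by move=> x _; rewrite lee_fin powR_ge0.
- by rewrite lee_fin powR_ge0.
apply: (@le_trans _ _ ((l `^ (1 - p))%:E * (l `^ p)%:E)%E).
  by apply: lee_wpmul2l => //; rewrite lee_fin powR_ge0.
rewrite -EFinM lee_fin mul1r -powRD; last by apply/implyP => _; rewrite gt_eqF.
by rewrite subrK powRr1// ltW.
Qed.

Lemma Rintegral_derive_bound u Du l i W B : 1 < p -> 0 < l -> grad_le u Du l -> test_function W ->
  (forall x, ~ cube 1 x -> W x = 0) -> (forall x, `|W x| <= B) ->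
  `|\int[mu]_x (u x * 'D_(basis_vec R i) W x)| <= B * (2 ^+ n + 1) * l.
Proof.
move=> p1 l0 [cu uDu El] tW W0 WB; have [_ wi] := uDu i; rewrite wi// normrN.
have LDu j : L1loc (fun x => Du x ord0 j) by have [] := uDu j.
have := energy_Rintegral_bound i p1 l0 ler01 LDu El (test_function_continuous tW) W0 WB.
by rewrite -[1 *+ 2]/(2%:R).
Qed.

End energy.

Lemma integrable_indic_cube (R : realType) n (M : R) :
  (lebesgue_rV R n).-integrable setT (EFin \o \1_(cube M)).
Proof.
have mC := @measurable_cube R n M.
apply: (integrable_outside0 mC); first by move=> x xM; rewrite indicE memNset.
apply: (@bounded_integrable _ _ _ _ _ _ 1) => //; first exact: lebesgue_rV_cube_lty.
by move=> x _; rewrite indicE; case: (_ \in _); rewrite ?normr1 ?normr0.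
Qed.

Lemma Rintegral_sum d (T : measurableType d) (R : realType)
    (mu : {measure set T -> \bar R}) (I : Type) (s : seq I) (f : I -> T -> R) :
  (forall i, mu.-integrable setT (EFin \o f i)) ->
  \int[mu]_x (\sum_(i <- s) f i x) = \sum_(i <- s) \int[mu]_x f i x.
Proof.
move=> fi.
suff [] : mu.-integrable setT (EFin \o (fun x => \sum_(i <- s) f i x)) /\
  \int[mu]_x (\sum_(i <- s) f i x) = \sum_(i <- s) \int[mu]_x f i x by [].
elim: s => [|i s [IH1 IH2]].
  rewrite (_ : (fun x => _) = cst 0); last by apply/funext => x; rewrite big_nil.
  by rewrite big_nil Rintegral_cst// mul0r; split => //; exact: integrable0.
rewrite (_ : (fun x => _) = (fun x => f i x + \sum_(j <- s) f j x)); last first.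
  by apply/funext => x; rewrite big_cons.
split; last by rewrite big_cons RintegralD// IH2.
exact: (integrableD measurableT (fi i) IH1).
Qed.

(** * Averages against bumps and the pointwise estimate *)

Section morrey.
Context (R : realType) (n : nat) (p : R).
Hypothesis p1 : 1 < p.
Hypothesis np : n%:R < p.
Local Notation mu := (lebesgue_rV R n).
Implicit Types (u : 'rV[R]_n -> R) (Du : 'rV[R]_n -> 'rV[R]_n) (x y : 'rV[R]_n).

Let p0 : 0 < p. Proof. exact: lt_trans p1. Qed.
Let S : R -> R := @smooth_step R.
Let b : R -> R := derive1 S.

Let sS : smooth1 S. Proof. exact: smooth_step_smooth. Qed.
Let sb : smooth1 b. Proof. by have [] := smooth1_derive sS. Qed.

Definition bump_rV : 'rV[R]_n -> R := prod_fun (fun=> b).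

Let prod_out F x : (forall j t, 1 < `|t| -> F j t = 0) -> ~ cube 1 x ->
  @prod_fun R n F x = 0.
Proof.
move=> F0 /existsNP[j /negP]; rewrite -ltNge => xj.
by rewrite /prod_fun (bigD1 j)//= F0// mul0r.
Qed.

Lemma bump_out x : ~ cube 1 x -> bump_rV x = 0.
Proof. by apply: prod_out => j t; exact: derive_smooth_step_out. Qed.

Lemma bump_test : test_function bump_rV.
Proof.
by apply: test_function_cube bump_out; apply: smooth_prod_fun => j; exact: sb.
Qed.

Lemma bump_ge0 x : 0 <= bump_rV x.
Proof. by apply: prodr_ge0 => j _; exact: derive_smooth_step_ge0. Qed.

Lemma bump0_gt0 : 0 < bump_rV 0.
Proof. by apply: prodr_gt0 => j _; rewrite mxE; exact: derive_smooth_step_gt0. Qed.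

Let cbump : continuous bump_rV.
Proof. exact: test_function_continuous bump_test. Qed.

Let integrable_bump : mu.-integrable setT (EFin \o bump_rV).
Proof. exact: continuous_integrable_cube cbump bump_out. Qed.

(** By continuity the bump exceeds half of its value at 0 on a small cube around 0. *)
Lemma Rintegral_bump_gt0 : 0 < \int[mu]_x bump_rV x.
Proof.
have b0 := bump0_gt0.
have h20 : 0 < bump_rV 0 / 2 by rewrite divr_gt0.
have /cvgrPdist_lt/(_ _ h20) := @cbump 0.
move=> /nbhs_ballP[d /= d0 hd].
have d20 : 0 < d / 2 by rewrite divr_gt0.
pose f x : R := bump_rV 0 / 2 * \1_(cube (d / 2)) x.
have mC := @measurable_cube R n (d / 2).
have If : \int[mu]_x f x = bump_rV 0 / 2 * (d / 2 *+ 2) ^+ n.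
  rewrite /f RintegralZl//; last exact: integrable_indic_cube.
  rewrite /Rintegral integral_indic// setIT.
  by rewrite [X in fine X](lebesgue_rV_cube n (ltW d20)).
have: 0 < \int[mu]_x f x.
  by rewrite If mulr_gt0// exprn_gt0// pmulrn_lgt0.
have jf := integrableZl measurableT (bump_rV 0 / 2) (integrable_indic_cube n (d / 2)).
move/lt_le_trans; apply; apply: (le_Rintegral measurableT jf integrable_bump).
move=> x _; rewrite /f indicE; case: (boolP (_ \in _)) => [|_]; last first.
  by rewrite mulr0 bump_ge0.
rewrite inE => xd; rewrite mulr1.
have : `|bump_rV 0 - bump_rV x| < bump_rV 0 / 2.
  apply: hd; rewrite mx_norm_ball /ball_ /= sub0r normrN.
  have /(cubeP _ (ltW d20)) := xd.
  by move/le_lt_trans; apply; rewrite ltr_pdivrMr// mulr_natr mulr2n ltrDl.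
by rewrite ltr_distlC => /andP[h _]; apply: ltW; apply: le_lt_trans h; lra.
Qed.

(* [B x j] is an antiderivative of [b - c x j]. Both scaled bumps have total mass 1, so
   [B x j] is supported in [-1, 1] when [|x j| <= 1]. *)
Let c (x : 'rV[R]_n) (j : 'I_n) (t : R) : R := 2 * b (- x ord0 j + 2 * t).
Let B (x : 'rV[R]_n) (j : 'I_n) (t : R) : R := S t + (-1) * S (- x ord0 j + 2 * t).

Let sc x j : smooth1 (c x j).
Proof. by move=> k; apply: CkM; [exact: Ck_cst|apply: Ck_affine; exact: sb]. Qed.

Let sB x j : smooth1 (B x j).
Proof.
move=> k; apply: CkD; first exact: sS.
by apply: CkM; [exact: Ck_cst|apply: Ck_affine; exact: sS].
Qed.

Let dB x j t : derive1 (B x j) t = b t - c x j t.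
Proof.
have dS s : is_derive s (1 : R) S (b s) by have [h _] := smooth1_derive sS; exact: h.
have dl : is_derive t (1 : R) (fun t => - x ord0 j + 2 * t) 2.
  have := is_deriveD (is_derive_cst (- x ord0 j) t (1 : R))
    (is_deriveZ (2 : R) (is_derive_id t (1 : R))).
  by rewrite add0r /GRing.scale/= mulr1.
have d1 := @is_derive1_comp _ _ (fun t => - x ord0 j + 2 * t) _ _ _ (dS _) dl.
have d2 := is_deriveD (dS t) (is_deriveZ (-1 : R) d1).
rewrite derive1E; apply: etrans (@derive_val _ _ _ _ _ _ _ d2) _.
by rewrite /GRing.scale/= mulN1r /c mulrC.
Qed.

(** If [|x_j| <= 1] and [|t| > 1] then [2t - x_j] is still outside [-1, 1]. Hence the comparison of
    averages is made for [x] in the unit cube. *)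
Let c_out x j t : cube 1 x -> 1 < `|t| -> c x j t = 0.
Proof.
move=> x1 t1; rewrite /c /b derive_smooth_step_out ?mulr0//.
have := x1 j; rewrite ler_norml => /andP[? ?].
by move: t1; rewrite !lter_normr => /orP[?|?]; apply/orP; [left|right]; lra.
Qed.

(** Beyond [-1, 1] both smooth steps have reached the same plateau, 0 or 1, and cancel. *)
Let B_out x j t : cube 1 x -> 1 < `|t| -> B x j t = 0.
Proof.
move=> x1; have := x1 j; rewrite ler_norml => /andP[? ?].
rewrite lter_normr /B /S => /orP[?|?].
  by rewrite !smooth_step_ge1 ?mulN1r ?subrr//; lra.
by rewrite !smooth_step_le0 ?mulr0 ?addr0//; lra.
Qed.

(** One constant for all three kinds of factors of [W x i]: [b], its rescaling [c x j], which
    doubles it, and [B x j], a difference of two steps and hence at most 2. *)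
Let b_bounded : exists2 D, 2 <= D & forall t, `|b t| *+ 2 <= D.
Proof.
have cb : {within `[(-1 : R), 1], continuous (fun t => `|b t|)}.
  apply: continuous_subspaceT => t; apply: continuous_comp; last exact: norm_continuous.
  exact: smooth1_continuous.
have le11 : (-1 : R) <= 1 by lra.
have [m m1 mmax] := EVT_max le11 cb.
exists (Num.max 2 (`|b m| *+ 2)); first by rewrite le_max lexx.
move=> t; have [t1|t1] := leP `|t| 1.
  rewrite le_max; apply/orP; right; rewrite lerMn2r/=; apply: mmax.
  by rewrite in_itv/= -ler_norml.
by rewrite /b derive_smooth_step_out// normr0 mul0rn le_max ler0n.
Qed.

(* Replacing the factors [b] by [c x j] one index at a time telescopes the difference of
   the two products, and [W x i] is an antiderivative of the [i]-th step. *)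
Let chain x k (j : 'I_n) : R -> R := if (j < k)%N then c x j else b.

Let W x (i : 'I_n) := prod_fun (with_factor (chain x i) i (B x i)).

Let schain x k j : smooth1 (chain x k j).
Proof. by rewrite /chain; case: ifP. Qed.

Let sW x (i j : 'I_n) : smooth1 (with_factor (chain x i) i (B x i) j).
Proof. by rewrite /with_factor; case: eqP. Qed.

Let W_out x i y : cube 1 x -> ~ cube 1 y -> W x i y = 0.
Proof.
move=> x1; apply: prod_out => j t t1; rewrite /with_factor; case: eqP => _; first exact: B_out.
by rewrite /chain; case: ifP => _; [exact: c_out|exact: derive_smooth_step_out].
Qed.

Let W_test x i : cube 1 x -> test_function (W x i).
Proof.
move=> x1; apply: (@test_function_cube _ _ _ 1); last by move=> y; exact: W_out.
exact: smooth_prod_fun.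
Qed.

Let W_bound D x i y : 2 <= D -> (forall t, `|b t| *+ 2 <= D) -> `|W x i y| <= D ^+ n.
Proof.
move=> D2 bD; rewrite /W /prod_fun normr_prod.
rewrite -[n in leRHS]card_ord -prodr_const; apply: ler_prod => j _.
rewrite normr_ge0/= /with_factor; case: eqP => _.
  apply: le_trans D2; rewrite /B; apply: le_trans (ler_normD _ _) _.
  by rewrite mulN1r normrN; apply: lerD; exact: smooth_step_bound.
rewrite /chain; case: ifP => _.
  by rewrite /c normrM ger0_norm// [leLHS]mulr_natl; exact: bD.
by apply: le_trans (bD (y ord0 j)); rewrite mulr2n lerDl.
Qed.

Let dW x i y : 'D_(basis_vec R i) (W x i) y =
  prod_fun (chain x i) y - prod_fun (chain x i.+1) y.
Proof.
rewrite (@derive_val _ _ _ _ _ _ _ (is_derive_prod_fun i y (@sW x i))).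
rewrite prod_fun_with_factor [with_factor _ _ _ i]/with_factor eqxx dB mulrBl.
have h f : (forall j, j != i -> f j = with_factor (chain x i) i (B x i) j) ->
  f i (y ord0 i) * \prod_(j | j != i) with_factor (chain x i) i (B x i) j (y ord0 j) = prod_fun f y.
  move=> fE; rewrite /prod_fun [RHS](bigD1 i)//=; congr (_ * _).
  by apply: eq_bigr => j ji; rewrite fE.
rewrite -[prod_fun (chain x i) y]h; last by move=> j /negbTE ji; rewrite /with_factor ji.
(* [chain x i] and [chain x i.+1] differ at the index [i] alone, so both share the remaining
   product. *)
rewrite -[prod_fun (chain x i.+1) y]h; last first.
  move=> j ji; rewrite /with_factor (negbTE ji) /chain ltnS leq_eqVlt.
  by rewrite (_ : (j == i :> nat) = false)//; exact/negbTE.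
by rewrite /chain ltnn ltnSn.
Qed.

Let bump_sub x y : bump_rV y - prod_fun (c x) y = \sum_(i < n) 'D_(basis_vec R i) (W x i) y.
Proof.
under eq_bigr do rewrite dW.
rewrite -(big_mkord xpredT (fun i => prod_fun (chain x i) y - prod_fun (chain x i.+1) y)).
rewrite -[RHS]opprK -sumrN; under eq_bigr do rewrite opprB.
rewrite telescope_sumr// opprB /bump_rV; congr (_ - _); rewrite /prod_fun.
by apply: eq_bigr => j _; rewrite /chain ltn_ord.
Qed.

Let half x : 'rV[R]_n -> 'rV[R]_n := affine_rV (2^-1 *: x) 2^-1.

(** Doubling [(x + y)/2] and subtracting [x] gives back [y], so the scaled bump pulled back by
    [half x] is the original bump. The [2^n] compensates the Jacobian in [A_half]. *)
Let prod_c x y : prod_fun (c x) (half x y) = 2 ^+ n * bump_rV y.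
Proof.
rewrite /bump_rV /prod_fun /c big_split/= prodr_const card_ord; congr (_ * _).
by apply: eq_bigr => j _; rewrite !mxE; congr b; field.
Qed.

Let A u : R := \int[mu]_y (u y * bump_rV y).

Let iub u : continuous u -> mu.-integrable setT (EFin \o (fun y => u y * bump_rV y)).
Proof.
by move=> cu; apply: (L1loc_integrableM (continuous_L1loc cu) cbump bump_out).
Qed.

Let A_half u x : cube 1 x -> continuous u ->
  A (u \o half x) = \int[mu]_y (u y * prod_fun (c x) y).
Proof.
move=> x1 cu; have h0 : (0 : R) < 2^-1 by rewrite invr_gt0.
have cP : continuous (prod_fun (c x)).
  by apply: continuous_prod_fun => j; exact: smooth1_continuous.
have P0 y : ~ cube 1 y -> prod_fun (c x) y = 0.
  by apply: prod_out => j t; exact: c_out.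
have iP := L1loc_integrableM (continuous_L1loc cu) cP P0.
rewrite (Rintegral_affine (2^-1 *: x) h0 iP).
rewrite -(RintegralZl (2^-1 ^+ n) measurableT (integrable_affine (2^-1 *: x) h0 iP)).
apply: eq_Rintegral => y _; rewrite -/(half x y) prod_c /= exprVn; field.
by rewrite expf_neq0.
Qed.

Let A_step : exists2 K, 0 < K & forall u Du l x, 0 < l -> grad_le p u Du l -> cube 1 x ->
  `|A u - A (u \o half x)| <= K * l.
Proof.
have [D D2 bD] := b_bounded.
have D0 : 0 < D by lra.
(* There are [n] divergence terms, each bounded by [Rintegral_derive_bound] with [D^n] a bound on
   [W x i]. The added 1 keeps the constant positive when [n] is 0. *)
exists (D ^+ n * (2 ^+ n + 1) * n%:R + 1).
  by rewrite ltr_wpDl// !mulr_ge0// ?addr_ge0// exprn_ge0// ltW.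
move=> u Du l x l0 gu x1; have [cu _ _] := gu.
have cP : continuous (prod_fun (c x)).
  by apply: continuous_prod_fun => j; exact: smooth1_continuous.
have P0 y : ~ cube 1 y -> prod_fun (c x) y = 0.
  by apply: prod_out => j t; exact: c_out.
have iW i : mu.-integrable setT (EFin \o (fun y => u y * 'D_(basis_vec R i) (W x i) y)).
  apply: (L1loc_integrableM (continuous_L1loc cu)).
    exact: test_function_continuous_derive (W_test i x1).
  by apply: derive_out => y; exact: W_out.
rewrite A_half// /A -RintegralB//; last 2 first.
- exact: iub.
- exact: (L1loc_integrableM (continuous_L1loc cu) cP P0).
rewrite (@eq_Rintegral _ _ _ _ _ (fun y => \sum_(i < n) u y * 'D_(basis_vec R i) (W x i) y)); last first.
  by move=> y _; rewrite -mulrBr bump_sub mulr_sumr.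
have -> : \int[mu]_y (\sum_(i < n) u y * 'D_(basis_vec R i) (W x i) y) =
    \sum_(i < n) \int[mu]_y (u y * 'D_(basis_vec R i) (W x i) y).
  exact: Rintegral_sum.
apply: le_trans (ler_norm_sum _ _ _) _.
apply: (@le_trans _ _ (\sum_(i < n) D ^+ n * (2 ^+ n + 1) * l)).
  apply: ler_sum => i _; apply: (@Rintegral_derive_bound R n p u Du l i (W x i) (D ^+ n) p1 l0 gu) => //.
  - exact: W_test.
  - by move=> y; exact: W_out.
  - by move=> y; exact: W_bound.
rewrite sumr_const card_ord -[leLHS]mulr_natr; set C := D ^+ n * _.
by rewrite mulrDl mul1r [leLHS]mulrAC lerDl ltW.
Qed.

Let alpha := 1 - n%:R / p.

Let alpha_gt0 : 0 < alpha.
Proof. by rewrite subr_gt0 ltr_pdivrMr// mul1r. Qed.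

Let theta : R := 2^-1 `^ alpha.

Let theta_gt0 : 0 < theta. Proof. by rewrite powR_gt0// invr_gt0. Qed.

Let theta_lt1 : theta < 1.
Proof.
apply: (@lt_le_trans _ _ (1 `^ alpha)); last by rewrite powR1.
by apply: gt0_ltr_powR; rewrite ?nnegrE ?invr_ge0// invf_lt1// ltr1n.
Qed.

(** Induction on [k] with [u] varying: one halving replaces the bound [l] by [theta * l], and
    [K / (1 - theta)] solves [s = K + theta s]. *)
Let A_iter K u Du l x k : 0 < K ->
  (forall u Du l x, 0 < l -> grad_le p u Du l -> cube 1 x ->
    `|A u - A (u \o half x)| <= K * l) ->
  0 < l -> grad_le p u Du l -> cube 1 x ->
  `|A u - A (u \o iter k (half x))| <= K / (1 - theta) * l.
Proof.
move=> K0 hK l0 gu x1; elim: k u Du l l0 gu => [|k IH] u Du l l0 gu.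
  rewrite (_ : u \o iter 0 (half x) = u)// subrr normr0.
  by rewrite mulr_ge0 ?divr_ge0 ?subr_ge0 ?ltW.
have h0 : (0 : R) < 2^-1 by rewrite invr_gt0.
have gu' := grad_le_affine p0 (2^-1 *: x) h0 (ltW l0) gu.
rewrite -[A u](subrK (A (u \o half x))) -addrA.
apply: le_trans (ler_normD _ _) _.
apply: (@le_trans _ _ (K * l + K / (1 - theta) * (theta * l))).
  apply: lerD; first exact: hK gu x1.
  apply: (IH _ _ _ _ gu'); exact: mulr_gt0.
rewrite le_eqVlt; apply/orP; left; apply/eqP; field.
by rewrite gt_eqF// subr_gt0.
Qed.

Let iter_half x k y : iter k (half x) y - x = 2 ^- k *: (y - x).
Proof.
elim: k => [|k IH] /=; first by rewrite expr0 invr1 scale1r.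
rewrite exprS invfM -scalerA -IH /half /affine_rV scalerBr addrAC.
rewrite [RHS]addrC; congr (_ + _).
by rewrite -[X in _ - X]scale1r -scalerBl -scaleNr; congr (_ *: _); field.
Qed.

Let A_iter_cvg u x e : continuous u -> cube 1 x -> 0 < e ->
  exists k, `|A (u \o iter k (half x)) - u x * \int[mu]_y bump_rV y| <= e * \int[mu]_y bump_rV y.
Proof.
move=> cu x1 e0.
have /cvgrPdist_lt/(_ _ e0)/nbhs_ballP[d /= d0 hd] := cu x.
(* The iterated map shrinks [y - x] by [2^-k], and two points of the unit cube are at sup distance
   at most 2. So the whole cube lands where [u] is within [e] of [u x]. *)
have [k kd] : exists k, 2 ^- k * 2 < d.
  have hd2 : (0 : R) < d / 2 by rewrite divr_gt0.
  have h1 : `|2^-1 : R| < 1 by rewrite ger0_norm ?invr_ge0// invf_lt1// ltr1n.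
  have /cvgrPdist_lt/(_ _ hd2)[k _ /(_ k (leqnn k)) /=] := cvg_expr h1.
  rewrite sub0r normrN exprVn ger0_norm ?invr_ge0 ?exprn_ge0// => kd.
  by exists k; rewrite -ltr_pdivlMr.
exists k.
have cv : continuous (u \o iter k (half x)).
  move=> y; apply: continuous_comp; last exact: cu.
  elim: k {kd} => [|k IH]; first exact: cvg_id.
  apply: (@continuous_comp _ _ _ (iter k (half x)) (half x)); first exact: IH.
  exact: continuous_affine.
have i1 := iub cv.
have i2 : mu.-integrable setT (EFin \o (fun y => u x * bump_rV y)).
  exact: (integrableZl measurableT (u x) integrable_bump).
have i3 : mu.-integrable setT (EFin \o (fun y => e * bump_rV y)).
  exact: (integrableZl measurableT e integrable_bump).
have i12 := integrableB measurableT i1 i2.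
rewrite /A -!RintegralZl// -RintegralB//.
apply: le_trans (le_normr_Rintegral measurableT i12) _.
apply: le_Rintegral => //; first exact: integrable_norm i12.
move=> y _; rewrite -mulrBl normrM (ger0_norm (bump_ge0 y)).
have [y1|/bump_out ->] := pselect (cube 1 y); last by rewrite !mulr0.
apply: ler_wpM2r; first exact: bump_ge0.
apply: ltW; rewrite distrC; apply: hd.
rewrite mx_norm_ball /ball_ /= distrC iter_half normrZ ger0_norm; last first.
  by rewrite invr_ge0 exprn_ge0.
apply: le_lt_trans kd; apply: ler_wpM2l; first by rewrite invr_ge0 exprn_ge0.
apply: le_trans (ler_normB _ _) _.
by rewrite [leRHS](_ : _ = 1 + 1); [apply: lerD; exact/cubeP|ring].
Qed.

(** A single average controls [u] at all points of the unit cube ([loc]). Recentring at [y] and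
    scaling by [r = |x - y|] moves [y] to 0 and [x] to a unit vector. Passing through the common
    average costs the factor 2, and the factor [r^alpha] comes from [grad_le_affine]. *)
Lemma morrey : exists2 K, 0 < K & forall u Du l, 0 < l -> grad_le p u Du l ->
  forall x y, `|u x - u y| <= K * enorm (x - y) `^ alpha * l.
Proof.
have [K K0 hK] := A_step.
set J := \int[mu]_y bump_rV y; have J0 : 0 < J := Rintegral_bump_gt0.
pose K1 := K / (1 - theta).
have K10 : 0 < K1 by rewrite divr_gt0// subr_gt0.
have loc u Du l x : 0 < l -> grad_le p u Du l -> cube 1 x -> `|A u - u x * J| <= K1 * l.
  move=> l0 gu x1; have [cu _ _] := gu; apply/ler_addgt0Pr => e e0.
  have [k hk] := A_iter_cvg cu x1 (divr_gt0 e0 J0).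
  rewrite divfK ?gt_eqF// in hk.
  rewrite -[A u](subrK (A (u \o iter k (half x)))) -addrA.
  apply: le_trans (ler_normD _ _) _; apply: lerD => //.
  exact: A_iter K0 hK l0 gu x1.
exists (2 * K1 / J); first by rewrite divr_gt0// mulr_gt0.
move=> u Du l l0 gu x y.
have [->|xy] := eqVneq x y.
  rewrite !subrr normr0; apply: mulr_ge0; last exact: ltW.
  by apply: mulr_ge0; [rewrite ltW// divr_gt0// mulr_gt0|exact: powR_ge0].
set r := enorm (x - y).
have r0 : 0 < r.
  rewrite lt_def enorm_ge0 andbT; apply: contraNneq xy => /enorm_eq0/eqP.
  by rewrite subr_eq0.
have gv := grad_le_affine p0 y r0 (ltW l0) gu.
pose z := r^-1 *: (x - y).
have z1 : cube 1 z.
  move=> j; rewrite mxE normrM gtr0_norm ?invr_gt0// mulrC ler_pdivrMr// mul1r.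
  exact: coord_le_enorm.
have o1 : cube 1 (0 : 'rV[R]_n) by move=> j; rewrite mxE normr0.
have rl0 : 0 < r `^ (1 - n%:R / p) * l by rewrite mulr_gt0 ?powR_gt0.
have hz := loc _ _ _ _ rl0 gv z1; have ho := loc _ _ _ _ rl0 gv o1.
have vz : (u \o affine_rV y r) z = u x.
  by rewrite /= /affine_rV /z scalerA divff ?gt_eqF// scale1r addrC subrK.
have vo : (u \o affine_rV y r) 0 = u y by rewrite /= /affine_rV scaler0 addr0.
rewrite vz in hz; rewrite vo in ho.
rewrite -(ler_pM2r J0) -[X in X * J <= _]/(`|u x - u y|) -[X in _ * X <= _](gtr0_norm J0) -normrM mulrBl.
have -> : 2 * K1 / J * r `^ alpha * l * J =
    K1 * (r `^ (1 - n%:R / p) * l) + K1 * (r `^ (1 - n%:R / p) * l).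
  by rewrite -/alpha; field; rewrite gt_eqF.
rewrite -(subrK (A (u \o affine_rV y r)) (u x * J)) -addrA.
apply: le_trans (ler_normD _ _) _; apply: lerD => //.
by rewrite distrC.
Qed.

End morrey.

(** * Uniform convexity of the energy *)

(** The absolute value gives continuity on the whole line, so that compositions need no restriction
    to nonnegative arguments. *)
Lemma continuous_norm_powR (R : realType) (p : R) : 0 < p ->
  continuous (fun x : R => `|x| `^ p).
Proof.
move=> p0 x; have [->|x0] := eqVneq x 0.
  apply/cvgrPdist_lt => e e0; rewrite normr0 powR0 ?gt_eqF//.
  near=> y; rewrite sub0r normrN ger0_norm ?powR_ge0//.
  have -> : e = (e `^ p^-1) `^ p by rewrite -powRrM mulVf ?gt_eqF// powRr1// ltW.
  apply: gt0_ltr_powR; rewrite ?nnegrE ?powR_ge0//.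
  near: y; apply: (@cvgr0_norm_lt _ _ _ _ _ id); last by rewrite powR_gt0.
  exact: cvg_id.
apply: (@continuous_comp _ _ _ (fun x : R => `|x|) (fun x => x `^ p)); first exact: norm_continuous.
by have /(is_derive1_powR p)/is_derive_continuous : 0 < `|x| by rewrite normr_gt0.
Unshelve. all: by end_near.
Qed.

Section uniform_convexity.
Context (R : realType) (p : R).
Hypothesis p1 : 1 < p.

Let p0 : 0 < p. Proof. exact: lt_trans p1. Qed.

(** Strict convexity in tangent form, from the mean value theorem and the strict growth of
    [x^(p-1)]. The point [t = 0] is treated apart, since [powR] is differentiated at positive
    points. *)
Let powR_tangent_lt (m t : R) : 0 < m -> 0 <= t -> t != m ->
  m `^ p + p * m `^ (p - 1) * (t - m) < t `^ p.
Proof.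
move=> m0 t0 tm.
have cp (a b : R) : 0 < a -> {within `[a, b], continuous (fun x : R => x `^ p)}.
  move=> a0; apply: continuous_in_subspaceT => x; rewrite inE/= in_itv/= => /andP[ax _].
  by have /(is_derive1_powR p)/is_derive_continuous := lt_le_trans a0 ax.
have dp (a b : R) : 0 < a -> forall x, x \in `]a, b[ ->
    is_derive x (1 : R) (fun x : R => x `^ p) (p * x `^ (p - 1)).
  by move=> a0 x; rewrite in_itv/= => /andP[ax _]; apply: is_derive1_powR; exact: lt_trans ax.
have p1' : 0 < p - 1 by rewrite subr_gt0.
have [tm'|mt|/eqP] := ltgtP t m; last by rewrite (negbTE tm).
- have [->|t00] := eqVneq t 0.
    rewrite powR0 ?gt_eqF// sub0r mulrN -mulrA [_ * m]mulrC mulr_powRB1 ?ltW//.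
    by rewrite subr_lt0 -[X in X < _]mul1r ltr_pM2r// powR_gt0.
  have tp : 0 < t by rewrite lt_def t00.
  have [c] := @MVT _ (fun x : R => x `^ p) (fun x => p * x `^ (p - 1)) t m tm'
    (dp t m tp) (cp t m tp).
  rewrite in_itv/= => /andP[tc cm] h.
  have cpos : 0 < c by exact: lt_trans tc.
  have : p * c `^ (p - 1) * (m - t) < p * m `^ (p - 1) * (m - t).
    rewrite ltr_pM2r ?subr_gt0// ltr_pM2l//.
    by apply: gt0_ltr_powR => //; rewrite nnegrE ltW.
  set P := p * m `^ _; set Q := p * c `^ _ in h *; lra.
- have [c] := @MVT _ (fun x : R => x `^ p) (fun x => p * x `^ (p - 1)) m t mt
    (dp m t m0) (cp m t m0).
  rewrite in_itv/= => /andP[tc cm] h.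
  rewrite -ltrBrDl h ltr_pM2r ?subr_gt0// ltr_pM2l//.
  by apply: gt0_ltr_powR => //; rewrite nnegrE ltW// (lt_trans m0).
Qed.

(** Add the tangent inequalities taken at the midpoint: the linear terms cancel. *)
Lemma powR_midpoint_lt (s t : R) : 0 <= s -> 0 <= t -> s != t ->
  ((s + t) / 2) `^ p < (s `^ p + t `^ p) / 2.
Proof.
move=> s0 t0 st; set m := (s + t) / 2.
have m0 : 0 < m.
  rewrite divr_gt0// lt_def addr_ge0// andbT paddr_eq0//.
  by apply: contra st => /andP[/eqP -> /eqP ->].
have sm : s != m by apply: contra st => /eqP sm; apply/eqP; rewrite /m in sm; lra.
have tm : t != m by apply: contra st => /eqP tm; apply/eqP; rewrite /m in tm; lra.
have hs := powR_tangent_lt m0 s0 sm; have ht := powR_tangent_lt m0 t0 tm.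
rewrite ltr_pdivlMr//.
have E : p * m `^ (p - 1) * (s - m) + p * m `^ (p - 1) * (t - m) = 0.
  by rewrite -mulrDr (_ : s - m + (t - m) = 0) ?mulr0// /m; lra.
lra.
Qed.

Section vectors.
Context (n : nat).
Implicit Types (a b : 'rV[R]_n).

(** A function of one pair, so that it can be minimized over a compact set of pairs. *)
Definition midpoint_gap (z : 'rV[R]_n * 'rV[R]_n) : R :=
  (enorm z.1 `^ p + enorm z.2 `^ p) / 2 - enorm (2^-1 *: (z.1 + z.2)) `^ p.

Let enorm_half a b : enorm (2^-1 *: (a + b)) <= (enorm a + enorm b) / 2.
Proof.
by rewrite enormZ ger0_norm ?invr_ge0// mulrC ler_pM2r ?invr_gt0// ler_enormD.
Qed.

Let powR_midpoint_le (s t : R) : 0 <= s -> 0 <= t ->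
  ((s + t) / 2) `^ p <= (s `^ p + t `^ p) / 2.
Proof.
move=> s0 t0; have [->|st] := eqVneq s t; last by rewrite ltW// powR_midpoint_lt.
have half2 (x : R) : (x + x) / 2 = x by field.
by rewrite !half2.
Qed.

Lemma midpoint_gap_ge0 a b : 0 <= midpoint_gap (a, b).
Proof.
rewrite subr_ge0 /=; apply: le_trans (powR_midpoint_le (enorm_ge0 _) (enorm_ge0 _)).
by apply: ge0_ler_powR; rewrite ?nnegrE ?enorm_ge0 ?divr_ge0 ?addr_ge0 ?enorm_ge0// ltW.
Qed.

(** If the lengths differ, strictness comes from the power function. If they agree, it comes from
    the parallelogram law. *)
Lemma midpoint_gap_gt0 a b : a != b -> 0 < midpoint_gap (a, b).
Proof.
move=> ab; rewrite subr_gt0/=.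
have h : enorm (2^-1 *: (a + b)) `^ p <= ((enorm a + enorm b) / 2) `^ p.
  by apply: ge0_ler_powR; rewrite ?nnegrE ?enorm_ge0 ?divr_ge0 ?addr_ge0 ?enorm_ge0// ltW.
have [ab'|ab'] := eqVneq (enorm a) (enorm b); last first.
  by apply: le_lt_trans h _; apply: powR_midpoint_lt => //; exact: enorm_ge0.
rewrite ab' (_ : (_ + _) / 2 = enorm b `^ p); last by field.
apply: gt0_ltr_powR; rewrite ?nnegrE ?enorm_ge0//.
have := parallelogram a b; rewrite ab' => pe.
have d0 : 0 < enorm (a - b).
  rewrite lt_def enorm_ge0 andbT; apply: contraNneq ab => /enorm_eq0/eqP.
  by rewrite subr_eq0.
rewrite enormZ ger0_norm ?invr_ge0//.
rewrite -(@ltr_pXn2r _ 2) ?nnegrE ?mulr_ge0 ?enorm_ge0 ?invr_ge0// exprMn.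
have : 0 < enorm (a - b) ^+ 2 by rewrite exprn_gt0.
set x := enorm (a + b) ^+ 2 in pe *; set y := enorm (a - b) ^+ 2 in pe *.
move=> y0; have -> : x = 4 * enorm b ^+ 2 - y by lra.
by rewrite -subr_gt0 (_ : _ - _ = y / 4); [rewrite divr_gt0|field].
Qed.

Let cpow (T : topologicalType) (f : T -> 'rV[R]_n) : continuous f ->
  continuous (fun x => enorm (f x) `^ p).
Proof.
move=> cf x.
rewrite (_ : (fun x => _) = (fun x => `|enorm (f x)| `^ p)); last first.
  by apply/funext => y; rewrite ger0_norm ?enorm_ge0.
apply: (@continuous_comp _ _ _ (fun x => enorm (f x)) (fun t => `|t| `^ p)).
  by apply: (@continuous_comp _ _ _ f); [exact: cf|exact: continuous_enorm].
exact: (continuous_norm_powR p0).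
Qed.

Lemma continuous_midpoint_gap : continuous midpoint_gap.
Proof.
have c1 : continuous (fun z : 'rV[R]_n * 'rV[R]_n => z.1) by move=> z; exact: cvg_fst.
have c2 : continuous (fun z : 'rV[R]_n * 'rV[R]_n => z.2) by move=> z; exact: cvg_snd.
have c3 : continuous (fun z : 'rV[R]_n * 'rV[R]_n => 2^-1 *: (z.1 + z.2)).
  move=> z; apply: (@continuous_comp _ _ _ (fun z : 'rV[R]_n * 'rV[R]_n => z.1 + z.2)).
    by apply: continuousD; [exact: c1|exact: c2].
  exact: scaler_continuous.
have k1 := @cpow _ _ c1; have k2 := @cpow _ _ c2; have k3 := @cpow _ _ c3.
move=> z; apply: (@continuousB _ _ _
  (fun z : 'rV[R]_n * 'rV[R]_n => (enorm z.1 `^ p + enorm z.2 `^ p) / 2)); last exact: k3.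
apply: (@continuousM _ _ (fun z : 'rV[R]_n * 'rV[R]_n => enorm z.1 `^ p + enorm z.2 `^ p) (cst 2^-1));
  last exact: cst_continuous.
by apply: (@continuousD _ _ _ (fun z : 'rV[R]_n * 'rV[R]_n => enorm z.1 `^ p)); [exact: k1|exact: k2].
Qed.

Lemma midpoint_gapZ r a b : 0 <= r -> midpoint_gap (r *: a, r *: b) = r `^ p * midpoint_gap (a, b).
Proof.
move=> r0; rewrite /midpoint_gap/=.
have -> : 2^-1 *: (r *: a + r *: b) = r *: (2^-1 *: (a + b)).
  by rewrite -scalerDr !scalerA mulrC.
by rewrite !(enormZ r) ger0_norm// !powRM ?enorm_ge0//; ring.
Qed.

(** Normalized pairs with [|a - b|^p > e] lie in the compact set [K], where [a] and [b] differ and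
    the gap therefore has a minimum [c > 0]. For them [|a - b| <= 2], whence the constant
    [2^p / c]. *)
Let unif_norm e : 0 < e -> exists2 C, 0 <= C & forall a b,
  enorm a `^ p + enorm b `^ p = 1 -> enorm (a - b) `^ p <= e + C * midpoint_gap (a, b).
Proof.
move=> e0.
pose K : set ('rV[R]_n * 'rV[R]_n) := (cube 1 `*` cube 1) `&`
  [set z | e <= enorm (z.1 - z.2) `^ p].
have c12 : continuous (fun z : 'rV[R]_n * 'rV[R]_n => z.1 - z.2).
  by move=> z; apply: continuousB; [exact: cvg_fst|exact: cvg_snd].
have cd := @cpow _ _ c12.
have cK : compact K.
  apply: compact_closedI; first by apply: compact_setX; exact: compact_cube.
  apply: (@closed_comp _ _ (fun z : 'rV[R]_n * 'rV[R]_n => enorm (z.1 - z.2) `^ p) [set x | e <= x]).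
    by move=> z _; exact: cd.
  exact: closed_ge.
have small a b : enorm a `^ p + enorm b `^ p = 1 -> enorm a <= 1 /\ enorm b <= 1.
  move=> ab; split; rewrite leNgt; apply/negP => h.
    have := powR_ge0 (enorm b) p.
    have : 1 `^ p < enorm a `^ p by apply: gt0_ltr_powR; rewrite ?nnegrE ?enorm_ge0.
    by rewrite powR1; lra.
  have := powR_ge0 (enorm a) p.
  have : 1 `^ p < enorm b `^ p by apply: gt0_ltr_powR; rewrite ?nnegrE ?enorm_ge0.
  by rewrite powR1; lra.
have inK a b : enorm a `^ p + enorm b `^ p = 1 -> e < enorm (a - b) `^ p -> K (a, b).
  move=> /small[a1 b1] eab; split; last exact: ltW.
  split => i /=; first exact: le_trans (coord_le_enorm _ _) a1.
  exact: le_trans (coord_le_enorm _ _) b1.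
have [K0|/set0P K0] := eqVneq K set0.
  exists 0 => // a b ab; rewrite mul0r addr0 leNgt; apply/negP => /(inK _ _ ab).
  by rewrite K0.
have cg : {within K, continuous midpoint_gap}.
  by apply: continuous_subspaceT; exact: continuous_midpoint_gap.
have [z0 /set_mem] := @compact_EVT_min _ R midpoint_gap K K0 cK cg.
case: z0 => a0 b0 K00 gmin.
set c := midpoint_gap (a0, b0) in gmin.
have c0 : 0 < c.
  apply: midpoint_gap_gt0; apply: contraTneq e0 => ab; rewrite -leNgt.
  have [_ /=] := K00; rewrite ab subrr enorm0 powR0//; exact: lt0r_neq0.
exists (2 `^ p / c); first by rewrite divr_ge0 ?powR_ge0// ltW.
move=> a b ab; have [abe|abe] := leP (enorm (a - b) `^ p) e.
  by rewrite ler_wpDr// mulr_ge0 ?midpoint_gap_ge0// divr_ge0 ?powR_ge0// ltW.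
apply: ler_wpDl; first exact: ltW.
apply: (@le_trans _ _ (2 `^ p)).
  apply: ge0_ler_powR; rewrite ?nnegrE ?enorm_ge0//; first exact: ltW.
  have [a1 b1] := small _ _ ab.
  by apply: le_trans (ler_enormD _ _) _; rewrite enormN; lra.
have cab : c <= midpoint_gap (a, b) by apply: gmin; apply/mem_set; exact: inK.
clearbody c; rewrite -mulrA -[leLHS]mulr1; apply: ler_wpM2l; first exact: powR_ge0.
by rewrite mulrC ler_pdivlMr// mul1r.
Qed.

(** All terms are homogeneous of degree [p], so the pair may be normalized. The inequality takes the
    place of Clarkson's: it is linear in [p]-th powers and can be integrated as it stands. *)
Lemma uniform_convexity e : 0 < e -> exists2 C, 0 <= C & forall a b,
  enorm (a - b) `^ p <= e * (enorm a `^ p + enorm b `^ p) + C * midpoint_gap (a, b).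
Proof.
move=> e0; have [C C0 hC] := unif_norm e0; exists C => // a b.
set N := enorm a `^ p + enorm b `^ p.
have N0 : 0 <= N by rewrite addr_ge0// powR_ge0.
have [NZ|NZ] := eqVneq N 0.
  have /eqP := NZ; rewrite paddr_eq0 ?powR_ge0// !powR_eq0 => /andP[/andP[/eqP/enorm_eq0 -> _] /andP[/eqP/enorm_eq0 -> _]].
  rewrite subr0 enorm0 powR0 ?gt_eqF//; apply: addr_ge0; apply: mulr_ge0 => //.
    exact: ltW.
  exact: midpoint_gap_ge0.
have Np : 0 < N by rewrite lt_def NZ.
pose r := N `^ (- p^-1).
have rp : r `^ p = N^-1.
  by rewrite /r -powRrM mulNr mulVf ?gt_eqF// powR_inv1.
have r0 : 0 <= r by exact: powR_ge0.
have nZ v : enorm (r *: v) `^ p = N^-1 * enorm v `^ p.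
  by rewrite enormZ ger0_norm// powRM ?enorm_ge0// rp.
have := hC (r *: a) (r *: b).
rewrite -scalerBr midpoint_gapZ// !nZ rp -mulrDr mulVf// => /(_ erefl).
by rewrite -(ler_pM2l Np) mulVKf// mulrDr [N * e]mulrC (mulrCA N C) mulVKf.
Qed.

End vectors.
End uniform_convexity.

(** * The space D^{1,p} *)

Section dirichlet_space.
Context (R : realType) (n : nat) (p : R).
Hypothesis p1 : 1 < p.
Local Notation mu := (lebesgue_rV R n).
Implicit Types (u : 'rV[R]_n -> R) (Du : 'rV[R]_n -> 'rV[R]_n).

Let p0 : 0 < p. Proof. exact: lt_trans p1. Qed.

Lemma energy_ge0 Du : (0 <= energy p Du)%E.
Proof. by apply: integral_ge0 => x _; rewrite lee_fin powR_ge0. Qed.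

Lemma normDu_le Du l : 0 <= l ->
  (normDu p Du <= l%:E)%E <-> (energy p Du <= (l `^ p)%:E)%E.
Proof.
move=> l0; rewrite normDuE; have := energy_ge0 Du.
case: (energy p Du) => [r| |] //=; last by rewrite invr_eq0 gt_eqF.
rewrite !lee_fin => r0.
have -> : (r <= l `^ p) = ((r `^ p^-1) `^ p <= l `^ p).
  by rewrite -powRrM mulVf ?gt_eqF// powRr1.
split=> h; first by apply: ge0_ler_powR; rewrite ?nnegrE ?powR_ge0// ltW.
by rewrite leNgt; apply/negP => hl; move: h; rewrite leNgt gt0_ltr_powR ?nnegrE ?powR_ge0.
Qed.

Lemma grad_le_trans u Du l l' : 0 <= l -> l <= l' -> grad_le p u Du l -> grad_le p u Du l'.
Proof.
move=> l0 ll' [cu uDu El]; split=> //; apply: le_trans El _; rewrite lee_fin.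
by apply: ge0_ler_powR; rewrite ?nnegrE//; [exact: ltW|exact: le_trans ll'].
Qed.

Lemma grad_le_D1p u Du l : grad_le p u Du l -> D1p p u.
Proof.
move=> [cu uDu El]; split => //; first exact: continuous_L1loc.
have mDu i : measurable_fun setT (fun x => Du x ord0 i) by have [[]] := uDu i.
move=> i; have [_ wi] := uDu i; exists (fun x => Du x ord0 i) => //.
rewrite inE; apply/andP; split; rewrite inE//=.
rewrite /finite_norm unlock; apply: poweR_lty.
apply: le_lt_trans (le_lt_trans El (ltry _)); apply: ge0_le_integral => //.
- by move=> x _; exact: poweR_ge0.
- rewrite (_ : (fun x => _) = EFin \o (fun x => `|Du x ord0 i| `^ p))//.
  apply/measurable_EFinP.
  apply: (@measurableT_comp _ _ _ _ _ _ (@powR R ^~ p)); first exact: measurable_powR.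
  exact: measurableT_comp.
- exact: measurable_energy.
- move=> x _; rewrite /= lee_fin; apply: ge0_ler_powR; rewrite ?nnegrE ?enorm_ge0//.
    exact: ltW.
  exact: coord_le_enorm.
Qed.

(** On a compact set each component is dominated by [1 + |Du|^p]. *)
Lemma energy_L1loc Du : (forall i, measurable_fun setT (fun x => Du x ord0 i)) ->
  (energy p Du < +oo)%E -> forall i, L1loc (fun x => Du x ord0 i).
Proof.
move=> mDu Eoo i; split => // K cK.
have mK := compact_measurable_rV cK.
have iE : mu.-integrable K (fun x => (enorm (Du x) `^ p)%:E).
  apply: (integrableS measurableT mK (@subsetT _ _)).
  apply/integrableP; split; first exact: measurable_energy.
  apply: le_lt_trans Eoo; apply: ge0_le_integral => //.
  - by apply: measurableT_comp => //; exact: measurable_energy.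
  - exact: measurable_energy.
  - by move=> x _; rewrite /= ger0_norm// powR_ge0.
have i1 : mu.-integrable K (EFin \o cst 1).
  by apply: (@bounded_integrable _ _ _ _ _ _ 1) => //; [exact: compact_lty|move=> x _; rewrite normr1].
apply: (le_integrable mK _ _ (integrableD mK i1 iE)).
  by apply/measurable_EFinP; exact: measurable_funTS.
move=> x Kx; rewrite /= lee_fin [leRHS]ger0_norm ?addr_ge0 ?powR_ge0//.
apply: le_trans (coord_le_enorm _ i) _.
have [h|h] := leP (enorm (Du x)) 1; first by rewrite ler_wpDr// powR_ge0.
by apply: ler_wpDl => //; apply: le1r_powR; exact: ltW.
Qed.

Lemma energyZ c Du : (forall i, measurable_fun setT (fun x => Du x ord0 i)) ->
  energy p (fun x => c *: Du x) = ((`|c| `^ p)%:E * energy p Du)%E.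
Proof.
move=> mDu; rewrite /energy -ge0_integralZl//.
- by apply: eq_integral => x _; rewrite enormZ powRM ?enorm_ge0// EFinM.
- exact: measurable_energy.
- by move=> x _; rewrite lee_fin powR_ge0.

Qed.

Lemma L1locD (f g : 'rV[R]_n -> R) c1 c2 : L1loc f -> L1loc g ->
  L1loc (fun x => c1 * f x + c2 * g x).
Proof.
move=> [mf Lf] [mg Lg]; split.
  by apply: measurable_funD; apply: measurable_funM.
move=> K cK; have mK := compact_measurable_rV cK.
exact: (integrableD mK (integrableZl mK c1 (Lf _ cK)) (integrableZl mK c2 (Lg _ cK))).
Qed.

(** The additive constant serves to normalize [u 0 = 0]. It drops out because derivatives of test
    functions have zero integral. *)
Lemma weak_gradientD u1 u2 D1 D2 c1 c2 c : continuous u1 -> continuous u2 ->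
  weak_gradient u1 D1 -> weak_gradient u2 D2 ->
  weak_gradient (fun x => c1 * u1 x + c2 * u2 x + c)
                (fun x => c1 *: D1 x + c2 *: D2 x).
Proof.
move=> cu1 cu2 g1 g2 i; have [L1 w1] := g1 i; have [L2 w2] := g2 i.
have E : (fun x => (c1 *: D1 x + c2 *: D2 x) ord0 i) =
    (fun x => c1 * D1 x ord0 i + c2 * D2 x ord0 i).
  by apply/funext => x; rewrite !mxE.
rewrite E; split; first exact: L1locD.
move=> phi tphi; set e := basis_vec R i.
have [M M0 phi0] := test_function_supp tphi.
have cp := test_function_continuous tphi.
have cdp : continuous ('D_e phi) by exact: test_function_continuous_derive.
have dphi0 := @derive_out _ _ phi e M phi0.
have iu1 := L1loc_integrableM (continuous_L1loc cu1) cdp dphi0.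
have iu2 := L1loc_integrableM (continuous_L1loc cu2) cdp dphi0.
have ic := continuous_integrable_cube cdp dphi0.
have i1 := L1loc_integrableM L1 cp phi0; have i2 := L1loc_integrableM L2 cp phi0.
have dphi_int : \int[mu]_x 'D_e phi x = 0.
  apply: (Rintegral_derive_eq0 (ltW M0) cp) => // x.
  by have [] := test_function_derive i x tphi.
transitivity (c1 * \int[mu]_x (u1 x * 'D_e phi x) +
    c2 * \int[mu]_x (u2 x * 'D_e phi x) + c * \int[mu]_x 'D_e phi x).
  rewrite -!RintegralZl// -RintegralD//; last 2 first.
  - exact: (integrableZl measurableT c1 iu1).
  - exact: (integrableZl measurableT c2 iu2).
  rewrite -RintegralD//; last 2 first.
  - exact: (integrableD measurableT (integrableZl measurableT c1 iu1)
      (integrableZl measurableT c2 iu2)).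
  - exact: (integrableZl measurableT c ic).
  by apply: eq_Rintegral => x _; ring.
rewrite dphi_int w1// w2// mulr0 addr0 !mulrN -opprD -!RintegralZl// -RintegralD//.
- by congr (- _); apply: eq_Rintegral => x _; ring.
- exact: (integrableZl measurableT c1 i1).
- exact: (integrableZl measurableT c2 i2).
Qed.

Lemma grad_leZ u Du l c d : 0 <= l -> grad_le p u Du l ->
  grad_le p (fun x => c * u x + d) (fun x => c *: Du x) (`|c| * l).
Proof.
move=> l0 [cu uDu El].
have mDu i : measurable_fun setT (fun x => Du x ord0 i) by have [[]] := uDu i.
split.
- move=> x; apply: (@continuousD _ _ _ (fun x => c * u x) (cst d)); last exact: cst_continuous.
  by apply: (@continuousM _ _ (cst c) u); [exact: cst_continuous|exact: cu].
- have := weak_gradientD c 0 d cu cu uDu uDu.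
  rewrite (_ : (fun x => _) = (fun x => c * u x + d)); last first.
    by apply/funext => x; rewrite mul0r addr0.
  rewrite (_ : (fun x => c *: Du x + _) = (fun x => c *: Du x))//.
  by apply/funext => x; rewrite scale0r addr0.
- by rewrite energyZ// powRM// EFinM; apply: lee_wpmul2l.
Qed.

Lemma bump_grad_le : exists2 l, 0 < l & grad_le p (@bump_rV R n)
  (fun x => \row_i 'D_(basis_vec R i) (@bump_rV R n) x) l.
Proof.
have tb := bump_test R n.
pose D (x : 'rV[R]_n) : 'rV[R]_n := \row_i 'D_(basis_vec R i) (@bump_rV R n) x.
rewrite -/D.
have Di i : (fun x => D x ord0 i) = 'D_(basis_vec R i) (@bump_rV R n).
  by apply/funext => x; rewrite /D mxE.
have cD i : continuous ('D_(basis_vec R i) (@bump_rV R n)).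
  exact: test_function_continuous_derive.
have D0 i x : ~ cube 1 x -> 'D_(basis_vec R i) (@bump_rV R n) x = 0.
  by apply: derive_out; exact: bump_out.
have mD i : measurable_fun setT (fun x => D x ord0 i).
  by rewrite Di; exact: continuous_measurable_rV.
have wg : weak_gradient (@bump_rV R n) D.
  move=> i; rewrite Di; split; first exact: continuous_L1loc.
  exact: weak_partial_smooth.
have /choice[C hC] : forall i, exists C, forall x, cube 1 x -> `|D x ord0 i| <= C.
  move=> i; have [C _ hC] := continuous_bounded_compact (cD i) (@compact_cube R n 1).
  by exists C => x x1; rewrite /D mxE; exact: hC.
pose B := (\sum_i C i) `^ p.
have Eoo : (energy p D < +oo)%E.
  have : mu.-integrable setT (EFin \o (fun x => enorm (D x) `^ p)).
    apply: (integrable_outside0 (@measurable_cube R n 1)).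
      move=> x x1; rewrite (_ : D x = 0) ?enorm0 ?powR0 ?gt_eqF//.
      by apply/rowP => i; rewrite !mxE D0.
    apply: (@bounded_integrable _ _ _ _ _ _ B).
    - exact: measurable_cube.
    - exact: lebesgue_rV_cube_lty.
    - by apply: measurable_funTS; apply/measurable_EFinP; exact: measurable_energy.
    - move=> x x1; rewrite ger0_norm ?powR_ge0//.
      apply: ge0_ler_powR; rewrite ?nnegrE ?enorm_ge0//; first exact: ltW.
        by apply: sumr_ge0 => i _; apply: le_trans (hC i x x1).
      by apply: le_trans (enorm_le_sum _) _; apply: ler_sum => i _; exact: hC.
  move=> /integrableP[_]; apply: le_lt_trans; apply: ge0_le_integral => //.
  - by move=> x _; rewrite lee_fin powR_ge0.
  - exact: measurable_energy.
  - by apply: measurableT_comp => //; exact: measurable_energy.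
  - by move=> x _; rewrite /= lee_fin ler_norm.
(* Adding 1 gives a positive bound at once, with no need to know that the norm is nonzero. *)
exists (fine (normDu p D) + 1).
  by rewrite ltr_wpDl// fine_ge0// normDuE poweR_ge0.
split => //; first exact: test_function_continuous.
have Nfin : normDu p D \is a fin_num.
  by rewrite ge0_fin_numE normDuE ?poweR_ge0// poweR_lty.
apply/normDu_le; first by rewrite addr_ge0// fine_ge0// normDuE poweR_ge0.
by rewrite EFinD fineK// leeDl.
Qed.

End dirichlet_space.

(** * Completeness and lower semicontinuity of the energy *)

Lemma cvgn_geometric_increments (R : realType) (u : nat -> R) C q :
  0 <= C -> 0 <= q < 1 -> (forall k, `|u k.+1 - u k| <= C * q ^+ k) -> cvgn u.
Proof.
move=> C0 /andP[q0 q1] uC.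
have cs : cvgn [normed series (telescope u)].
  apply: (@series_le_cvg _ _ (geometric C q)) => [k|k|k|].
  - exact: normr_ge0.
  - by rewrite mulr_ge0// exprn_ge0.
  - exact: uC.
  - by apply: is_cvg_geometric_series; rewrite ger0_norm.
rewrite (_ : u = (fun k => u 0%N + series (telescope u) k)); last first.
  by apply/funext => k; rewrite -eq_sum_telescope.
by apply: is_cvgD; [exact: is_cvg_cst|exact: (@normed_cvg R R _ cs)].
Qed.

Lemma cvg_rV (R : realType) n (f : nat -> 'rV[R]_n) (l : 'rV[R]_n) :
  (forall i, (fun k => f k ord0 i) @ \oo --> l ord0 i) -> f @ \oo --> l.
Proof.
move=> fl; apply/cvg_ballP => e e0.
have : \forall k \near \oo, forall i, ball (l ord0 i) e (f k ord0 i).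
  apply: filter_forall => i; move: (fl i) => /cvg_ballP; exact.
by apply: filterS => k h; split => // i j; rewrite ord1; exact: h.
Qed.

Section completeness.
Context (R : realType) (n : nat) (p : R).
Hypothesis p1 : 1 < p.
Local Notation mu := (lebesgue_rV R n).
Implicit Types (D : 'rV[R]_n -> 'rV[R]_n).

Let p0 : 0 < p. Proof. exact: lt_trans p1. Qed.

Let limn_einf_le (u : (\bar R)^nat) c : (forall k, u k <= c)%E -> (limn_einf u <= c)%E.
Proof.
move=> uc; rewrite limn_einf_lim; apply: lime_le; first exact: is_cvg_einfs.
apply: nearW => k; apply: le_trans (uc k); apply: ereal_inf_lbound.
by exists k => //=.
Qed.

(** Fatou's lemma on the set [A] where the fields converge. The integrand depends continuously on
    the field, so its lower limit there is its value at [D]. *)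
Lemma fatou_energy (D_ : nat -> 'rV[R]_n -> 'rV[R]_n) D A c :
  measurable A -> mu (~` A) = 0%E ->
  (forall k i, measurable_fun setT (fun x => D_ k x ord0 i)) ->
  (forall i, measurable_fun setT (fun x => D x ord0 i)) ->
  (forall x, A x -> D_ ^~ x @ \oo --> D x) ->
  (forall k, energy p (D_ k) <= c)%E -> (energy p D <= c)%E.
Proof.
move=> mA A0 mD_ mD DA Ec; rewrite /energy.
have mE := measurable_energy p mD.
rewrite (@ge0_negligible_integral _ _ _ _ setT (~` A)) //; last 2 first.
- exact: measurableC.
- by move=> x _; rewrite lee_fin powR_ge0.
rewrite setTD setCK.
rewrite (@eq_integral _ _ _ _ _ (fun x => limn_einf (fun k => (enorm (D_ k x) `^ p)%:E))); last first.
  move=> x; rewrite inE => Ax; apply/esym.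
  have cv : (fun k => (enorm (D_ k x) `^ p)%:E) @ \oo --> (enorm (D x) `^ p)%:E.
    apply: cvg_EFin; first exact: nearW.
    apply: (@continuous_cvg _ _ _ _ _ (D_ ^~ x) (fun v : 'rV[R]_n => enorm v `^ p) (D x));
      last exact: DA.
    rewrite (_ : (fun v => _) = (fun v : 'rV[R]_n => `|enorm v| `^ p)); last first.
      by apply/funext => y; rewrite ger0_norm ?enorm_ge0.
    apply: (@continuous_comp _ _ _ (@enorm R n) (fun t => `|t| `^ p)).
      exact: continuous_enorm.
    exact: (continuous_norm_powR p0).
  by have [-> _] := cvg_limn_einf_sup cv.
apply: le_trans; first apply: fatou => //.
- by move=> k; apply: measurable_funTS; exact: measurable_energy.
- by move=> k x _; rewrite lee_fin powR_ge0.
apply: limn_einf_le => k; apply: le_trans (Ec k).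
apply: ge0_subset_integral => //.
- exact: measurable_energy.
- by move=> x _; rewrite lee_fin powR_ge0.
Qed.

Let geometric_sum N : \sum_(0 <= k < N) (2^-1 : R) ^+ k <= 2.
Proof.
suff -> : \sum_(0 <= k < N) (2^-1 : R) ^+ k = 2 - 2 * 2^-1 ^+ N.
  by rewrite lerBlDr lerDl mulr_ge0// exprn_ge0// invr_ge0.
elim: N => [|N IH]; first by rewrite big_nil expr0 mulr1 subrr.
by rewrite big_nat_recr//= IH exprS; field.
Qed.

(* A.e. [sum_k 2^k |D_(k+1) - D_k|^p] is finite, so the increments decay geometrically. *)
Lemma riesz_fischer (D_ : nat -> 'rV[R]_n -> 'rV[R]_n) :
  (forall k i, measurable_fun setT (fun x => D_ k x ord0 i)) ->
  (forall k, energy p (fun x => D_ k.+1 x - D_ k x)%R <= (4^-1 ^+ k)%:E)%E ->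
  exists D A, [/\ measurable A, mu (~` A) = 0%E,
    forall i, measurable_fun setT (fun x => D x ord0 i) &
    forall x, A x -> D_ ^~ x @ \oo --> D x].
Proof.
move=> mD_ Ek.
have mDD k i : measurable_fun setT (fun x => (D_ k.+1 x - D_ k x) ord0 i).
  rewrite (_ : (fun x => _) = (fun x => D_ k.+1 x ord0 i - D_ k x ord0 i)).
    exact: measurable_funB.
  by apply/funext => x; rewrite !mxE.
pose a k x : \bar R := ((2 ^+ k)%:E * (enorm (D_ k.+1 x - D_ k x) `^ p)%:E)%E.
have ma k : measurable_fun setT (a k).
  by apply: emeasurable_funM => //; exact: measurable_energy.
have a0 k x : (0 <= a k x)%E.
  by rewrite /a -EFinM lee_fin mulr_ge0 ?exprn_ge0// powR_ge0.
pose g x : \bar R := (\sum_(k <oo) a k x)%E.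
have mg : measurable_fun setT g by apply: ge0_emeasurable_sum.
have g0 x : (0 <= g x)%E by apply: nneseries_ge0.
have ig : (\int[mu]_x g x <= 2%:E)%E.
  rewrite integral_nneseries//.
  (* The weights [2^k] against energies at most [4^-k] leave a geometric series of sum 2. *)
  apply: lime_le; first by apply: is_cvg_nneseries => k _ _; exact: integral_ge0.
  apply: nearW => N; apply: (@le_trans _ _ (\sum_(0 <= k < N) ((2^-1 : R) ^+ k)%:E)%E).
    apply: lee_sum => k _; rewrite /a ge0_integralZl//; last 2 first.
    - exact: (measurable_energy p (mDD k)).
    - by move=> x _; rewrite lee_fin powR_ge0.
    apply: (@le_trans _ _ ((2 ^+ k)%:E * (4^-1 ^+ k)%:E)%E).
      by apply: lee_wpmul2l => //; exact: Ek.
    have h24 : 2 * 4^-1 = 2^-1 :> R by field.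
    by rewrite -EFinM lee_fin -exprMn h24.
  by rewrite sumEFin lee_fin geometric_sum.
pose A : set 'rV[R]_n := [set x | (g x < +oo)%E].
have mA : measurable A.
  by rewrite -[A]setTI; exact: measurable_lte.
have iig : mu.-integrable setT g.
  apply/integrableP; split => //; apply: le_lt_trans (le_lt_trans ig (ltry _)).
  by apply: ge0_le_integral => //; [exact: measurableT_comp|move=> x _; rewrite gee0_abs].
have A0 : mu (~` A) = 0%E.
  have [N [mN N0 AN]] := integrable_ae measurableT iig.
  apply/eqP; rewrite -measure_le0 -[leRHS]N0; apply: le_measure; rewrite ?inE//.
    exact: measurableC.
  move=> x Ax; apply: AN => /= /(_ I); apply: contra_not Ax => gx.
  by rewrite /A/= ltey_eq gx.
have cvA x i : A x -> cvgn (fun k => D_ k x ord0 i).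
  move=> Ax; have gfin : g x \is a fin_num by rewrite ge0_fin_numE.
  set G := fine (g x); have G0 : 0 <= G by exact: fine_ge0.
  have ak k : enorm (D_ k.+1 x - D_ k x) `^ p <= G * 2^-1 ^+ k.
    have : (a k x <= G%:E)%E.
      rewrite fineK//; apply: le_trans (@nneseries_lim_ge _ (a ^~ x) xpredT 0%N k.+1 _) => //.
      by rewrite big_nat_recr//= leeDr// sume_ge0.
    rewrite /a -EFinM lee_fin exprVn => h.
    by rewrite ler_pdivlMr ?exprn_gt0// mulrC.
  (* The [p]-th roots of the factors in [G 2^-k], which bounds the [p]-th power of the increment. *)
  pose q : R := 2^-1 `^ p^-1; pose C := G `^ p^-1.
  have q1 : q < 1.
    apply: (@lt_le_trans _ _ (1 `^ p^-1)); last by rewrite powR1.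
    by apply: gt0_ltr_powR; rewrite ?nnegrE ?invr_ge0 ?invr_gt0// invf_lt1// ltr1n.
  have bk k : `|D_ k.+1 x ord0 i - D_ k x ord0 i| <= C * q ^+ k.
    apply: (@le_trans _ _ (enorm (D_ k.+1 x - D_ k x))).
      by have := coord_le_enorm (D_ k.+1 x - D_ k x) i; rewrite !mxE.
    have e0 := enorm_ge0 (D_ k.+1 x - D_ k x).
    rewrite -[leLHS](powRr1 e0) -[X in _ `^ X](divff (lt0r_neq0 p0)) powRrM.
    apply: (@le_trans _ _ ((G * 2^-1 ^+ k) `^ p^-1)).
      apply: ge0_ler_powR; rewrite ?nnegrE ?powR_ge0 ?invr_ge0//; first exact: ltW.
      by rewrite mulr_ge0// exprn_ge0// invr_ge0.
    rewrite powRM ?exprn_ge0 ?invr_ge0//; apply: ler_wpM2l; first exact: powR_ge0.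
    have h2 : (0 : R) <= 2^-1 by rewrite invr_ge0.
    rewrite -(powR_mulrn k h2) -(powR_mulrn k (powR_ge0 _ _)).
    by rewrite -!powRrM mulrC.
  apply: (@cvgn_geometric_increments _ _ C q) bk; first exact: powR_ge0.
  by rewrite powR_ge0.
(* The indicator of [A] makes [D] an everywhere limit of measurable fields, hence measurable. *)
pose D x : 'rV[R]_n := \row_i (\1_A x * limn (fun k => D_ k x ord0 i)).
have DE x i : A x -> D x ord0 i = limn (fun k => D_ k x ord0 i).
  by move=> Ax; rewrite /D mxE indicE mem_set// mul1r.
exists D, A; split => //; last first.
  by move=> x Ax; apply: cvg_rV => i; rewrite DE//; exact: cvA.
move=> i; apply: (@measurable_fun_cvg _ _ _ _ (fun k x => \1_A x * D_ k x ord0 i)).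
  move=> k; apply: measurable_funM => //; exact: measurable_indic.
move=> x _; have [Ax|Ax] := pselect (A x); last first.
  rewrite /D mxE indicE memNset// mul0r.
  by under eq_fun do rewrite mul0r; exact: cvg_cst.
rewrite DE// indicE mem_set//; under eq_fun do rewrite mul1r.
exact: cvA.
Qed.

End completeness.

(** * The sharp constant *)

Section sharp_constant.
Context (R : realType) (n : nat) (p : R).
Hypothesis n1 : (1 <= n)%N.
Hypothesis np : n%:R < p.
Local Notation mu := (lebesgue_rV R n).
Local Notation alpha := (1 - n%:R / p).
Local Notation Cs := (sharp_morrey_constant n p).
Implicit Types (u : 'rV[R]_n -> R) (Du : 'rV[R]_n -> 'rV[R]_n).

Let p1 : 1 < p. Proof. by apply: le_lt_trans np; rewrite ler1n. Qed.

Let p0 : 0 < p. Proof. exact: lt_trans p1. Qed.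

Lemma morrey_exponent_gt0 : 0 < alpha.
Proof. by rewrite subr_gt0 ltr_pdivrMr// mul1r. Qed.

Let alpha_gt0 := morrey_exponent_gt0.

Let enorm_sub_gt0 (x y : 'rV[R]_n) : x != y -> 0 < enorm (x - y).
Proof.
move=> xy; rewrite lt_def enorm_ge0 andbT; apply: contraNneq xy => /enorm_eq0/eqP.
by rewrite subr_eq0.
Qed.

Lemma morrey_seminorm_le u c :
  (forall x y, `|u x - u y| <= c * enorm (x - y) `^ alpha) ->
  (morrey_seminorm p u <= c%:E)%E.
Proof.
move=> uc; apply: ge_ereal_sup => _ [[x y] /= xy <-]; rewrite lee_fin.
by rewrite ler_pdivrMr ?powR_gt0 ?enorm_sub_gt0.
Qed.

Lemma le_morrey_seminorm u c : (morrey_seminorm p u <= c%:E)%E ->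
  forall x y, `|u x - u y| <= c * enorm (x - y) `^ alpha.
Proof.
move=> uc x y; have [->|xy] := eqVneq x y.
  by rewrite !subrr normr0 enorm0 powR0 ?gt_eqF// mulr0.
rewrite -ler_pdivrMr ?powR_gt0 ?enorm_sub_gt0// -lee_fin.
by apply: le_trans uc; apply: ereal_sup_ubound; exists (x, y).
Qed.

(** [morrey] is stated for positive [l], whereas [normDu] may vanish, so its bound is approached
    from above. *)
Let le_mul_limit (a b L : R) : 0 <= b -> (forall l, L < l -> a <= b * l) -> a <= b * L.
Proof.
move=> b0 h; apply/ler_addgt0Pr => e e0.
have b10 : 0 < b + 1 by rewrite ltr_wpDl.
have := h (L + e / (b + 1)); rewrite ltrDl divr_gt0// => /(_ isT)/le_trans; apply.
rewrite mulrDr lerD2l mulrCA; apply: ler_piMr; first exact: ltW.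
by rewrite ler_pdivrMr// mul1r lerDl.
Qed.

Let normDu_ge0 Du : (0 <= normDu p Du)%E.
Proof. by rewrite normDuE poweR_ge0. Qed.

Lemma morrey_inequality_exists : exists2 K, 0 < K & morrey_inequality n p K.
Proof.
have [K K0 hK] := morrey p1 np; exists K => // u Du [cu _ _] wg.
have := normDu_ge0 Du; case E : (normDu p Du) => [L| |]// L0; last first.
  by rewrite gt0_muley ?lte_fin// leey.
rewrite lee_fin in L0; rewrite -EFinM; apply: morrey_seminorm_le => x y.
rewrite mulrAC; apply: le_mul_limit => [|l Ll]; first by rewrite mulr_ge0 ?powR_ge0// ltW.
have l0 : 0 < l by exact: le_lt_trans Ll.
apply: (hK u Du l l0).
split => //; apply/normDu_le => //; first exact: ltW.
by rewrite E lee_fin ltW.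
Qed.

Let grad_le_normDu u Du l : 0 <= l -> grad_le p u Du l -> (normDu p Du <= l%:E)%E.
Proof. by move=> l0 [_ _ El]; apply/normDu_le. Qed.

Let grad_le_weak_gradient u Du l : grad_le p u Du l -> weak_gradient u Du.
Proof. by case. Qed.

(** The bump is positive at 0 and vanishes at [(2, .., 2)], outside its support. The resulting
    quotient bounds every valid constant from below. This also makes the real infimum in
    [sharp_morrey_constant] meaningful. *)
Lemma morrey_constant_lower_bound :
  exists2 c, 0 < c & forall C, morrey_inequality n p C -> c <= C.
Proof.
have [l l0 gb] := bump_grad_le n p1.
pose y : 'rV[R]_n := const_mx 2.
have by0 : @bump_rV R n y = 0.
  apply: bump_out => /(_ (Ordinal n1)); rewrite mxE ger0_norm//.
  by rewrite leNgt ltr1n.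
have y0 : 0 != y.
  apply/eqP => /rowP/(_ (Ordinal n1)); rewrite !mxE => /eqP.
  by rewrite eq_sym pnatr_eq0.
pose q := `|@bump_rV R n 0 - bump_rV y| / enorm (0 - y) `^ alpha.
have q0 : 0 < q.
  by rewrite /q by0 subr0 divr_gt0 ?powR_gt0 ?enorm_sub_gt0// normr_gt0 gt_eqF// bump0_gt0.
exists (q / l) => [|C hC]; first by rewrite divr_gt0.
have qC : (q%:E <= C%:E * normDu p (fun x => \row_i 'D_(basis_vec R i) (@bump_rV R n) x))%E.
  apply: le_trans (hC _ _ (grad_le_D1p p1 gb) (grad_le_weak_gradient gb)).
  by apply: ereal_sup_ubound; exists (0, y).
have Nl := grad_le_normDu (ltW l0) gb; have N0 := normDu_ge0 (fun x => \row_i 'D_(basis_vec R i) (@bump_rV R n) x).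
have C0 : 0 < C.
  rewrite ltNge; apply/negP => C0; move: (qC); apply/negP; rewrite -ltNge.
  by apply: (@le_lt_trans _ _ 0%E); rewrite ?lte_fin// mule_le0_ge0 ?lee_fin.
rewrite ler_pdivrMr// -lee_fin; apply: le_trans qC _.
by rewrite EFinM; apply: lee_wpmul2l => //; rewrite lee_fin ltW.
Qed.

Lemma sharp_morrey_constant_gt0 : 0 < Cs.
Proof.
have [c c0 hc] := morrey_constant_lower_bound.
have [K _ hK] := morrey_inequality_exists.
by apply: lt_le_trans c0 _; apply: lb_le_inf; [exists K|exact: hc].
Qed.

(** The infimum is itself a valid constant: for fixed [x] and [y] the quotient [|u x - u y| / b] is
    a lower bound of all valid constants. *)
Lemma sharp_morrey u Du l : 0 <= l -> grad_le p u Du l ->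
  forall x y, `|u x - u y| <= Cs * enorm (x - y) `^ alpha * l.
Proof.
move=> l0 gu x y; rewrite -mulrA; set b := _ `^ _ * l.
have b0 : 0 <= b by rewrite mulr_ge0// powR_ge0.
have [c c0 hc] := morrey_constant_lower_bound.
have [K _ hK] := morrey_inequality_exists.
have h C : morrey_inequality n p C -> `|u x - u y| <= C * b.
  move=> hC; rewrite /b [_ * l]mulrC mulrA; apply: le_morrey_seminorm.
  apply: le_trans (hC _ _ (grad_le_D1p p1 gu) (grad_le_weak_gradient gu)) _.
  rewrite EFinM; apply: lee_wpmul2l; last exact: grad_le_normDu l0 gu.
  by rewrite lee_fin; apply: le_trans (ltW c0) (hc _ hC).
have [bE|bN0] := eqVneq b 0; first by have := h K hK; rewrite bE !mulr0.
have bp : 0 < b by rewrite lt_def bN0.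
rewrite -ler_pdivrMr//; apply: lb_le_inf; first by exists K.
by move=> C hC; rewrite ler_pdivrMr//; exact: h.
Qed.

Local Notation m := (Cs^-1).

Let m0 : 0 < m. Proof. by rewrite invr_gt0 sharp_morrey_constant_gt0. Qed.

(** [C = 1/(m + e)] is below the sharp constant, so some [u], [x], [y] violate the inequality with
    it. Moving [y] to 0, scaling by [|x - y|] and normalizing the two values gives the required
    function. *)
Lemma near_optimal e : 0 < e -> exists u Du omega, [/\ enorm omega = 1,
  grad_le p u Du (m + e), u 0 = 0 & u omega = 1].
Proof.
move=> e0; pose C := (m + e)^-1.
have me0 : 0 < m + e by rewrite addr_gt0.
have C0 : 0 < C by rewrite invr_gt0.
have CCs : C < Cs.
  by rewrite -[ltRHS]invrK ltf_pV2 ?posrE// ltrDl.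
have : ~ morrey_inequality n p C.
  move=> hC; move: CCs; apply/negP; rewrite -leNgt; apply: ge_inf => //.
  have [c _ hc] := morrey_constant_lower_bound; exists c => D; exact: hc.
move=> /existsNP[u /existsNP[Du /not_implyP[uD /not_implyP[wg /negP]]]].
rewrite -ltNge => /ereal_sup_gt[_ [[x y] /= xy <-]].
(* An infinite norm is excluded: it would make the bound that was exceeded infinite. *)
have := normDu_ge0 Du; case E : (normDu p Du) => [L| |]// L0; last first.
  by rewrite gt0_muley ?lte_fin.
rewrite lee_fin in L0; rewrite -EFinM lte_fin => CL.
set r := enorm (x - y) in CL; have r0 : 0 < r by exact: enorm_sub_gt0.
have ra : 0 < r `^ alpha by exact: powR_gt0.
pose s := u x - u y.
have s0 : 0 < `|s|.
  have : 0 <= C * L by rewrite mulr_ge0// ltW.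
  by move=> /le_lt_trans/(_ CL); rewrite pmulr_lgt0// invr_gt0.
have gu : grad_le p u Du L.
  by have [cu _ _] := uD; split => //; apply/normDu_le => //; rewrite E.
have gv := grad_le_affine p0 y r0 L0 gu.
have rL0 : 0 <= r `^ alpha * L by rewrite mulr_ge0// ltW.
have gw := grad_leZ s^-1 (- (s^-1 * u y)) rL0 gv.
exists (fun z => s^-1 * (u \o affine_rV y r) z - s^-1 * u y).
exists (fun z => s^-1 *: (r *: Du (affine_rV y r z))).
exists (r^-1 *: (x - y)); split.
- by rewrite enormZ gtr0_norm ?invr_gt0// mulVf// gt_eqF.
- apply: (grad_le_trans p1 _ _ gw); first by rewrite mulr_ge0.
  rewrite normfV ler_pdivrMl// -[m + e]invrK -/C ler_pdivlMr//.
  by move: CL; rewrite ltr_pdivlMr// => /ltW; rewrite mulrC mulrA mulrAC.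
- by rewrite /= /affine_rV scaler0 addr0 subrr.
- rewrite /= /affine_rV scalerA divff ?gt_eqF// scale1r [y + _]addrC subrK -mulrBr.
  by rewrite mulVf// -normr_gt0.
Qed.

(** [omega] is a cluster point of near-optimal directions [w k]. By the sharp inequality a function
    equal to 1 at a nearby [w k] is almost 1 at [omega], so dividing by its value there costs
    little. *)
Lemma near_optimal_direction : exists2 omega : 'rV[R]_n, enorm omega = 1 &
  forall e, 0 < e -> exists u Du, [/\ grad_le p u Du (m + e), u 0 = 0 & u omega = 1].
Proof.
have /choice[w hw] : forall k, exists w : 'rV[R]_n, exists u Du, [/\ enorm w = 1,
    grad_le p u Du (m + k.+1%:R^-1), u 0 = 0 & u w = 1].
  move=> k; have k0 : (0 : R) < k.+1%:R^-1 by rewrite invr_gt0.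
  by have [u [Du [w h]]] := near_optimal k0; exists w, u, Du.
pose S : set 'rV[R]_n := cube 1 `&` [set x | enorm x = 1].
have cS : compact S.
  apply: compact_closedI; first exact: compact_cube.
  apply: (@closed_comp _ _ (@enorm R n) [set 1]); last exact: closed_eq.
  by move=> x _; exact: continuous_enorm.
have wS k : S (w k).
  have [u [Du [w1 _ _ _]]] := hw k; split => // i.
  by rewrite -w1; exact: coord_le_enorm.
have wS' : (w @ \oo) S by exists 0%N => // k _; exact: wS.
have [omega [[_ o1] clo]] := cS (w @ \oo) _ wS'.
exists omega => // e e0.
(* The solution of [(1 - d)(m + e) = m + d]: dividing by a value at least [1 - d] turns the bound
   [m + d] into [m + e]. *)
pose d := e / (1 + m + e).
have me0 : 0 < 1 + m + e by rewrite !addr_gt0.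
have d0 : 0 < d by rewrite divr_gt0.
have d1 : d < 1 by rewrite ltr_pdivrMr// mul1r ltrDr addr_gt0.
have m1 : 0 < m + 1 by rewrite addr_gt0.
have Cs0 := sharp_morrey_constant_gt0.
(* Within distance [t], a function with gradient bound at most [m + 1] varies by at most [d]. *)
pose t := (d / (Cs * (m + 1))) `^ alpha^-1.
have t0 : 0 < t by rewrite powR_gt0// divr_gt0// mulr_gt0.
have ch : continuous (fun x : 'rV[R]_n => enorm (omega - x)).
  move=> x; apply: (@continuous_comp _ _ _ (fun x : 'rV[R]_n => omega - x) (@enorm R n)).
    by apply: continuousB; [exact: cst_continuous|exact: cvg_id].
  exact: continuous_enorm.
have nb : nbhs omega [set x | enorm (omega - x) < t].
  have /cvgrPdist_lt/(_ _ t0) := ch omega.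
  apply: filterS => x /=; rewrite subrr enorm0 sub0r normrN ger0_norm//.
  exact: enorm_ge0.
have [N _ hN] := near_infty_natSinv_lt (PosNum d0).
have Aw : (w @ \oo) (w @` [set k | (N <= k)%N]).
  by exists N => // k /= Nk; exists k.
have [_ [[k Nk <-] wt]] := clo _ _ Aw nb.
have [u [Du [w1 gu u0 uw]]] := hw k.
set j : R := k.+1%:R^-1 in gu; have j0 : 0 < j by rewrite invr_gt0.
have jd : j < d by exact: hN.
have mj0 : 0 <= m + j by rewrite ltW// addr_gt0.
have uo : `|u omega - u (w k)| <= d.
  apply: le_trans (sharp_morrey mj0 gu _ _) _.
  have ta : t `^ alpha = d / (Cs * (m + 1)).
    by rewrite /t -powRrM mulVf ?gt_eqF// powRr1// divr_ge0 ?ltW// mulr_gt0.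
  apply: (@le_trans _ _ (Cs * (d / (Cs * (m + 1))) * (m + 1))); last first.
    by rewrite mulrAC mulrC divfK// gt_eqF// mulr_gt0.
  apply: ler_pM => //.
  - by rewrite mulr_ge0 ?powR_ge0// ltW.
  - apply: ler_wpM2l; first exact: ltW.
    rewrite -ta; apply: ge0_ler_powR; rewrite ?nnegrE ?enorm_ge0//; exact: ltW.
  - by rewrite lerD2l ltW// (lt_trans jd).
have uo1 : 1 - d <= u omega.
  by move: uo; rewrite uw ler_norml => /andP[h _]; lra.
have uo0 : 0 < u omega by apply: lt_le_trans uo1; rewrite subr_gt0.
exists (fun x => (u omega)^-1 * u x + 0), (fun x => (u omega)^-1 *: Du x); split.
- apply: (grad_le_trans p1 _ _ (grad_leZ (u omega)^-1 0 mj0 gu)); first by rewrite mulr_ge0.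
  rewrite gtr0_norm ?invr_gt0// ler_pdivrMl//.
  apply: (@le_trans _ _ ((1 - d) * (m + e))).
    have -> : (1 - d) * (m + e) = m + d.
      rewrite /d; move: (m) me0 => a ae0; field.
      by rewrite gt_eqF.
    by rewrite lerD2l ltW.
  by apply: ler_wpM2r => //; rewrite ltW// addr_gt0.
- by rewrite u0 mulr0 addr0.
- by rewrite addr0 mulVf// gt_eqF.
Qed.

End sharp_constant.

(** * Existence of an extremal *)

Lemma cvgn_le_dist (R : realType) (v : nat -> R) l c b j : v @ \oo --> l ->
  (forall k, (j <= k)%N -> `|v k - c| <= b) -> `|l - c| <= b.
Proof.
move=> vl vb; apply/ler_addgt0Pr => e e0.
have /cvgrPdist_le/(_ _ e0)[N _ hN] := vl.
set k := maxn j N; have := hN k (leq_maxr _ _); have := vb k (leq_maxl _ _).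
have -> : l - c = (l - v k) + (v k - c) by rewrite addrA subrK.
by move=> h1 h2; apply: le_trans (ler_normD _ _) _; rewrite addrC lerD.
Qed.

Lemma Rintegral_cube_bound (R : realType) n (f : 'rV[R]_n -> R) M b : 0 <= M ->
  (lebesgue_rV R n).-integrable setT (EFin \o f) ->
  (forall x, ~ cube M x -> f x = 0) -> (forall x, cube M x -> `|f x| <= b) ->
  `|\int[lebesgue_rV R n]_x f x| <= b * (M *+ 2) ^+ n.
Proof.
move=> M0 fi f0 fb; have ii := integrable_indic_cube n M.
have mC := @measurable_cube R n M.
apply: (le_trans (le_normr_Rintegral measurableT fi)).
have -> : b * (M *+ 2) ^+ n = \int[lebesgue_rV R n]_x (b * \1_(cube M) x).
  rewrite RintegralZl// /Rintegral integral_indic// setIT.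
  by rewrite [X in _ = _ * fine X](lebesgue_rV_cube n M0).
apply: le_Rintegral => //; first exact: integrable_norm fi.
  exact: (integrableZl measurableT b ii).
move=> x _; have [Mx|Mx] := pselect (cube M x).
  by rewrite indicE mem_set// mulr1; exact: fb.
by rewrite f0// normr0 indicE memNset// mulr0.
Qed.

(** For each index [j] the identity holds exactly. Replacing [u_ j] and [D_ j] by [u] and [D]
    changes the two integrals by at most a multiple of [q j]. The weight [h] may grow at infinity,
    since it is evaluated on the support of [phi]. *)
Lemma weak_gradient_limit (R : realType) n (p : R) (u_ : nat -> 'rV[R]_n -> R)
    (D_ : nat -> 'rV[R]_n -> 'rV[R]_n) (u : 'rV[R]_n -> R)
    (D : 'rV[R]_n -> 'rV[R]_n) (h : 'rV[R]_n -> R) (q : nat -> R) :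
  1 < p -> continuous u -> (forall i, L1loc (fun x => D x ord0 i)) ->
  continuous h -> (forall j, continuous (u_ j)) ->
  (forall j, weak_gradient (u_ j) (D_ j)) ->
  (forall j, 0 < q j) -> q @ \oo --> 0 ->
  (forall j x, `|u x - u_ j x| <= h x * q j) ->
  (forall j, energy p (fun x => D x - D_ j x)%R <= (q j `^ p)%:E)%E ->
  weak_gradient u D.
Proof.
move=> p1 cu LD ch cu_ wg q0 qc uu ED i; split; first exact: LD.
move=> phi tphi; have [M M0 phi0] := test_function_supp tphi.
have cp := test_function_continuous tphi.
have cdp := @test_function_continuous_derive _ _ phi i tphi.
set dphi := 'D_(basis_vec R i) phi in cdp *.
have dphi0 : forall x, ~ cube M x -> dphi x = 0 by rewrite /dphi; apply: derive_out => y; exact: phi0.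
have cC := @compact_cube R n M.
have [B1 B10 hB1] := continuous_bounded_compact ch cC.
have [B2 B20 hB2] := continuous_bounded_compact cdp cC.
have [B3 B30 hB3'] := continuous_bounded_compact cp cC.
have hB3 x : `|phi x| <= B3.
  have [/hB3'//|/phi0 ->] := pselect (cube M x); by rewrite normr0.
set mu := lebesgue_rV R n.
set a := \int[mu]_x _; set b := \int[mu]_x _.
pose K := B1 * B2 * (M *+ 2) ^+ n + B3 * ((M *+ 2) ^+ n + 1).
have est j : `|a + b| <= K * q j.
  have [Lj wj] := wg j i; have := wj phi tphi; rewrite -/dphi -/mu.
  set aj := \int[mu]_x _; set bj := \int[mu]_x _ => ab.
  have ia : mu.-integrable setT (EFin \o (fun x => u x * dphi x)).
    exact: (L1loc_integrableM (continuous_L1loc cu) cdp dphi0).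
  have iaj : mu.-integrable setT (EFin \o (fun x => u_ j x * dphi x)).
    exact: (L1loc_integrableM (continuous_L1loc (cu_ j)) cdp dphi0).
  have ib := L1loc_integrableM (LD i) cp phi0.
  have ibj := L1loc_integrableM Lj cp phi0.
  have Ea : a - aj = \int[mu]_x (u x * dphi x - u_ j x * dphi x).
    by rewrite RintegralB.
  have Eb : b - bj = \int[mu]_x (D x ord0 i * phi x - D_ j x ord0 i * phi x).
    by rewrite RintegralB.
  have -> : a + b = (a - aj) + (b - bj) by rewrite ab; lra.
  apply: le_trans (ler_normD _ _) _; rewrite /K mulrDl; apply: lerD.
    rewrite Ea mulrAC; apply: Rintegral_cube_bound.
    - exact: ltW.
    - exact: (integrableB measurableT ia iaj).
    - by move=> x /dphi0 ->; rewrite !mulr0 subrr.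
    - move=> x Mx; rewrite -mulrBl normrM mulrAC; apply: ler_pM => //; last exact: hB2.
      apply: le_trans (uu j x) _; apply: ler_wpM2r; first exact: ltW.
      exact: le_trans (ler_norm _) (hB1 _ Mx).
  have mDD i0 : measurable_fun setT (fun x => (D x - D_ j x) ord0 i0).
    rewrite (_ : (fun x => _) = (fun x => D x ord0 i0 - D_ j x ord0 i0)).
      apply: measurable_funB; first by have [] := LD i0.
      by have [[]] := wg j i0.
    by apply/funext => x; rewrite !mxE.
  have LDD : forall i0, L1loc (fun x => (D x - D_ j x) ord0 i0).
    by apply: (energy_L1loc p1 mDD); apply: le_lt_trans (ED j) _; rewrite ltry.
  have := energy_Rintegral_bound i p1 (q0 j) (ltW M0) LDD (ED j) cp phi0 hB3.
  rewrite Eb; congr (`| _ | <= _); apply: eq_Rintegral => x _.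
  by rewrite !mxE mulrBl.
have qK : (fun j => K * q j) @ \oo --> 0.
  by rewrite -[0](mulr0 K); apply: cvgMr.
have : `|a + b| <= 0.
  rewrite -(cvg_lim _ qK)//; apply: limr_ge; first by apply/cvg_ex; exists 0.
  by apply: nearW => j; exact: est.
by rewrite normr_le0 addr_eq0 => /eqP.
Qed.

(** The subtracted midpoint term of [uniform_convexity] stands on the left, so that all integrals
    are of nonnegative extended functions and nothing is subtracted. *)
Lemma ge0_le_integral_combination d (T : measurableType d) (R : realType)
    (mu : {measure set T -> \bar R}) (f g h1 h2 : T -> \bar R) (c k : R) :
  measurable_fun setT f -> measurable_fun setT g ->
  measurable_fun setT h1 -> measurable_fun setT h2 ->
  (forall x, 0 <= f x)%E -> (forall x, 0 <= g x)%E ->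
  (forall x, 0 <= h1 x)%E -> (forall x, 0 <= h2 x)%E -> 0 <= c -> 0 <= k ->
  (forall x, f x + c%:E * g x <= k%:E * (h1 x + h2 x))%E ->
  (\int[mu]_x f x + c%:E * \int[mu]_x g x <=
   k%:E * (\int[mu]_x h1 x + \int[mu]_x h2 x))%E.
Proof.
move=> mf mg mh1 mh2 f0 g0 h10 h20 c0 k0 le.
have mcg : measurable_fun setT (fun x => c%:E * g x)%E.
  by apply: emeasurable_funM => //; exact: measurable_cst.
have cg0 x : (0 <= c%:E * g x)%E by rewrite mule_ge0.
have mh : measurable_fun setT (fun x => h1 x + h2 x)%E by exact: emeasurable_funD.
have h0 x : (0 <= h1 x + h2 x)%E by rewrite adde_ge0.
rewrite -ge0_integralZl// -ge0_integralD// -ge0_integralD// -ge0_integralZl//.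
apply: ge0_le_integral => //.
- by move=> x _; rewrite adde_ge0.
- exact: emeasurable_funD.
- by apply: emeasurable_funM => //; exact: measurable_cst.
Qed.

(** * The minimizing sequence and its limit *)

Section existence.
Context (R : realType) (n : nat) (p : R).
Hypothesis n1 : (1 <= n)%N.
Hypothesis np : n%:R < p.
Local Notation mu := (lebesgue_rV R n).
Local Notation alpha := (1 - n%:R / p).
Local Notation Cs := (sharp_morrey_constant n p).
Local Notation m := (Cs^-1).
Implicit Types (u : 'rV[R]_n -> R) (D : 'rV[R]_n -> 'rV[R]_n).

Let p1 : 1 < p. Proof. by apply: le_lt_trans np; rewrite ler1n. Qed.

Let p0 : 0 < p. Proof. exact: lt_trans p1. Qed.

Let alpha_gt0 : 0 < alpha. Proof. exact: morrey_exponent_gt0. Qed.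

Let Cs0 : 0 < Cs. Proof. exact: sharp_morrey_constant_gt0. Qed.

Let m0 : 0 < m. Proof. by rewrite invr_gt0. Qed.

Let grad_le_measurable u D l : grad_le p u D l ->
  forall i, measurable_fun setT (fun x => D x ord0 i).
Proof. by move=> [_ uD _] i; have [[]] := uD i. Qed.

Lemma continuous_hoelder u B : (forall x y, `|u x - u y| <= B * enorm (x - y) `^ alpha) ->
  continuous u.
Proof.
move=> uB x; apply/(@cvgrPdist_le _ _ _ (nbhs x)) => e e0.
pose g (y : 'rV[R]_n) : R := B * `|enorm (x - y)| `^ alpha.
have ch : continuous g.
  move=> y; apply: (@continuousM _ _ (cst B) (fun y : 'rV[R]_n => `|enorm (x - y)| `^ alpha)).
    exact: cst_continuous.
  apply: (@continuous_comp _ _ _ (fun y : 'rV[R]_n => enorm (x - y)) (fun t => `|t| `^ alpha)).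
    apply: (@continuous_comp _ _ _ (fun y : 'rV[R]_n => x - y) (@enorm R n)).
      by apply: continuousB; [exact: cst_continuous|exact: cvg_id].
    exact: continuous_enorm.
  exact: (continuous_norm_powR alpha_gt0).
have /cvgrPdist_le/(_ _ e0) := ch x.
have hx : g x = 0.
  by rewrite /g subrr enorm0 normr0 powR0 ?mulr0// gt_eqF.
apply: filterS => y h; rewrite hx sub0r normrN in h.
apply: le_trans (uB x y) _; apply: le_trans h.
by rewrite /g (ger0_norm (enorm_ge0 _)) ler_norm.
Qed.

Section fixed_direction.
Variable omega : 'rV[R]_n.
Hypothesis omega1 : enorm omega = 1.
Hypothesis near : forall e, 0 < e ->
  exists u D, [/\ grad_le p u D (m + e), u 0 = 0 & u omega = 1].

Definition admissible u D l := [/\ grad_le p u D l, u 0 = 0 & u omega = 1].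

(** Between [omega] and 0, which are at distance 1, the sharp inequality reads [1 <= C_* l]. *)
Lemma admissible_ge u D l : 0 <= l -> admissible u D l -> m <= l.
Proof.
move=> l0 [gu u0 uo]; have := sharp_morrey n1 np l0 gu omega 0.
by rewrite u0 uo !subr0 omega1 powR1 mulr1 normr1 -ler_pdivrMl// mulr1.
Qed.

(** [l] is merely an upper bound, so [admissible_ge] is applied to the norm itself, the [p]-th root
    of the energy. *)
Lemma admissible_energy_ge u D l : admissible u D l -> ((m `^ p)%:E <= energy p D)%E.
Proof.
move=> [[cu uD El] u0 uo].
have := energy_ge0 p D; case E : (energy p D) => [r| |]// r0; last by rewrite leey.
rewrite lee_fin in r0 *.
have rr : (r `^ p^-1) `^ p = r by rewrite -powRrM mulVf ?gt_eqF// powRr1.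
rewrite -rr; apply: ge0_ler_powR; rewrite ?nnegrE ?powR_ge0//; [exact: ltW|exact: ltW|].
apply: (@admissible_ge u D); first exact: powR_ge0.
by split => //; split => //; rewrite E rr.
Qed.

Lemma admissible_midpoint u1 D1 u2 D2 l : 0 <= l ->
  admissible u1 D1 l -> admissible u2 D2 l ->
  admissible (fun x => 2^-1 * u1 x + 2^-1 * u2 x + 0)
    (fun x => 2^-1 *: D1 x + 2^-1 *: D2 x) l.
Proof.
move=> l0 [g1 u10 u1o] [g2 u20 u2o].
have [cu1 wg1 E1] := g1; have [cu2 wg2 E2] := g2.
have mD1 := grad_le_measurable g1; have mD2 := grad_le_measurable g2.
split; last 2 first.
- by rewrite u10 u20 !mulr0 !addr0.
- by rewrite u1o u2o !mulr1 addr0; field.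
split.
- move=> x; apply: (@continuousD _ _ _ (fun x => 2^-1 * u1 x + 2^-1 * u2 x) (cst 0));
    last exact: cst_continuous.
  apply: (@continuousD _ _ _ (fun x => 2^-1 * u1 x) (fun x => 2^-1 * u2 x)).
    by apply: (@continuousM _ _ (cst 2^-1) u1); [exact: cst_continuous|exact: cu1].
  by apply: (@continuousM _ _ (cst 2^-1) u2); [exact: cst_continuous|exact: cu2].
- exact: weak_gradientD.
- have ineq : (energy p (fun x => 2^-1 *: D1 x + 2^-1 *: D2 x)%R <=
      2^-1%:E * (energy p D1 + energy p D2))%E.
    rewrite /energy -ge0_integralD//; last 4 first.
    - by move=> x _; rewrite lee_fin powR_ge0.
    - exact: measurable_energy.
    - by move=> x _; rewrite lee_fin powR_ge0.
    - exact: measurable_energy.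
    rewrite -ge0_integralZl//; last 2 first.
    - by apply: emeasurable_funD; exact: measurable_energy.
    - by move=> x _; rewrite -EFinD lee_fin addr_ge0// powR_ge0.
    apply: ge0_le_integral => //.
    - by move=> x _; rewrite lee_fin powR_ge0.
    - apply: measurable_energy => i.
      rewrite (_ : (fun x => _) = (fun x => 2^-1 * D1 x ord0 i + 2^-1 * D2 x ord0 i)).
        by apply: measurable_funD; apply: measurable_funM.
      by apply/funext => x; rewrite !mxE.
    - apply: emeasurable_funM => //.
      by apply: emeasurable_funD; exact: measurable_energy.
    - move=> x _; rewrite -EFinD -EFinM lee_fin -scalerDr mulrC -subr_ge0.
      exact: (midpoint_gap_ge0 p1).
  apply: le_trans ineq _; apply: (@le_trans _ _ (2^-1%:E * ((l `^ p)%:E + (l `^ p)%:E))%E).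
    by apply: lee_wpmul2l (leeD E1 E2); rewrite lee_fin invr_ge0.
  have half2 (t : R) : 2^-1 * (t + t) = t by field.
  by rewrite -[X in (X <= _)%E]/((2^-1 * (l `^ p + l `^ p))%:E) half2.
Qed.

(** Integrating [uniform_convexity] bounds the energy of the difference by
    [e (E1 + E2) + C ((E1 + E2)/2 - E12)]. The midpoint is admissible, so [E12 >= m^p], while [E1]
    and [E2] are at most [L = (m + d)^p]. Each of the two terms is made at most [eta / 2]. *)
Lemma admissible_close eta : 0 < eta -> exists2 d, 0 < d & forall u1 D1 u2 D2,
  admissible u1 D1 (m + d) -> admissible u2 D2 (m + d) ->
  (energy p (fun x => D1 x - D2 x)%R <= eta%:E)%E.
Proof.
move=> eta0.
have K0 : 0 < (m + 1) `^ p by rewrite powR_gt0// addr_gt0.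
(* Both energies will be at most [(m + 1)^p], so [e (E1 + E2) <= eta / 2]. *)
pose e := eta / (4 * (m + 1) `^ p).
have e0 : 0 < e by rewrite divr_gt0// mulr_gt0.
have [C C0 hC] := uniform_convexity p1 n e0.
have eC0 : 0 < eta / (2 * (C + 1)) by rewrite divr_gt0// mulr_gt0// ltr_wpDl.
have /cvgrPdist_le/(_ _ eC0)/nbhs_ballP[d0 /= d00 hd] := @continuous_norm_powR R p p0 m.
(* The 1 keeps the energies below [(m + 1)^p]. The [d0 / 2] puts [L] within [eta / (2 (C + 1))] of
   [m^p], by continuity of the power at [m]. *)
exists (Num.min 1 (d0 / 2)); first by rewrite lt_min ltr01 divr_gt0.
set d := Num.min _ _; move=> u1 D1 u2 D2 a1 a2.
have d_gt0 : 0 < d by rewrite lt_min ltr01 divr_gt0.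
have d1 : d <= 1 by rewrite ge_min lexx.
set L := (m + d) `^ p.
have L1 : L <= (m + 1) `^ p.
  apply: ge0_ler_powR; rewrite ?nnegrE ?lerD2l//; first exact: ltW.
    by rewrite ltW// addr_gt0.
  by rewrite ltW// addr_gt0.
have Lm : L <= m `^ p + eta / (2 * (C + 1)).
  have : ball m d0 (m + d).
    rewrite /ball/= opprD addNKr normrN gtr0_norm//.
    apply: (@le_lt_trans _ _ (d0 / 2)); first by rewrite ge_min lexx orbT.
    by rewrite ltr_pdivrMr// mulr_natr mulr2n ltrDl.
  have md0 : 0 < m + d by rewrite addr_gt0.
  move=> /hd; rewrite /= (gtr0_norm m0) (gtr0_norm md0) distrC.
  by move=> /(le_trans (ler_norm _)); rewrite lerBlDl.
have [g1 _ _] := a1; have [g2 _ _] := a2.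
have [_ _ E1] := g1; have [_ _ E2] := g2.
have mD1 := grad_le_measurable g1; have mD2 := grad_le_measurable g2.
have md0 : 0 <= m + d by rewrite ltW// addr_gt0.
have a12 := admissible_midpoint md0 a1 a2.
have [g12 _ _] := a12.
have mD12 := grad_le_measurable g12.
have E12 := admissible_energy_ge a12.
set D12 := (fun x => _ *: D1 x + _) in E12 mD12 g12.
have mB i : measurable_fun setT (fun x => (D1 x - D2 x) ord0 i).
  rewrite (_ : (fun x => _) = (fun x => D1 x ord0 i - D2 x ord0 i)).
    exact: measurable_funB.
  by apply/funext => x; rewrite !mxE.
set X := energy p (fun x => D1 x - D2 x)%R.
have ineq : (X + C%:E * energy p D12 <=
    (e + C / 2)%:E * (energy p D1 + energy p D2))%E.
  apply: ge0_le_integral_combination => //.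
  - exact: measurable_energy.
  - exact: measurable_energy.
  - exact: measurable_energy.
  - exact: measurable_energy.
  - by move=> x; rewrite lee_fin powR_ge0.
  - by move=> x; rewrite lee_fin powR_ge0.
  - by move=> x; rewrite lee_fin powR_ge0.
  - by move=> x; rewrite lee_fin powR_ge0.
  - by apply: addr_ge0; [exact: ltW|exact: divr_ge0].
  - move=> x.
    set f12 := enorm (D1 x - D2 x) `^ p; set f1 := enorm (D1 x) `^ p.
    set f2 := enorm (D2 x) `^ p; set f := enorm (D12 x) `^ p.
    suff : f12 + C * f <= (e + C / 2) * (f1 + f2) by rewrite -lee_fin.
    have := hC (D1 x) (D2 x); rewrite /midpoint_gap/= scalerDr -/(D12 x).
    rewrite -/f12 -/f1 -/f2 -/f => h.
    have := lerD h (lexx (C * f)).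
    rewrite (_ : e * (f1 + f2) + _ + C * f = (e + C / 2) * (f1 + f2))//.
    by field.
have X0 : (0 <= X)%E by exact: energy_ge0.
have up : ((e + C / 2)%:E * (energy p D1 + energy p D2) <= ((e + C / 2) * (L + L))%:E)%E.
  rewrite EFinM; apply: lee_wpmul2l; last exact: leeD E1 E2.
  by rewrite lee_fin; apply: addr_ge0; [exact: ltW|exact: divr_ge0].
have lo : (X + (C * m `^ p)%:E <= X + C%:E * energy p D12)%E.
  apply: leeD2l; rewrite EFinM; apply: lee_wpmul2l E12.
  by rewrite lee_fin.
clearbody X.
have hX := le_trans lo (le_trans ineq up).
clear ineq lo up.
have el : e * L <= eta / 4.
  apply: (@le_trans _ _ (e * (m + 1) `^ p)); first by apply: ler_wpM2l => //; exact: ltW.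
  by rewrite /e invfM mulrA divfK// gt_eqF.
have Cl : C * (eta / (2 * (C + 1))) <= eta / 2.
  have C1 : 0 < C + 1 by rewrite ltr_wpDl.
  rewrite invfM [eta * _]mulrA mulrCA; apply: ler_piMr; first by rewrite divr_ge0// ltW.
  by rewrite ler_pdivrMr// mul1r lerDl.
have CLm : C * L <= C * (m `^ p + eta / (2 * (C + 1))) by apply: ler_wpM2l.
case: X X0 hX => [x| |]// x0 h; rewrite lee_fin.
have {}h : x + C * m `^ p <= (e + C / 2) * (L + L) by exact: h.
move: Cl CLm el h; set Q := C * (eta / _); set P := C * m `^ p; set N := e * L.
set Z := C * L; rewrite mulrDr -/Q -/P mulrDl => h1 h2 h3 h4.
have h5 : e * (L + L) = N + N by rewrite mulrDr.
have h6 : C / 2 * (L + L) = Z by rewrite /Z; field.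
by rewrite h5 h6 in h4; lra.
Qed.

Lemma minimizing_sequence : exists (u_ : nat -> 'rV[R]_n -> R) (D_ : nat -> 'rV[R]_n -> 'rV[R]_n),
  (forall k, admissible (u_ k) (D_ k) (m + k.+1%:R^-1)) /\
  (forall j k, (j <= k)%N -> (energy p (fun x => D_ k x - D_ j x)%R <= (4^-1 ^+ j)%:E)%E).
Proof.
have /choice[d hd] : forall k, exists d, 0 < d /\ forall u1 D1 u2 D2,
    admissible u1 D1 (m + d) -> admissible u2 D2 (m + d) ->
    (energy p (fun x => D1 x - D2 x)%R <= (4^-1 ^+ k)%:E)%E.
  move=> k; have k0 : (0 : R) < 4^-1 ^+ k by rewrite exprn_gt0// invr_gt0.
  by have [d d0 h] := admissible_close k0; exists d.
(* This slack is at most [1/(k+1)] and at most each of [d 0, .., d k], so the [k]-th function meets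
   every earlier closeness requirement as well. *)
pose t (k : nat) : R := \big[Num.min/k.+1%:R^-1]_(j < k.+1) d j.
have t0 k : 0 < t k.
  rewrite /t; elim/big_ind : _ => [|x y x0 y0|]; first by rewrite invr_gt0.
    by rewrite lt_min x0.
  by move=> j _; have [] := hd j.
have tk k : t k <= k.+1%:R^-1 by exact: bigmin_le_id.
have td j k : (j <= k)%N -> t k <= d j.
  by move=> jk; apply: (@bigmin_le _ _ _ _ (Ordinal (_ : (j < k.+1)%N))).
have /choice[u_ hu] : forall k, exists u, exists D, admissible u D (m + t k).
  by move=> k; have [u [D h]] := near (t0 k); exists u, D.
have /choice[D_ hD] := hu.
have mono k s : t k <= s -> admissible (u_ k) (D_ k) (m + s).
  move=> ts; have [g g0 go] := hD k; split => //.
  apply: (grad_le_trans p1 _ _ g); first by rewrite ltW// addr_gt0.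
  by rewrite lerD2l.
exists u_, D_; split => [k|j k jk]; first exact: mono.
have [_ h] := hd j; apply: h; apply: mono; exact: td.
Qed.

Section minimizer.
Let m_ge0 : 0 <= m. Proof. exact: ltW. Qed.

Variables (u_ : nat -> 'rV[R]_n -> R) (D_ : nat -> 'rV[R]_n -> 'rV[R]_n).
Hypothesis adm : forall k, admissible (u_ k) (D_ k) (m + k.+1%:R^-1).
Hypothesis close : forall j k, (j <= k)%N ->
  (energy p (fun x => D_ k x - D_ j x)%R <= (4^-1 ^+ j)%:E)%E.

Let gd k : grad_le p (u_ k) (D_ k) (m + k.+1%:R^-1). Proof. by have [] := adm k. Qed.

Let u_0 k : u_ k 0 = 0. Proof. by have [] := adm k. Qed.

Let u_omega k : u_ k omega = 1. Proof. by have [] := adm k. Qed.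

Let mk_ge0 k : 0 <= m + k.+1%:R^-1.
Proof. by rewrite addr_ge0// invr_ge0. Qed.

Let mD_ k i : measurable_fun setT (fun x => D_ k x ord0 i).
Proof. by have [_ wg _] := gd k; have [[]] := wg i. Qed.

(** Energy [4^-j] corresponds to the gradient bound [q^j]. *)
Let q : R := 4^-1 `^ p^-1.

Let q0 : 0 < q. Proof. by rewrite powR_gt0// invr_gt0. Qed.

Let q1 : q < 1.
Proof.
apply: (@lt_le_trans _ _ (1 `^ p^-1)); last by rewrite powR1.
by apply: gt0_ltr_powR; rewrite ?nnegrE ?invr_ge0 ?invr_gt0// invf_lt1// ltr1n.
Qed.

Let qp j : (q ^+ j) `^ p = 4^-1 ^+ j.
Proof.
have h4 : (0 : R) <= 4^-1 by rewrite invr_ge0.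
rewrite -(powR_mulrn j (ltW q0)) -(powR_mulrn j h4) /q -!powRrM.
by rewrite mulrCA mulVf ?mulr1// gt_eqF.
Qed.

Let difference_grad_le j k : (j <= k)%N ->
  grad_le p (fun x => u_ k x - u_ j x) (fun x => D_ k x - D_ j x) (q ^+ j).
Proof.
move=> jk; have [ck wk _] := gd k; have [cj wj _] := gd j.
split; last by rewrite qp; exact: close.
- by move=> x; apply: (@continuousB _ _ _ (u_ k) (u_ j)); [exact: ck|exact: cj].
- have := weak_gradientD 1 (-1) 0 ck cj wk wj.
  rewrite (_ : (fun x => 1 * u_ k x + _ + 0) = (fun x => u_ k x - u_ j x)); last first.
    by apply/funext => x; rewrite mul1r mulN1r addr0.
  rewrite (_ : (fun x => 1 *: D_ k x + _) = (fun x => D_ k x - D_ j x))//.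
  by apply/funext => x; rewrite scale1r scaleN1r.
Qed.

Let h (x : 'rV[R]_n) := Cs * enorm x `^ alpha.

(** Both functions vanish at 0, so the sharp inequality between [x] and 0 controls their difference
    at [x]. *)
Let difference_le j k x : (j <= k)%N -> `|u_ k x - u_ j x| <= h x * q ^+ j.
Proof.
move=> jk; have qj0 : 0 <= q ^+ j by rewrite exprn_ge0// ltW.
have := sharp_morrey n1 np qj0 (difference_grad_le jk) x 0.
by rewrite !u_0 !subr0.
Qed.

Let h_ge0 x : 0 <= h x.
Proof. by rewrite mulr_ge0 ?powR_ge0// ltW. Qed.

Let u_cvg x : cvgn (u_ ^~ x).
Proof.
apply: (@cvgn_geometric_increments _ _ (h x) q) => //; first by rewrite ltW.
by move=> k; exact: difference_le.
Qed.

Let u x : R := limn (u_ ^~ x).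

Let u_le j x : `|u x - u_ j x| <= h x * q ^+ j.
Proof. by apply: (cvgn_le_dist (j := j) (@u_cvg x)) => k; exact: difference_le. Qed.

(** Continuity of [u] rests on this estimate, with [m + 1] dominating every [m + 1/(k+1)]. *)
Let u_hoelder x y : `|u x - u y| <= (Cs * (m + 1)) * enorm (x - y) `^ alpha.
Proof.
have uxy : (fun k => u_ k x - u_ k y) @ \oo --> u x - u y.
  by apply: cvgB; exact: u_cvg.
rewrite -[u x - u y]subr0; apply: (cvgn_le_dist (j := 0%N) uxy) => k _.
rewrite subr0; apply: le_trans (sharp_morrey n1 np (mk_ge0 k) (gd k) x y) _.
rewrite mulrAC; apply: ler_wpM2r; first exact: powR_ge0.
by apply: ler_wpM2l; [exact: ltW|rewrite lerD2l invf_le1// ler1n].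
Qed.

Lemma minimizer_exists : exists u D, admissible u D m.
Proof.
have [D [A [mA A0 mD DA]]] := riesz_fischer p1 mD_ (fun k => close (leqnSn k)).
have mDD j k i : measurable_fun setT (fun x => (D_ k x - D_ j x) ord0 i).
  rewrite (_ : (fun x => _) = (fun x => D_ k x ord0 i - D_ j x ord0 i)).
    exact: measurable_funB.
  by apply/funext => x; rewrite !mxE.
have mDE j i : measurable_fun setT (fun x => (D x - D_ j x) ord0 i).
  rewrite (_ : (fun x => _) = (fun x => D x ord0 i - D_ j x ord0 i)).
    exact: measurable_funB.
  by apply/funext => x; rewrite !mxE.
have DAs j x : A x -> (fun k => D_ (k + j)%N x) @ \oo --> D x.
  by move=> Ax; apply: (cvg_comp _ _ _ (DA x Ax)); exact: cvg_addnr.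
(* Fatou along the tail starting at [j]: shifting the index makes [close] available for every
   term. *)
have ED j : (energy p (fun x => D x - D_ j x)%R <= ((q ^+ j) `^ p)%:E)%E.
  rewrite qp; apply: (fatou_energy p1 (D_ := fun k x => D_ (k + j)%N x - D_ j x) mA A0).
  - by move=> k i; exact: mDD.
  - by move=> i; exact: mDE.
  - move=> x Ax; apply: cvgB; last exact: cvg_cst.
    exact: DAs.
  - by move=> k; apply: close; exact: leq_addl.
(* Dropping the first [N] terms brings all gradient bounds below [m + e], and [e] is arbitrary. *)
have Em : (energy p D <= (m `^ p)%:E)%E.
  apply/(normDu_le p1) => //; apply/lee_addgt0Pr => e e0.
  have [N _ hN] := near_infty_natSinv_lt (PosNum e0).
  have me0 : 0 <= m + e by rewrite addr_ge0// ltW.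
  rewrite -EFinD; apply/(normDu_le p1) => //.
  apply: (fatou_energy p1 (D_ := fun k x => D_ (k + N)%N x) mA A0) => //.
  - by move=> x; exact: DAs.
  - move=> k; suff [] : grad_le p (u_ (k + N)%N) (D_ (k + N)%N) (m + e) by [].
    apply: (grad_le_trans p1 (mk_ge0 _) _ (gd _)); rewrite lerD2l; apply: ltW.
    by apply: hN; exact: leq_addl.
have LD i : L1loc (fun x => D x ord0 i).
  by apply: (energy_L1loc p1 mD); apply: le_lt_trans Em _; rewrite ltry.
have cu : continuous u by exact: (continuous_hoelder u_hoelder).
exists u, D; split.
- split => //.
  apply: (@weak_gradient_limit _ _ p u_ D_ _ _ h (fun j => q ^+ j)) => //.
  - move=> x; rewrite /h; apply: (@continuousM _ _ (cst Cs) (fun x : 'rV[R]_n => enorm x `^ alpha)).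
      exact: cst_continuous.
    rewrite (_ : (fun x => _) = (fun x : 'rV[R]_n => `|enorm x| `^ alpha)); last first.
      by apply/funext => y; rewrite ger0_norm ?enorm_ge0.
    apply: (@continuous_comp _ _ _ (@enorm R n) (fun t => `|t| `^ alpha)).
      exact: continuous_enorm.
    exact: (continuous_norm_powR alpha_gt0).
  - by move=> j; have [] := gd j.
  - by move=> j; have [] := gd j.
  - by move=> j; rewrite exprn_gt0.
  - by apply: cvg_expr; rewrite gtr0_norm.
- by rewrite /u; under eq_fun do rewrite u_0; exact: lim_cst.
- by rewrite /u; under eq_fun do rewrite u_omega; exact: lim_cst.
Qed.

End minimizer.


End fixed_direction.

End existence.

Theorem lemma2p1 (R : realType) (n : nat) (p : R) :
  (1 <= n)%N -> n%:R < p ->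
  (exists (u : 'rV[R]_n -> R) (Du : 'rV[R]_n -> 'rV[R]_n),
    [/\ D1p p u, weak_gradient u Du,
        ~ (exists c : R, forall x, u x = c) &
        morrey_seminorm p u =
          ((sharp_morrey_constant n p)%:E * normDu p Du)%E]) /\
  0 < sharp_morrey_constant n p.
Proof.
move=> n1 np; have Cs0 := sharp_morrey_constant_gt0 n1 np; split => //.
set Cs := sharp_morrey_constant n p in Cs0 *.
have m0 : 0 < Cs^-1 by rewrite invr_gt0.
have p1 : 1 < p by apply: le_lt_trans np; rewrite ler1n.
have [omega omega1 near] := near_optimal_direction n1 np.
have [u_ [D_ [adm close]]] := minimizing_sequence n1 np omega1 near.
have [u [D au]] := minimizer_exists n1 np adm close.
have [gu u0 uo] := au; have [_ wg Em] := gu.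
exists u, D; split => //.
- exact: (grad_le_D1p p1 gu).
- by move=> [c uc]; move: uo; rewrite uc -(uc 0) u0 => /eqP; rewrite eq_sym oner_eq0.
(* The value [m] bounds the norm from above. Conversely the norm is itself a bound for which [u] is
   admissible, so it is at least [m]. *)
have -> : normDu p D = (Cs^-1)%:E.
  apply/eqP; rewrite eq_le; apply/andP; split.
    by apply/(normDu_le p1); [exact: ltW|].
  have := normDu_le p1 D; rewrite normDuE.
  have := energy_ge0 p D; move: Em; case E : (energy p D) => [r| |]// _ r0 hl.
  set l := fine ((r%:E `^ p^-1)%E).
  have l0 : 0 <= r `^ p^-1 by exact: powR_ge0.
  rewrite /= lee_fin.
  apply: (admissible_ge n1 np omega1 l0 (u := u) (D := D)).
  split => //; split; [by case: gu|exact: wg|].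
  by have [h _] := hl _ l0; rewrite E; apply: h; rewrite /=.
(* Both sides equal 1: the sharp inequality bounds the seminorm by [C_* m = 1], and the pair
   [omega], 0 attains it. *)
rewrite -EFinM mulfV ?gt_eqF//; apply/eqP; rewrite eq_le; apply/andP; split.
  apply: morrey_seminorm_le => x y; rewrite mul1r.
  have := sharp_morrey n1 np (ltW m0) gu x y.
  by rewrite mulrAC mulfV ?mul1r// gt_eqF.
apply: ereal_sup_ubound; exists (omega, 0).
  by apply/eqP => /= o0; move: omega1; rewrite o0 enorm0 => /eqP; rewrite eq_sym oner_eq0.
by rewrite /= u0 uo !subr0 omega1 powR1 divr1 normr1.
Qed.
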